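(* Let $\Phi$ be one of the root systems $A_{n-1}$, $B_n$, $C_n$, $D_n$, $BC_n$ with $n\ge 2$, with ambient space $V$ of dimension $l$ ($V=\{x\in\mathbb{R}^n: x_1+\cdots+x_n=0\}$, $l=n-1$, for $A_{n-1}$; $V=\mathbb{R}^n$, $l=n$, otherwise). Let $a,b$ be nonnegative integers, not both zero, with $a\le b$, and let $\hat{\mathcal A}=\hat{\mathcal A}^{[-a+1,b]}(\Phi)$. If $h$ denotes the number of hyperplanes of $\hat{\mathcal A}$, then every root of the characteristic polynomial $\chi(\hat{\mathcal A},q)$ has real part equal to $h/l$.
   Context: A hyperplane arrangement $\mathcal A$ in a real vector space $V$ is a finite set of affine hyperplanes of $V$. Let $L_{\mathcal A}$ be the poset, ordered by reverse inclusion, of all nonempty affine subspaces of $V$ that are intersections of some hyperplanes of $\mathcal A$ (including $V$ itself, the minimum $\hat 0$). The characteristic polynomial is $\chi(\mathcal A,q)=\sum_{x\in L_{\mathcal A}}\mu(\hat 0,x)\,q^{\dim x}$, where $\mu$ is the Möbius function of $L_{\mathcal A}$. For integers $c\le d$ and a root system $\Phi$ with chosen positive roots $\Phi^+$, $\hat{\mathcal A}^{[c,d]}(\Phi)$ is the arrangement in the ambient space of $\Phi$ consisting of the hyperplanes $(\alpha,x)=k$ for $\alpha\in\Phi^+$ and $k=c,c+1,\dots,d$. Here $e_1,\dots,e_n$ is the standard basis of $\mathbb{R}^n$ and the positive roots are: $A_{n-1}$: $e_i-e_j$ ($1\le i<j\le n$), acting on $V=\{x:\sum x_i=0\}$; $B_n$: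 $e_i$ and $e_i\pm e_j$ ($i<j$); $C_n$: $2e_i$ and $e_i\pm e_j$ ($i<j$); $D_n$: $e_i\pm e_j$ ($i<j$); $BC_n$ (the non-reduced system $B_n\cup C_n$): $e_i$, $2e_i$, and $e_i\pm e_j$ ($i<j$). *)

(* Defs.v *)
From HB Require Import structures.
From mathcomp Require Import all_boot all_order all_algebra.
From mathcomp Require Import all_classical all_reals.
From mathcomp Require Import complex.

Set Implicit Arguments.
Unset Strict Implicit.
Unset Printing Implicit Defensive.

Import Order.TTheory GRing.Theory Num.Theory.
Local Open Scope ring_scope.
Local Open Scope classical_set_scope.

Inductive root_type := TA | TB | TC | TD | TBC.

Section Defs.
Variable R : realType.

Definition evec (n : nat) (i : 'I_n) : 'rV[R]_n := \row_j (i == j)%:R.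

Definition dotv (n : nat) (u x : 'rV[R]_n) : R := \sum_(i < n) u 0 i * x 0 i.

Definition pos_roots (t : root_type) (n : nat) : seq 'rV[R]_n :=
  let minus := [seq evec i - evec j | i : 'I_n <- enum 'I_n,
                   j : 'I_n <- [seq j : 'I_n <- enum 'I_n | (i < j)%N]] in
  let plus := [seq evec i + evec j | i : 'I_n <- enum 'I_n,
                   j : 'I_n <- [seq j : 'I_n <- enum 'I_n | (i < j)%N]] in
  let short := [seq evec i | i : 'I_n <- enum 'I_n] in
  let long := [seq 2%:R *: evec i | i : 'I_n <- enum 'I_n] in
  match t with
  | TA => minus
  | TB => short ++ minus ++ plus
  | TC => long ++ minus ++ plus
  | TD => minus ++ plus
  | TBC => short ++ long ++ minus ++ plus
  end.

Definition ambient (t : root_type) (n : nat) : set 'rV[R]_n :=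
  match t with
  | TA => [set x | \sum_(i < n) x 0 i = 0]
  | _ => setT
  end.

Definition int_range (c d : int) : seq int :=
  [seq c + (i%:Z) | i <- iota 0 (absz (Num.max 0%R (d - c + 1)%R))].

(* The arrangement \hat A^{[c,d]}(Phi): the SET of hyperplanes
   {x in V | (alpha, x) = k}, alpha positive root, c <= k <= d.
   Hyperplanes are point sets, so coinciding ones (e.g. x_i = 1 and
   2 x_i = 2 in type BC) are counted once (undup). *)
Definition arrangement (t : root_type) (n : nat) (c d : int)
  : seq (set 'rV[R]_n) :=
  undup [seq [set x | @ambient t n x /\ dotv al x = k%:~R]
        | al <- pos_roots t n, k <- int_range c d].

Definition flat (n : nat) (V : set 'rV[R]_n) (A : seq (set 'rV[R]_n))
  (J : {set 'I_(size A)}) : set 'rV[R]_n :=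
  V `&` [set x | forall i : 'I_(size A), i \in J -> (nth set0 A i) x].

(* the intersection poset L_A: all nonempty intersections (V included),
   listed without repetition; order is reverse inclusion *)
Definition intersection_poset (n : nat) (V : set 'rV[R]_n)
  (A : seq (set 'rV[R]_n)) : seq (set 'rV[R]_n) :=
  undup [seq @flat n V A J | J <- enum [set: {set 'I_(size A)}] & @flat n V A J != set0].

(* Moebius function mu(0^, x) of L (minimum 0^ = bot, y < x iff x strictly
   contained in y), computed by the defining recursion
   mu(0^,0^) = 1,  mu(0^,x) = - sum_{0^ <= y < x} mu(0^,y).
   The fuel k is never exhausted when k = size L (chains in L have at
   most size L elements). *)
Fixpoint mobius_fuel (n : nat) (L : seq (set 'rV[R]_n)) (bot : set 'rV[R]_n)
  (k : nat) (x : set 'rV[R]_n) : int :=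
  if x == bot then 1 else
  match k with
  | 0 => 0
  | k'.+1 => - \sum_(y <- L | `[< x `<=` y >] && (y != x)) mobius_fuel L bot k' y
  end.

Definition mobius (n : nat) (L : seq (set 'rV[R]_n)) (bot : set 'rV[R]_n)
  (x : set 'rV[R]_n) : int := mobius_fuel L bot (size L) x.

Definition adim (n : nat) (X : set 'rV[R]_n) : nat :=
  \max_(d < n.+1 | `[< exists x0, X x0 /\ exists vs : seq 'rV[R]_n,
        [/\ size vs = d, free vs & forall v, v \in vs -> X (x0 + v)] >]) d.

Definition arr_char_poly (n : nat) (V : set 'rV[R]_n) (A : seq (set 'rV[R]_n))
  : {poly int} :=
  let L := intersection_poset V A in
  \sum_(x <- L) (mobius L V x) *: 'X^(adim x).

End Defs.
Arguments ambient R t n : clear implicits.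

Definition ambient_dim (t : root_type) (n : nat) : nat :=
  if t is TA then n.-1 else n.

(* Main.v *)
(** Put [m = b + 1 - a].  For every large prime [p], [chi.[p]] is the number
[N p] of points of the ambient space over [F_p] lying on no hyperplane: both are
the same inclusion-exclusion sum, since ranks of integer matrices are preserved
modulo [p].

Lift the coordinates of a point to integers (type [A]: normalised by one
coordinate; otherwise together with their negatives, modulo [p]) and sort them.
The order is recorded by a word [w], the positions by gaps [g_i >= 0] between
consecutive sites with [sum_i c_i g_i = p], where the [c_i] are the marks of the
affine diagram.  It suffices to test consecutive sites: the point is off the
arrangement iff [g_i >= a], and [g_i >= a + m] when [w] descends at [i].  So [N p]
is a sum over words of numbers [rho (p - a c - m des w)] of gap vectors, with
[c = sum_i c_i]; for [a = b = 0] the same sum counts all points.  Splitting gaps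
by their residues [k_i] modulo [m] gives
  [m^l N p = sum_k (p - a c - sum_i c_i k_i)^l],
over the [k] in [0, m)^(l+1) for which [m] divides the base.

A roots-of-unity filter rewrites this as the value at [p] of [G(S) q^l], where [S]
is the shift [f(q) |-> f(q - 1)].  The terms divisible by [(S - 1)^(l+1)] vanish,
and the roots of [G] that remain are [0] or of modulus [1].  If all roots of [f]
have real part [r] and [|z| = 1], those of [f(q - 1) - z f(q)] have real part
[r + 1/2]; hence all roots of [chi] have the same real part, which is [h / l]
because [chi] is monic with next coefficient [-h]. *)

Require Import Defs.
From HB Require Import structures.
From mathcomp Require Import all_boot all_order all_algebra all_fingroup
  all_solvable all_field all_character.
From mathcomp Require Import boolp complex.
From mathcomp Require Import zify ring lra.
Set Implicit Arguments.
Unset Strict Implicit.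
Unset Printing Implicit Defensive.
Import Order.TTheory GRing.Theory Num.Theory.

(** * Sorting permutations *)

(** The number of words with a given weighted number of descents is never computed. With [a = b = 0]
    no level is forbidden, so the word sum must be a constant times [j ^ l] for every modulus
    [j > 0], prime or not. Dividing the gaps by [m] turns each penalty [m * des w] into [des w], and
    these identities then remove the words. This is why sites are counted among integers, for every
    modulus, and not inside a field.

    The obstacle is that the levels [1 - a, ..., b] are not symmetric about 0, so the order of two
    sites does not tell which separation they require. Labels do: they break ties between coinciding
    sites, and a descent between distant sites forces one between consecutive sites, which reduces
    all roots to the walls.

    After the filter only [v = 1] and [v = -1] can remain. The relative sign of their terms must not
    depend on [p], hence the restriction to odd primes, and the sum must keep its roots at 0 or on
    the unit circle. The latter rests on how many marks equal 1: all of them, or 1, 2 or 4. *)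

Section SortingPermutation.
Variables (n : nat) (lt : rel 'I_n).
Hypotheses (lt_irr : irreflexive lt) (lt_trans : transitive lt)
  (lt_total : forall i j, i != j -> lt i j || lt j i).

Definition sorts (s : {perm 'I_n}) := forall i j : 'I_n, (i < j)%N -> lt (s i) (s j).

Lemma lt_sorts s i j : sorts s -> lt (s i) (s j) = (i < j)%N.
Proof.
move=> hs; apply/idP/idP => [lt_ij|/hs//].
rewrite ltnNge leq_eqVlt; apply/negP => /orP[/eqP/val_inj e|/hs lt_ji].
  by rewrite e lt_irr in lt_ij.
by have := lt_trans lt_ij lt_ji; rewrite lt_irr.
Qed.

(** In a sorted enumeration the index of an element is the number of elements below it, which
    depends on [lt] alone. Existence inverts the same rank function. *)
Lemma sorts_uniq s t : sorts s -> sorts t -> s = t.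
Proof.
have rank u i : sorts u -> #|[pred j | lt j (u i)]| = i :> nat.
  move=> hu; rewrite -(card_image (@perm_inj _ u^-1)).
  rewrite (eq_card (B := [pred j : 'I_n | (j < i)%N])) => [|j].
    rewrite -sum1_card (big_ord_narrow (ltnW (ltn_ord i))) /=.
    by rewrite sum1_card card_ord.
  rewrite !inE; apply/imageP/idP => [[k]|lt_ji].
    by rewrite inE => + ->; rewrite -{1}(permKV u k) lt_sorts.
  by exists (u j); rewrite ?inE ?lt_sorts ?permK.
move=> hs ht; apply/permP => i; apply: contraTeq isT => ne.
have [k sk] : exists k, s i = t k by exists (t^-1 (s i))%g; rewrite permKV.
have := rank s i hs; rewrite sk rank // => /val_inj ki.
by rewrite sk ki eqxx in ne.
Qed.

Lemma sorts_exists : exists s, sorts s.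
Proof.
pose rk i := #|[pred j | lt j i]|.
have rk_lt i j : lt i j -> (rk i < rk j)%N.
  move=> ij; apply: proper_card; apply/properP; split.
    by apply/subsetP => k; rewrite !inE => /lt_trans; apply.
  by exists i; rewrite !inE ?lt_irr.
have rk_bound i : (rk i < n)%N.
  rewrite -[ltnRHS](card_ord n); apply: proper_card; apply/properP; split.
    exact/subsetP.
  by exists i; rewrite ?inE ?lt_irr.
have inj : injective (fun i => Ordinal (rk_bound i)).
  move=> i j [e]; apply/eqP; apply: contraT => /lt_total/orP[]/rk_lt; rewrite e ltnn //.
pose t := perm inj; exists t^-1%g => i j lt_ij.
have ne : t^-1%g i != t^-1%g j by rewrite (inj_eq perm_inj) -val_eqE /= ltn_eqF.
have tE k : (t (t^-1%g k) : nat) = rk (t^-1%g k) by rewrite permE.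
case/orP: (lt_total ne) => // /rk_lt; rewrite -!tE !permKV => /ltn_trans/(_ lt_ij).
by rewrite ltnn.
Qed.

End SortingPermutation.

Local Open Scope ring_scope.

(** * Shift operators and the real parts of roots *)

Section ShiftOperators.
Variable R : rcfType.
Notation C := R[i].
Implicit Types (f g G H : {poly C}) (z r : C).

Definition shift (d : nat) f := f \Po ('X - (d%:R)%:P).

(* [act G f] is [G] evaluated at the operator [shift 1] and applied to [f]. *)
Definition act G f : {poly C} := \sum_(i < size G) G`_i *: shift i f.

Lemma shift0 f : shift 0 f = f.
Proof. by rewrite /shift subr0 comp_polyXr. Qed.

Lemma shiftZ d z f : shift d (z *: f) = z *: shift d f.
Proof. exact: comp_polyZ. Qed.

Lemma shift_comp d e f : shift d (shift e f) = shift (d + e) f.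
Proof.
rewrite /shift -comp_polyA comp_polyB comp_polyX comp_polyC natrD polyCD.
by congr (_ \Po _); rewrite opprD addrA.
Qed.

Lemma horner_shift d f x : (shift d f).[x] = f.[x - d%:R].
Proof. by rewrite horner_comp !hornerE. Qed.

Lemma act_widen n G f : (size G <= n)%N -> act G f = \sum_(i < n) G`_i *: shift i f.
Proof.
move=> sGn; rewrite /act (big_ord_widen n (fun i => G`_i *: shift i f)) //.
rewrite big_mkcond; apply: eq_bigr => i _; case: ltnP => // leGi.
by rewrite nth_default // scale0r.
Qed.

Lemma actD G H f : act (G + H) f = act G f + act H f.
Proof.
rewrite (@act_widen (maxn (size G) (size H))) ?size_polyD //.
rewrite (@act_widen (maxn (size G) (size H)) G) ?leq_maxl //.
rewrite (@act_widen (maxn (size G) (size H)) H) ?leq_maxr //.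
by rewrite -big_split; apply: eq_bigr => i _; rewrite coefD scalerDl.
Qed.

Lemma actZ z G f : act (z *: G) f = z *: act G f.
Proof.
rewrite (@act_widen (size G)) ?size_scale_leq // scaler_sumr.
by apply: eq_bigr => i _; rewrite coefZ scalerA.
Qed.

Lemma act0 f : act 0 f = 0.
Proof. by rewrite /act size_poly0 big_ord0. Qed.

Lemma act_sum I (s : seq I) (P : pred I) (F : I -> {poly C}) f :
  act (\sum_(i <- s | P i) F i) f = \sum_(i <- s | P i) act (F i) f.
Proof.
apply: (big_morph (fun G => act G f) (id1 := 0) (op1 := +%R)); last exact: act0.
by move=> G H; rewrite actD.
Qed.

Lemma actXn n f : act 'X^n f = shift n f.
Proof.
rewrite /act size_polyXn big_ord_recr /= coefXn eqxx scale1r big1 ?add0r // => i _.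
by rewrite coefXn ltn_eqF ?scale0r.
Qed.

Lemma act1 f : act 1 f = f.
Proof. by rewrite -[1]/('X^0) actXn shift0. Qed.

Lemma act_mulX G f : act ('X * G) f = shift 1 (act G f).
Proof.
rewrite (@act_widen (size G).+1); last first.
  by apply: leq_trans (size_polyMleq _ _) _; rewrite size_polyX.
rewrite big_ord_recl /= mulrC coefMX /= scale0r add0r /act.
rewrite (big_morph (shift 1) (id1 := 0) (op1 := +%R)) ?/shift ?comp_poly0 //; last first.
  by move=> ? ?; rewrite comp_polyD.
apply: eq_bigr => i _; rewrite coefMX /= -/(shift 1 _) -/(shift (bump 0 i) _).
by rewrite shiftZ shift_comp.
Qed.

Lemma act_mulXn n G f : act ('X^n * G) f = shift n (act G f).
Proof.
elim: n => [|n IHn]; first by rewrite mul1r shift0.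
by rewrite exprS -mulrA act_mulX IHn shift_comp.
Qed.

Lemma act_mulXsubC z G f :
  act (('X - z%:P) * G) f = shift 1 (act G f) - z *: act G f.
Proof. by rewrite mulrBl actD act_mulX -scaleN1r mul_polyC !actZ scaleN1r. Qed.

Lemma size_shift d f : size (shift d f) = size f.
Proof. by rewrite /shift size_comp_poly2 // size_XsubC. Qed.

Lemma size_shiftB d f : (size (shift d f - f)%R <= (size f).-1)%N.
Proof.
have [->|f0] := eqVneq f 0; first by rewrite /shift comp_poly0 subrr size_poly0.
apply/leq_sizeP => j; rewrite leq_eqVlt => /predU1P[<-|lt_f_j].
  have : lead_coef (shift d f) = lead_coef f.
    by rewrite /shift lead_coef_comp ?size_XsubC // lead_coefXsubC expr1n mulr1.
  by rewrite !lead_coefE size_shift coefB => ->; rewrite subrr.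
by rewrite coefB !nth_default ?subrr ?size_shift //; move: lt_f_j; case: (size f).
Qed.

(* Each factor [shift 1 - 1] lowers the degree. *)
Lemma act_kill N G f : (size f <= N)%N -> ('X - 1%:P) ^+ N %| G -> act G f = 0.
Proof.
move=> sfN /dvdpP[q ->]; rewrite mulrC => {G}.
have : (size (act (('X - 1%:P) ^+ N * q) f) <= size f - N)%N.
  elim: N {sfN} => [|N IHN].
    rewrite mul1r subn0 /act; apply: (big_ind (fun g => (size g <= size f)%N)).
    - by rewrite size_poly0.
    - by move=> g1 g2 h1 h2; apply: leq_trans (size_polyD _ _) _; rewrite geq_max h1.
    - by move=> i _; apply: leq_trans (size_scale_leq _ _) _; rewrite size_shift.
  rewrite exprS -mulrA act_mulXsubC scale1r.
  by apply: leq_trans (size_shiftB _ _) _; rewrite subnS -!subn1 leq_sub2r.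
by move: sfN; rewrite -subn_eq0 => /eqP-> ; rewrite leqn0 size_poly_eq0 => /eqP.
Qed.

(** A nonzero constant is aligned vacuously, but 0 is not, since every number is a root of it; hence
    the alternative [f = 0] in the closure lemmas. *)
Definition aligned f := exists r : R, forall z, root f z -> complex.Re z = r.

Lemma normc_lt (u v : C) : `|complex.Re u| < `|complex.Re v| ->
  complex.Im u = complex.Im v -> `|u| < `|v|.
Proof.
move=> ltuv eI; rewrite !normc_def ltcR eI.
have h : complex.Re u ^+ 2 < complex.Re v ^+ 2.
  by rewrite -[_ ^+ 2]real_normK ?num_real // -[ltRHS]real_normK ?num_real // ltr_pXn2r ?nnegrE.
rewrite ltr_sqrt ?ltrD2r // ltr_pwDl ?sqr_ge0 //.
by apply: le_lt_trans h; rewrite sqr_ge0.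
Qed.

(* At a root [x] one has [|f (x - 1)| = |f x|]; when [Re x] is not [r + 1/2], every
   factor of one side is smaller than the corresponding factor of the other. *)
Lemma aligned_shift_sub z f : `|z| = 1 ->
  f = 0 \/ aligned f -> shift 1 f - z *: f = 0 \/ aligned (shift 1 f - z *: f).
Proof.
move=> z1 [->|[r hr]]; first by left; rewrite /shift comp_poly0 scaler0 subr0.
have [f0|f0] := eqVneq f 0.
  by left; rewrite f0 /shift comp_poly0 scaler0 subr0.
have [rs frs] := closed_field_poly_normal f.
have lc0 : lead_coef f != 0 by rewrite lead_coef_eq0.
(* A constant [f] has no factors to compare strictly; the result is again a constant, possibly 0. *)
case: rs frs => [|r0 rs'] frs.
  rewrite frs big_nil; set c := lead_coef f.
  have -> : shift 1 (c *: 1) - z *: (c *: 1) = ((1 - z) * c)%:P.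
    rewrite -mul_polyC mulr1 /shift comp_polyC -mul_polyC -polyCM -polyCB.
    by rewrite mulrBl mul1r.
  have [->|e] := eqVneq ((1 - z) * c) 0; first by left; rewrite polyC0.
  by right; exists 0 => x; rewrite rootC (negPf e).
right; set rs := r0 :: rs' in frs.
have rsr x : x \in rs -> complex.Re x = r.
  by move=> xrs; apply: hr; rewrite frs rootZ ?root_prod_XsubC.
have fE x : f.[x] = lead_coef f * \prod_(y <- rs) (x - y).
  rewrite {1}frs hornerZ horner_prod; congr (_ * _).
  by apply: eq_bigr => y _; rewrite !hornerE.
exists (r + 2^-1) => x; rewrite /root hornerD hornerN hornerZ horner_shift subr_eq0.
move=> /eqP/(congr1 Num.norm); rewrite normrM z1 mul1r !fE !normrM !normr_prod.
have nlc : `|lead_coef f| != 0 by rewrite normr_eq0.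
move/(mulfI nlc) => eqp.
have key (u v : C) : `|complex.Re u - r| < `|complex.Re v - r| ->
   complex.Im u = complex.Im v ->
   \prod_(y <- rs) `|u - y| < \prod_(y <- rs) `|v - y|.
  move=> lt_uv eIm.
  have lty y : y \in rs -> `|u - y| < `|v - y|.
    move=> /rsr yr; apply: normc_lt; move: lt_uv eIm; rewrite -yr.
      by case: u v y yr => [? ?] [? ?] [].
    by case: u v y yr => [? ?] [? ?] [? ?] _ _ /= ->.
  rewrite big_seq [ltRHS]big_seq; apply: ltr_prod => [|y yrs]; last by rewrite normr_ge0 lty.
  by apply/hasP; exists r0; rewrite mem_head.
have [lt_s|lt_s|//] := ltgtP (complex.Re x) (r + 2^-1).
- have := key x (x - 1%:R); rewrite eqp ltxx; case: (x) lt_s => u v /= lt_s H.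
  exfalso; apply: notF; apply: H; last by rewrite subr0.
  by rewrite [ltRHS]ler0_norm ?ltr_norml; [apply/andP; split; lra | lra].
- have := key (x - 1%:R) x; rewrite eqp ltxx; case: (x) lt_s => u v /= lt_s H.
  exfalso; apply: notF; apply: H; last by rewrite subr0.
  by rewrite [ltRHS]ger0_norm ?ltr_norml; [apply/andP; split; lra | lra].
Qed.

Lemma aligned_shift d f : f = 0 \/ aligned f -> shift d f = 0 \/ aligned (shift d f).
Proof.
case=> [->|[r hr]]; first by left; rewrite /shift comp_poly0.
right; exists (r + d%:R) => z; rewrite /root horner_shift => /hr <-.
case: z => u v /=; rewrite raddfB /=.
by have -> : complex.Re (d%:R : C) = d%:R; [rewrite -(rmorph_nat (real_complex R)) | rewrite subrK].
Qed.

Lemma alignedZ z f : f = 0 \/ aligned f -> z *: f = 0 \/ aligned (z *: f).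
Proof.
case=> [->|[r hr]]; first by left; rewrite scaler0.
have [->|z0] := eqVneq z 0; first by left; rewrite scale0r.
by right; exists r => x; rewrite rootZ // => /hr.
Qed.

Lemma aligned_act G f : (forall z, root G z -> z = 0 \/ `|z| = 1) ->
  f = 0 \/ aligned f -> act G f = 0 \/ aligned (act G f).
Proof.
move=> hG hf; have [->|G0] := eqVneq G 0; first by left; rewrite act0.
have [rs Grs] := closed_field_poly_normal G.
have {}hG z : z \in rs -> z = 0 \/ `|z| = 1.
  by move=> zrs; apply: hG; rewrite Grs rootZ ?lead_coef_eq0 ?root_prod_XsubC.
rewrite Grs actZ; apply: alignedZ => {Grs}.
elim: rs hG => [|z rs IH] hz; first by rewrite big_nil act1.
have {}IH := IH (fun y yrs => hz y (mem_behead (s := z :: rs) yrs)).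
rewrite big_cons act_mulXsubC; have [->|z1] := hz z (mem_head _ _).
  by rewrite scale0r subr0; apply: aligned_shift.
exact: aligned_shift_sub.
Qed.

Lemma alignedXn n : aligned 'X^n.
Proof.
exists 0 => z; case: n => [|n]; first by rewrite expr0 (negPf (root1 z)).
by rewrite /root hornerXn expf_eq0 => /= /eqP->.
Qed.

(** By Vieta the roots sum to [h], and the [l] of them share one real part. *)
Lemma aligned_sum_roots (p : {poly C}) l (h : R) : p \is monic -> (size p = l.+1)%N ->
  (0 < l)%N -> p`_l.-1 = - (h%:C)%C -> aligned p -> forall z, root p z -> complex.Re z = h / l%:R.
Proof.
move=> pm sp l0 pc [r hr] z /hr ->.
have [rs prs] := closed_field_poly_normal p.
rewrite (monicP pm) scale1r in prs.
have srs : size rs = l by apply: succn_inj; rewrite -sp prs size_prod_XsubC.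
have : complex.Re (\sum_(x <- rs) x) = h.
  have : - \sum_(x <- rs) x = - (h%:C)%C.
    by rewrite -pc prs -srs -coefPn_prod_XsubC // srs -lt0n.
  by move/oppr_inj => ->.
have -> : complex.Re (\sum_(x <- rs) x) = r *+ l.
  rewrite raddf_sum /= (eq_big_seq (fun=> r)) => [|x xrs].
    by rewrite big_const_seq count_predT iter_addr addr0 srs.
  by apply: hr; rewrite prs root_prod_XsubC.
by move=> <-; rewrite -[r *+ l]mulr_natr mulfK // pnatr_eq0 -lt0n.
Qed.

End ShiftOperators.

(** * A roots-of-unity filter *)

(* The argument of [C_prim_root_exists], which is restricted to [algC]. *)
Lemma closed_prim_root (F : numClosedFieldType) n : (0 < n)%N -> exists z : F, n.-primitive_root z.
Proof.
move=> n_gt0; have [r Dp] := closed_field_poly_normal ('X^n - 1 : {poly F}).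
rewrite (monicP _) ?monicXnsubC // scale1r in Dp.
have rn1 : all n.-unity_root r by apply/allP => z; rewrite -root_prod_XsubC -Dp.
have sz_r : (n <= size r)%N.
  by rewrite -ltnS -(size_prod_XsubC r id) -Dp size_XnsubC.
have [|z _ prz] := hasP (has_prim_root n_gt0 rn1 _ sz_r); last by exists z.
by rewrite -separable_prod_XsubC -Dp separable_Xn_sub_1 // pnatr_eq0 -lt0n.
Qed.

Lemma prim_root_neq0 (F : fieldType) n (z : F) : n.-primitive_root z -> z != 0.
Proof.
move=> pz; apply/eqP => z0; have /eqP := prim_expr_order pz.
by rewrite z0 expr0n gtn_eqF ?(prim_order_gt0 pz) // eq_sym oner_eq0.
Qed.

Section RootsOfUnityFilter.
Variables (R : rcfType) (l : nat) (c : 'I_l.+1 -> nat) (m : nat).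
Notation C := R[i].

Definition wsum n (k : {ffun 'I_l.+1 -> 'I_n}) : nat := \sum_i c i * k i.

(** Expanding the product gives one monomial [(v *: 'X) ^+ wsum k] for each residue vector [k], so
    [act] turns it into the weighted sum over all [k]. The product form is what exposes its
    roots. *)
Definition twist (v : C) : {poly C} := \prod_i \sum_(k < m) (v *: 'X) ^+ (c i * k).

Lemma horner_act_twist v f x : (act (twist v) f).[x] =
  \sum_(k : {ffun 'I_l.+1 -> 'I_m}) v ^+ wsum k * f.[x - (wsum k)%:R].
Proof.
rewrite /twist bigA_distr_bigA act_sum horner_sum; apply: eq_bigr => k _.
have -> : \prod_i (v *: 'X) ^+ (c i * k i) = v ^+ wsum k *: 'X^(wsum k).
  by rewrite -expr_sum exprZn.
by rewrite actZ actXn hornerZ horner_shift.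
Qed.

Lemma sum_expr_root1 n (u : C) : u ^+ n = 1 -> \sum_(k < n) u ^+ k = if u == 1 then n%:R else 0.
Proof.
move=> un; case: eqP => [->|/eqP u1].
  by rewrite (eq_bigr (fun=> 1)) => [|i _]; rewrite ?expr1n // sumr_const card_ord.
have : (u - 1) * \sum_(k < n) u ^+ k = 0 by rewrite -subrX1 un subrr.
by move/eqP; rewrite mulf_eq0 subr_eq0 (negPf u1) => /eqP.
Qed.

(** Each of the [l.+1] factors is, at 1, a full geometric sum over a nontrivial [m]-th root of unity
    and so vanishes there; this exceeds the degree of ['X^l]. *)
Lemma act_twist_kill v : v ^+ m = 1 -> (forall i, v ^+ c i != 1) -> act (twist v) 'X^l = 0.
Proof.
move=> vm vc; apply: (act_kill (N := l.+1)); first by rewrite size_polyXn.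
rewrite /twist -[X in _ ^+ X]card_ord -prodr_const;
  apply: (big_ind2 (fun p q : {poly C} => p %| q)) => [//||i _]; first by move=> *; apply: dvdp_mul.
rewrite dvdp_XsubCl /root horner_sum (eq_bigr (fun k : 'I_m => (v ^+ c i) ^+ k)) => [|k _].
  by rewrite sum_expr_root1 ?(negPf (vc i)) // -exprM mulnC exprM vm expr1n.
by rewrite horner_exp hornerZ hornerX mulr1 exprM.
Qed.

Hypothesis m_gt0 : (0 < m)%N.
Variable a : nat.

(* The Coxeter number when [c] lists the marks of an affine Dynkin diagram. *)
Definition cox : nat := \sum_i c i.

(* The subtractions are not truncated once [(a + m) * cox <= p]. *)
Definition count_sum p : nat :=
  \sum_(k : {ffun 'I_l.+1 -> 'I_m})
    if m %| p - (a * cox + wsum k) then (p - (a * cox + wsum k)) ^ l else 0.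

Lemma wsum_le (k : {ffun 'I_l.+1 -> 'I_m}) : (wsum k <= m * cox)%N.
Proof.
rewrite /wsum /cox big_distrr; apply: leq_sum => i _ /=.
by rewrite mulnC leq_mul2r ltnW ?orbT.
Qed.

(** The share of the [m]-th root of unity [v] in the indicator that [m] divides
    [p - (a * cox + wsum k)], summed over [k]; the powers of [v] that depend on [k] are absorbed by
    [twist v^-1]. *)
Definition filter_term p (v : C) : C :=
  v ^+ p * v^-1 ^+ (a * cox) * (act (twist v^-1) 'X^l).[p%:R - (a * cox)%:R].

Lemma count_sum_filter (w : C) p : m.-primitive_root w -> (a * cox + m * cox <= p)%N ->
  (m * count_sum p)%:R = \sum_(e < m) filter_term p (w ^+ e).
Proof.
move=> pw lep.
have wu e : w ^+ e \is a GRing.unit by rewrite unitrX // unitfE (prim_root_neq0 pw).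
pose D k := (p - (a * cox + @wsum m k))%N.
have DE k : (p = D k + (a * cox + wsum k))%N.
  by rewrite subnK // (leq_trans _ lep) // leq_add2l wsum_le.
transitivity (\sum_(e < m) \sum_k w ^+ e ^+ (D k) * (D k)%:R ^+ l).
  rewrite exchange_big /count_sum natrM natr_sum mulr_sumr; apply: eq_bigr => k _ /=.
  rewrite -mulr_suml (eq_bigr (fun e : 'I_m => (w ^+ D k) ^+ e)) => [|e _]; last exact: exprAC.
  rewrite sum_expr_root1 -?(prim_order_dvd pw) -?exprM ?(prim_expr_order pw) //; last first.
    by rewrite mulnC exprM (prim_expr_order pw) expr1n.
  by rewrite -/(D k); case: ifP; rewrite ?mulr0 ?mul0r // natrX.
apply: eq_bigr => e _; rewrite /filter_term horner_act_twist mulr_sumr.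
apply: eq_bigr => k _; rewrite hornerXn mulrA; congr (_ * _ ^+ l); last first.
  by rewrite {1}(DE k) !natrD; ring.
rewrite [in X in _ = X * _ * _](DE k) -mulrA -exprD exprD exprVn mulrK //.
by rewrite unitrX.
Qed.

Lemma filter_term_kill p v : v ^+ m = 1 -> (forall i, v ^+ c i != 1) -> filter_term p v = 0.
Proof.
move=> vm vc; rewrite /filter_term act_twist_kill ?horner0 ?mulr0 // ?exprVn ?vm ?invr1 //.
by move=> i; rewrite exprVn invr_eq1.
Qed.

Hypothesis c12 : forall i, c i = 1%N \/ c i = 2%N.

Lemma normr1_of_expr n (z : C) : (0 < n)%N -> z ^+ n = 1 -> `|z| = 1.
Proof.
move=> n0 zn; apply/eqP; rewrite -(pexpr_eq1 (n := n)) -?lt0n // -?normrX ?zn ?normr1 //.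
Qed.

Definition geom n (t : C) : C := \sum_(k < n) t ^+ k.

Lemma geom_root n t : (0 < n)%N -> geom n t = 0 -> `|t| = 1.
Proof.
move=> n0 t0; apply: (normr1_of_expr n0).
by apply/eqP; rewrite -subr_eq0 subrX1 -/(geom n t) t0 mulr0.
Qed.

(** Pairs consecutive powers of [t]. For even [m] it isolates the factors [1 + z] and [1 - z] of
    [twist 1] and [twist (-1)]; what is left depends on [z ^+ 2] only and is common to both. *)
Lemma geom_double n t : geom n.*2 t = (1 + t) * geom n (t ^+ 2).
Proof.
rewrite /geom; elim: n => [|n IHn]; first by rewrite !big_ord0 mulr0.
rewrite doubleS 3!big_ord_recr /= IHn -exprM mulnC muln2 mulrDr -addrA; congr (_ + _).
by rewrite mulrDl mul1r exprS.
Qed.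

Lemma horner_twist v z : (twist v).[z] = \prod_i geom m ((v * z) ^+ c i).
Proof.
rewrite /twist horner_prod; apply: eq_bigr => i _; rewrite horner_sum.
by apply: eq_bigr => k _; rewrite horner_exp hornerZ hornerX exprM.
Qed.

Lemma root_twist1 z : root (twist 1) z -> `|z| = 1.
Proof.
rewrite /root horner_twist => /prodf_eq0[i _] /eqP/(geom_root m_gt0).
have ci : (0 < c i)%N by case: (c12 i) => ->.
by rewrite mul1r normrX => /eqP; rewrite pexpr_eq1 -?lt0n // => /eqP.
Qed.

Definition nshort := #|[pred i | c i == 1%N]|.

(** A mark 2 sees only [v ^+ 2 = 1], so the sign of [v] matters only for the marks equal to 1. *)
Lemma horner_twist_split v z : v ^+ 2 = 1 ->
  (twist v).[z] = geom m (v * z) ^+ nshort * \prod_(i | c i != 1%N) geom m (z ^+ 2).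
Proof.
move=> v2; rewrite horner_twist (bigID (fun i => c i == 1%N)) /=; congr (_ * _).
  by rewrite -prodr_const; apply: eq_bigr => i /eqP->; rewrite expr1.
by apply: eq_bigr => i; case: (c12 i) => -> // _; rewrite exprMn v2 mul1r.
Qed.

(** Once common factors with roots of modulus 1 are removed, [(1 + z) ^+ s + e * (1 - z) ^+ s] is
    left, with [s = nshort]. For [s = 1] it is [2] or [2 z]; for [e = -1] it is [4 z] when [s = 2]
    and [8 z (1 + z ^+ 2)] when [s = 4]. The sign matters: for [s = 4] and [e = 1] the roots leave
    the unit circle. *)
Lemma root_twist_pair (e : C) z : ~~ odd m ->
  nshort = 1%N /\ e ^+ 2 = 1 \/ (nshort = 2%N \/ nshort = 4%N) /\ e = -1 ->
  root (twist 1 + e *: twist (-1)) z -> z = 0 \/ `|z| = 1.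
Proof.
move=> m_even hu; rewrite /root hornerD hornerZ !horner_twist_split ?expr1n ?sqrrN ?expr1n //.
rewrite mulrA -mulrDl mulf_eq0 => /orP[|/prodf_eq0[i _] /eqP/(geom_root m_gt0)]; last first.
  by rewrite normrX => /eqP; rewrite pexpr_eq1 // => /eqP; right.
have mE : m = m./2.*2 by rewrite -[LHS]odd_double_half (negPf m_even).
have h0 : (0 < m./2)%N by move: m_gt0; rewrite {1}mE double_gt0.
rewrite mE !geom_double mul1r mulN1r sqrrN !exprMn mulrA -mulrDl mulf_eq0.
case/orP => [|]; last first.
  rewrite expf_eq0 => /andP[_ /eqP/(geom_root h0)] /eqP.
  by rewrite normrX pexpr_eq1 // => /eqP; right.
case: hu => [[-> /eqP]|[[->|->] ->]].
- rewrite sqrf_eq1 !expr1 => /orP[]/eqP->.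
    have -> : 1 + z + 1 * (1 - z) = 2%:R by ring.
    by rewrite pnatr_eq0.
  have -> : 1 + z + -1 * (1 - z) = 2%:R * z by ring.
  by rewrite mulf_eq0 pnatr_eq0 => /eqP; left.
- have -> : (1 + z) ^+ 2 + -1 * (1 - z) ^+ 2 = 4%:R * z by ring.
  by rewrite mulf_eq0 pnatr_eq0 => /eqP; left.
have -> : (1 + z) ^+ 4 + -1 * (1 - z) ^+ 4 = 8%:R * (z * (1 + z ^+ 2)) by ring.
rewrite mulf_eq0 pnatr_eq0 /= mulf_eq0 => /orP[/eqP|]; first by left.
move=> z2; right; apply: (@normr1_of_expr 4) => //.
rewrite (exprM z 2 2); have -> : z ^+ 2 = -1 by apply/eqP; rewrite -addr_eq0 addrC.
by rewrite sqrrN expr1n.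
Qed.

(* As the [c i] are 1 or 2, only the roots of unity [1] and [-1] have some [v ^+ c i]
   equal to 1; for every other [v], [twist v] contains [('X - 1) ^+ l.+1]. *)
Theorem count_sum_operator :
  (forall i, c i = 1%N) \/ nshort = 1%N \/ (nshort = 2%N \/ nshort = 4%N) /\ ~~ odd (a * cox) ->
  exists G : {poly C}, (forall z, root G z -> z = 0 \/ `|z| = 1) /\
    forall p, odd p -> (a * cox + m * cox <= p)%N ->
      (m * count_sum p)%:R = (act G 'X^l).[p%:R].
Proof.
move=> hc; have [w pw] := closed_prim_root C m_gt0.
have wm e : (w ^+ e) ^+ m = 1 by rewrite exprAC (prim_expr_order pw) expr1n.
have actX p G : (act ('X^(a * cox) * G) 'X^l).[p%:R] = (act G 'X^l).[p%:R - (a * cox)%:R].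
  by rewrite act_mulXn horner_shift.
have term1 p : filter_term p (w ^+ 0) = (act (twist 1) 'X^l).[p%:R - (a * cox)%:R].
  by rewrite /filter_term expr0 invr1 !expr1n !mul1r.
have kill (e : 'I_m) p : (0 < e)%N ->
    ((m %| e * 2)%N -> forall i, c i = 1%N) -> filter_term p (w ^+ e) = 0.
  move=> e0 he; apply: filter_term_kill => // i.
  case: (c12 i) => ci; rewrite ci -exprM -(prim_order_dvd pw).
    by rewrite muln1 gtnNdvd.
  by apply/negP => /he/(_ i); rewrite ci.
have rootX G : (forall z, root G z -> z = 0 \/ `|z| = 1) ->
    forall z, root ('X^(a * cox) * G) z -> z = 0 \/ `|z| = 1.
  move=> hG z; rewrite rootM => /orP[|/hG //].
  by rewrite /root hornerXn expf_eq0 => /andP[_ /eqP]; left.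
(* In these cases [-1] is not an [m]-th root of unity, or it is killed because no mark is 2; only
   [v = 1] remains. *)
have [hk|] := boolP (odd m || [forall i, c i == 1%N]).
  exists ('X^(a * cox) * twist 1); split.
    by apply: rootX => z /root_twist1; right.
  move=> p _ lep; rewrite (count_sum_filter pw lep) actX -term1.
  rewrite (bigD1 (Ordinal m_gt0)) //= big1 ?addr0 // => e; rewrite -lt0n => e0.
  apply: kill => // me; case/orP: hk => [om|/forallP hi i]; last exact/eqP.
  by move: me; rewrite Gauss_dvdl ?coprimen2 // gtnNdvd.
rewrite negb_or => /andP[em nall].
have {}hc : nshort = 1%N \/ (nshort = 2%N \/ nshort = 4%N) /\ ~~ odd (a * cox).
  case: hc => // hi; case/negP: nall; apply/forallP => i; exact/eqP.
(* The term at [-1] carries the sign [(-1) ^+ (p + a * cox)], which is the same for all odd [p]. *)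
pose s : C := - (-1) ^+ (a * cox).
exists ('X^(a * cox) * (twist 1 + s *: twist (-1))); split.
  apply: rootX => z; apply: root_twist_pair => //.
  case: hc => [->|[h /negPf ea]]; [left | right]; split=> //.
    by rewrite /s sqrrN sqrr_sign.
  by rewrite /s -signr_odd ea.
have mE : m = m./2.*2 by rewrite -[LHS]odd_double_half (negPf em).
have h0 : (0 < m./2)%N by move: m_gt0; rewrite {1}mE double_gt0.
have hm : (m./2 < m)%N by rewrite {2}mE -addnn -[ltnLHS]addn0 ltn_add2l.
have wh : w ^+ m./2 = -1.
  apply/eqP; have: w ^+ m./2 ^+ 2 == 1.
    by rewrite -exprM muln2 -mE (prim_expr_order pw).
  by rewrite sqrf_eq1 -(prim_order_dvd pw) gtnNdvd.
move=> p op lep; rewrite (count_sum_filter pw lep) actX actD actZ hornerD hornerZ -term1.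
rewrite (bigD1 (Ordinal m_gt0)) //= (bigD1 (Ordinal hm)) /=; last by rewrite -val_eqE /= -lt0n.
rewrite big1 ?addr0 => [|e /andP[]].
  congr (_ + _); rewrite wh /filter_term invrN1 -signr_odd op expr1.
  by rewrite mulN1r.
rewrite -!val_eqE /= -lt0n => e0 eh; apply: kill => // /dvdnP[q].
(* For [0 < e < m], [m] divides [2 e] only if [e = m / 2], the index of [-1], which has been split
   off. *)
case: q => [|[|q]]; first by move/eqP; rewrite mul0n muln_eq0 (gtn_eqF e0).
  rewrite mul1n muln2 => e2; case/negP: eh; apply/eqP.
  by apply: double_inj; rewrite e2 -mE.
by have := ltn_ord e; nia.
Qed.

End RootsOfUnityFilter.

(** * Counting gap vectors *)

(* Cardinality for predicates on infinite types, such as ['I_n -> int]. *)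
Definition card_is (T : Type) (P : T -> Prop) (N : nat) : Prop :=
  exists (X : finType) (e : X -> T),
    [/\ injective e, forall t, P t <-> exists x, e x = t & #|X| = N].

Lemma card_is_le (T U : Type) (P : T -> Prop) (Q : U -> Prop) (f : T -> U) N M :
  card_is P N -> card_is Q M -> (forall t, P t -> Q (f t)) ->
  (forall t t', P t -> P t' -> f t = f t' -> t = t') -> (N <= M)%N.
Proof.
move=> [X [e [ie eP <-]]] [Y [d [id dQ <-]]] hf inj.
have ex x : exists y, d y = f (e x) by apply/dQ/hf/eP; exists x.
have /choice[g hg] := ex.
apply: (leq_card g) => x x' gx; apply: ie; apply: inj; try by apply/eP; eexists.
by rewrite -!hg gx.
Qed.

Lemma card_is_bij (T U : Type) (P : T -> Prop) (Q : U -> Prop) (f : T -> U) (g : U -> T) N :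
  (forall t, P t -> Q (f t) /\ g (f t) = t) -> (forall u, Q u -> P (g u) /\ f (g u) = u) ->
  card_is P N -> card_is Q N.
Proof.
move=> hf hg [X [e [ie eP cX]]]; exists X, (f \o e).
have Pe x : P (e x) by apply/eP; exists x.
split=> // [x x' /= efx|u].
  by apply: ie; rewrite -(hf _ (Pe x)).2 efx (hf _ (Pe x')).2.
split=> [/hg[/eP[x ex] fu]|[x <-]]; first by exists x; rewrite /= ex.
exact: (hf _ (Pe x)).1.
Qed.

Lemma card_is_ext (T : Type) (P Q : T -> Prop) N :
  (forall t, P t <-> Q t) -> card_is P N -> card_is Q N.
Proof. by move=> h; apply: (card_is_bij (f := id) (g := id)) => t /h. Qed.

Lemma card_is_uniq (T : Type) (P : T -> Prop) N M : card_is P N -> card_is P M -> N = M.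
Proof.
move=> hN hM; apply/eqP; rewrite eqn_leq (card_is_le (f := id) hN hM) //.
exact: (card_is_le (f := id) hM hN).
Qed.

Lemma card_is_fin (X : finType) (A : {pred X}) : card_is (fun x => x \in A) #|A|.
Proof.
exists {x : X | x \in A}, val; split; last by rewrite card_sig.
  exact: val_inj.
by move=> x; split=> [xA|[[y yA] <-]//]; exists (exist _ x xA).
Qed.

Lemma card_is_image (T : Type) (X : finType) (e : X -> T) (A : {pred X}) (P : T -> Prop) :
  injective e -> (forall t, P t <-> exists2 x, x \in A & e x = t) -> card_is P #|A|.
Proof.
move=> ie hP; exists {x : X | x \in A}, (e \o val); split; last by rewrite card_sig.
  by move=> x y /ie/val_inj.
move=> t; split=> [/hP[x xA <-]|[[x xA] /= <-]]; last by apply/hP; exists x.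
by exists (exist _ x xA).
Qed.

Lemma card_is_sub (T : Type) (P Q : T -> Prop) N :
  (forall t, Q t -> P t) -> card_is P N -> exists M, card_is Q M.
Proof.
move=> sQP [X [e [ie eP _]]]; exists #|[pred x | `[< Q (e x) >]]|.
apply: (card_is_image (e := e)) => // t; split=> [Qt|[x]]; last first.
  by rewrite inE => /asboolP Qx <-.
by have /eP[x ex] := sQP _ Qt; exists x; rewrite // inE ex; apply/asboolP.
Qed.

Lemma card_is0 (T : Type) (P : T -> Prop) : (forall t, ~ P t) -> card_is P 0.
Proof.
move=> h; exists void, (fun x : void => match x with end); split; last exact: card_void.
  by case.
by move=> t; split=> [/h|[[]]].
Qed.

Lemma card_is_bigU (K : finType) (T : Type) (P : K -> T -> Prop) (N : K -> nat) :
  (forall k, card_is (P k) (N k)) ->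
  (forall k k' t, P k t -> P k' t -> k = k') ->
  card_is (fun t => exists k, P k t) (\sum_k N k)%N.
Proof.
move=> hN disj.
pose X k := projT1 (cid (hN k)); pose e k : X k -> T := projT1 (cid (projT2 (cid (hN k)))).
have he k : [/\ injective (e k), forall t, P k t <-> exists x, e k x = t & #|X k| = N k].
  exact: projT2 (cid (projT2 (cid (hN k)))).
exists {k : K & X k}, (fun u => e (tag u) (tagged u)); split.
- move=> [k x] [k' x'] /= ee.
  have Pk : P k (e k x) by have [_ -> _] := he k; exists x.
  have Pk' : P k' (e k x) by rewrite ee; have [_ -> _] := he k'; exists x'.
  have kk := disj _ _ _ Pk Pk'; case: _ / kk x' ee Pk' => x' ee _.
  by have [inj _ _] := he k; rewrite (inj _ _ ee).
- move=> t; split=> [[k]|[[k x] <-]].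
    by have [_ -> _] := he k => -[x <-]; exists (Tagged X x).
  by exists k; have [_ -> _] := he k; exists x.
rewrite card_tagged sumnE big_map big_enum /=; apply: eq_bigr => k _.
by have [_ _ ->] := he k.
Qed.

Section GapSets.
Variables (l : nat) (c : 'I_l.+1 -> nat).
Hypothesis c_gt0 : forall i, (0 < c i)%N.

Definition gapset (r : int) (g : 'I_l.+1 -> int) : Prop :=
  (forall i, 0 <= g i) /\ \sum_i (c i)%:Z * g i = r.

Lemma gapset_finite r : exists N, card_is (gapset r) N.
Proof.
pose M := `|r|%N.
pose e (f : {ffun 'I_l.+1 -> 'I_M.+1}) i : int := f i.
apply: (@card_is_sub _ (fun g => exists2 f, f \in {: {ffun 'I_l.+1 -> 'I_M.+1}} & e f = g));
  last first.
  apply: (card_is_image (e := e)) => [f f' ff|t]; last exact: iff_refl.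
  apply/ffunP => i; apply: val_inj.
  by have /= [] := congr1 (fun h => h i) ff.
move=> g [g0 gr]; exists [ffun i => inord `|g i|%N] => //.
apply/funext => i; rewrite /e ffunE inordK ?gez0_abs // ltnS.
have : g i <= r.
  rewrite -gr (bigD1 i) //=; apply: (@le_trans _ _ ((c i)%:Z * g i)).
    by rewrite ler_peMl ?g0 //; have := c_gt0 i; lia.
  by rewrite lerDl sumr_ge0 // => j _; rewrite mulr_ge0.
by have := g0 i; rewrite /M; lia.
Qed.

(** Extracted from finiteness alone: no formula for this number is used, only its behaviour under
    division of the gaps by [m] and its sums over words. *)
Definition rho (r : int) : nat := projT1 (cid (gapset_finite r)).

Lemma rhoP r : card_is (gapset r) (rho r).
Proof. by rewrite /rho; case: cid. Qed.

Lemma card_gaps_ge (L : 'I_l.+1 -> int) (q : int) :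
  card_is (fun g => (forall i, L i <= g i) /\ \sum_i (c i)%:Z * g i = q)
    (rho (q - \sum_i (c i)%:Z * L i)).
Proof.
apply: (card_is_bij (f := fun g i => g i + L i) (g := fun g i => g i - L i)) (rhoP _);
  [move=> g [g0 gq] | move=> g [gL gq]].
- split; last by apply/funext => i; rewrite addrK.
  split=> [i|]; first by rewrite lerDr.
  under eq_bigr do rewrite mulrDr.
  by rewrite big_split /= gq subrK.
- split; last by apply/funext => i; rewrite subrK.
  split=> [i|]; first by rewrite subr_ge0.
  under eq_bigr do rewrite mulrBr.
  by rewrite sumrB gq.
Qed.

(** Writing [g i = k i + m * g' i], the vectors with residues [k] correspond to gap vectors [g'] of
    weight [(r - wsum k) / m]; there are none when [m] does not divide. *)
Lemma rho_scale (m : nat) (r : int) : (0 < m)%N ->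
  rho r = (\sum_(k : {ffun 'I_l.+1 -> 'I_m})
    if (r - (wsum c k)%:Z)%R \in dvdz m then rho (divz (r - (wsum c k)%:Z) m) else 0)%N.
Proof.
move=> m0; apply: card_is_uniq (rhoP r) _.
pose P (k : {ffun 'I_l.+1 -> 'I_m}) (g : 'I_l.+1 -> int) :=
  gapset r g /\ forall i, (g i %% m)%Z = k i.
apply: (@card_is_ext _ (fun g => exists k, P k g)) => [g|].
  split=> [[k []]//|hg]; exists [ffun i => Ordinal (ltn_pmod `|g i|%N m0)]; split=> // i.
  by rewrite ffunE /=; have := hg.1 i; case: (g i) => // x _; rewrite modz_nat.
apply: card_is_bigU => [k|k k' g [_ h] [_ h']]; last first.
  by apply/ffunP => i; apply: val_inj; apply/eqP; rewrite -eqz_nat -h -h'.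
have wE : (wsum c k)%:Z = \sum_i (c i)%:Z * (k i)%:Z.
  by rewrite /wsum -natz natr_sum; apply: eq_bigr => i _; rewrite natrM !natz.
case: ifP => [/divzK dr|ndr]; last first.
  apply: card_is0 => g [[g0 gr] gk]; move/negP: ndr; apply.
  rewrite -gr wE -sumrB; apply: rpred_sum => i _.
  by rewrite -mulrBr dvdz_mull // -gk {1}(divz_eq (g i) m) addrK dvdz_mull.
apply: (card_is_bij (f := fun g i => (k i)%:Z + m%:Z * g i)
  (g := fun g i => (g i %/ m)%Z)) (rhoP _).
- move=> g [g0 gr]; split; last first.
    apply/funext => i; have lk := ltn_ord (k i); have mz : m%:Z != 0 by lia.
    rewrite /= addrC mulrC divzMDl // divz_small ?addr0 //.
  split=> [|i]; last by rewrite addrC mulrC modzMDl modz_small //; have := ltn_ord (k i); lia.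
  split=> [i|]; first by have := g0 i; nia.
  under eq_bigr do rewrite mulrDr mulrCA.
  by rewrite big_split /= -mulr_sumr gr -wE mulrC dr addrC subrK.
- move=> g [[g0 gr] gk]; split; last first.
    by apply/funext => i; rewrite -gk addrC mulrC -divz_eq.
  split=> [i|]; first by rewrite divz_ge0.
  have m0' : m%:Z != 0 by lia.
  apply: (mulIf m0'); rewrite dr -gr wE mulr_suml -sumrB; apply: eq_bigr => i _.
  by rewrite {2}(divz_eq (g i) m) gk; ring.
Qed.

(** [K] is the set of words and [C] the number of integer lifts of a point. After [rho_scale] the
    term of [u] in the last hypothesis becomes a sum of [rho (j - des k)] with
    [j = (q - a * cox c - wsum c u) / m], which the hypothesis on all [j] evaluates to [C * j ^ l];
    then [m ^ l] clears the denominator. *)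
Theorem count_from_gaps (K : finType) (des : K -> nat) (C N a m q : nat) :
  (0 < m)%N -> (0 < C)%N -> (a * cox c + m * cox c + m <= q)%N ->
  (forall j, (0 < j)%N -> C * j ^ l = \sum_k rho (j%:Z - (des k)%:Z))%N ->
  (C * N = \sum_k rho (q%:Z - (a * cox c)%:Z - m%:Z * (des k)%:Z))%N ->
  (m ^ l * N = count_sum c m a q)%N.
Proof.
move=> m0 C0 leq_q h0 h1.
apply/eqP; rewrite -(eqn_pmul2l C0) mulnCA h1 /count_sum; apply/eqP.
have E k : rho (q%:Z - (a * cox c)%:Z - m%:Z * (des k)%:Z) =
    (\sum_(u : {ffun 'I_l.+1 -> 'I_m}) if m %| q - (a * cox c + wsum c u) then
       rho (((q - (a * cox c + wsum c u)) %/ m)%N%:Z - (des k)%:Z) else 0)%N.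
  rewrite (rho_scale _ m0); apply: eq_bigr => u _.
  have leu : (wsum c u <= m * cox c)%N by exact: wsum_le.
  have -> : q%:Z - (a * cox c)%:Z - m%:Z * (des k)%:Z - (wsum c u)%:Z =
      - (des k)%:Z * m%:Z + (q - (a * cox c + wsum c u))%N%:Z by lia.
  rewrite rpredDl ?dvdz_mull //= divzMDl; last by lia.
  by rewrite divz_nat addrC.
under eq_bigr do rewrite E.
rewrite exchange_big [LHS]big_distrr [RHS]big_distrr; apply: eq_bigr => u _.
case: ifP => [mq|_]; last by rewrite /= big1 // !muln0.
have leu : (wsum c u <= m * cox c)%N by exact: wsum_le.
have leE : (a * cox c + wsum c u + m <= q)%N.
  by apply: leq_trans leq_q; rewrite leq_add2r leq_add2l.
(* The summand [+ m] in the bound on [q] makes the quotient positive, as the hypothesis on [j]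
   requires. *)
have j0 : (0 < (q - (a * cox c + wsum c u)) %/ m)%N.
  by rewrite divn_gt0 // leq_subRL // (leq_trans (leq_addr _ _) leE).
by rewrite /= -h0 // mulnCA -expnMn (mulnC m) divnK.
Qed.

End GapSets.

(** * Chains of labelled sites *)

(* A labelled site: twice its position, and a label that orders coinciding sites.
   Positions are doubled because, in the absence of short roots, the coordinates
   [x_i] are lifted either all to integers or all to half-integers. *)
Definition pt := (int * int)%type.

Section SignedPoints.
Implicit Types (P Q : pt) (q : int).

Definition opp P : pt := (- P.1, - P.2).
Definition shf q P : pt := (P.1 + 2 * q, P.2).
(** Positions are doubled, so the period is [2 * q], and [q] is the second fixed point of negation
    modulo the period. *)
Definition rfl q P : pt := shf q (opp P).

(** Used with [m = b + 1 - a]. Without a descent, the positive root is minus the gap and must avoid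
    [1 - a, ..., 0], so the gap is at least [a]; at a descent the root is the gap itself and must
    avoid [1, ..., b], so the gap is at least [b + 1 = a + m]. *)
Definition gapmin (a m : int) P Q : int := a + if Q.2 < P.2 then m else 0.

Definition far (a m : int) P Q : bool := 2 * gapmin a m P Q <= Q.1 - P.1.

Lemma far_opp a m P Q : far a m (opp Q) (opp P) = far a m P Q.
Proof. by rewrite /far /gapmin /opp /= ltrN2; congr (_ <= _); ring. Qed.

Lemma far_shf a m q P Q : far a m (shf q P) (shf q Q) = far a m P Q.
Proof. by rewrite /far /gapmin /shf /=; congr (_ <= _); ring. Qed.

Lemma far_rfl a m q P Q : far a m (rfl q Q) (rfl q P) = far a m P Q.
Proof. by rewrite /rfl far_shf far_opp. Qed.

Lemma far_opp_rfl a m q P Q : far a m (rfl q P) (shf q Q) = far a m (opp P) Q.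
Proof. by rewrite /rfl far_shf. Qed.

Lemma oppK : involutive opp.
Proof. by case=> x y; rewrite /opp /= !opprK. Qed.

Lemma rflK q : involutive (rfl q).
Proof. by case=> x y; rewrite /rfl /shf /opp /= opprK; congr (_, _); ring. Qed.

Lemma far_oppC a m P Q : far a m (opp P) Q = far a m (opp Q) P.
Proof. by rewrite -far_opp oppK. Qed.

Lemma far_rflC a m q P Q : far a m P (rfl q Q) = far a m Q (rfl q P).
Proof. by rewrite -(far_rfl a m q) rflK. Qed.

Section Chains.
Variables (a m : int).
Hypotheses (a_ge0 : 0 <= a) (m_ge0 : 0 <= m).

(** If the label drops from [P] to [P'], it drops in one of the two steps, and that step already
    pays [m]. This is why consecutive sites suffice. *)
Lemma far_trans Q P P' : far a m P Q -> far a m Q P' -> far a m P P'.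
Proof. by rewrite /far /gapmin; do 3 case: ifP; lia. Qed.

Variables (sh lg : bool) (n1 : nat) (q : int) (P : nat -> pt).
Hypotheses (n1_gt0 : (0 < n1)%N) (n1_gt1 : ~~ sh -> ~~ lg -> (1 < n1)%N).

(* [sh] and [lg] tell whether the short roots [e_i] and the long roots [2 e_i] are
   present: B is (true, false), C is (false, true), D is (false, false) and BC is
   (true, true).  The conditions of [chain] are the walls of an alcove. *)
Definition chain_start : bool :=
  if sh then far a m (0, 0) (P 0)
  else if lg then far a m (opp (P 0)) (P 0) else far a m (opp (P 0)) (P 1).

Definition chain_end : bool :=
  if lg then far a m (P n1) (rfl q (P n1)) else far a m (P n1) (rfl q (P n1.-1)).

Definition chain : Prop :=
  [/\ chain_start, chain_end & forall r, (r < n1)%N -> far a m (P r) (P r.+1)].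

Hypothesis hP : chain.

Lemma chain_lt r s : (r < s)%N -> (s <= n1)%N -> far a m (P r) (P s).
Proof.
have [_ _ inner] := hP; elim: s => // s IHs; rewrite ltnS leq_eqVlt => /predU1P[->|rs] sn.
  exact: inner.
by apply: far_trans (IHs rs (ltnW sn)) (inner _ sn).
Qed.

(** Every comparison passes through the wall at the lower end. The excluded case is the first site
    against its own negative in type D, where [2 e_i] is not a root. *)
Lemma chain_opp r s : (r <= n1)%N -> (s <= n1)%N -> [|| sh, lg, r != s | (0 < r)%N] ->
  far a m (opp (P r)) (P s).
Proof.
move=> rn sn; have [st _ _] := hP; move: st; rewrite /chain_start.
case: (boolP sh) n1_gt1 => [sh1 _ P0 _|sh0 n12].
  have O r' : (r' <= n1)%N -> far a m (0, 0) (P r').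
    by case: r' => [//|r' r'n]; apply: far_trans P0 (chain_lt _ r'n).
  apply: (@far_trans (0, 0)); last exact: O.
  by rewrite -[(0, 0) : pt](oppK) far_opp /opp /= oppr0 O.
case: (boolP lg) n12 => [lg1 _ P0 _|lg0 /(_ isT isT) n12 P0 /= rs].
  have O s' : (s' <= n1)%N -> far a m (opp (P 0)) (P s').
    by case: s' => [//|s' s'n]; apply: far_trans P0 (chain_lt _ s'n).
  case: r rn => [_|r rn]; first exact: O.
  by apply: (@far_trans (opp (P 0))); rewrite ?far_opp ?chain_lt ?O.
have O s' : (0 < s' <= n1)%N -> far a m (opp (P 0)) (P s').
  case: s' => [|[|s']] // s'n; apply: far_trans P0 (chain_lt _ _) => //.
case: r rn rs => [_|r rn _]; first by rewrite orbF eq_sym -lt0n => s0; apply: O; rewrite s0.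
have Or : far a m (opp (P r.+1)) (P 0) by rewrite far_oppC O.
by case: s sn => [//|s sn]; apply: far_trans Or (chain_lt _ sn).
Qed.

(** The counterpart of [chain_opp] at the upper end; here the last site is not compared with its own
    reflection unless long roots are present. *)
Lemma chain_rfl r s : (r <= n1)%N -> (s <= n1)%N -> [|| lg, r != s | (r < n1)%N] ->
  far a m (P r) (rfl q (P s)).
Proof.
move=> rn sn; have [_ en _] := hP; move: en; rewrite /chain_end.
case: (boolP lg) => [lg1 Pn _|lg0 Pn /= rs].
  have E s' : (s' <= n1)%N -> far a m (P n1) (rfl q (P s')).
    rewrite leq_eqVlt => /predU1P[->//|s'n].
    by apply: far_trans Pn _; rewrite far_rfl chain_lt.
  move: rn; rewrite leq_eqVlt => /predU1P[->|rn]; first exact: E.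
  by apply: far_trans (chain_lt rn _) (E _ sn).
have E s' : (s' < n1)%N -> far a m (P n1) (rfl q (P s')).
  move=> s'n; have : (s' <= n1.-1)%N by lia.
  rewrite leq_eqVlt => /predU1P[->//|{}s'n].
  by apply: far_trans Pn _; rewrite far_rfl chain_lt // leq_pred.
have [rn'|nr] := ltnP r n1; last first.
  have -> : r = n1 by apply/eqP; rewrite eqn_leq rn.
  by apply: E; lia.
have Er : far a m (P r) (rfl q (P n1)) by rewrite far_rflC E.
move: sn; rewrite leq_eqVlt => /predU1P[->//|sn].
by apply: far_trans Er _; rewrite far_rfl chain_lt.
Qed.

(** The path goes through the reflection of a third site [x], chosen to avoid the excluded cases of
    [chain_rfl] and [chain_opp]. For the first and last sites between two forks, [x = 1] serves, and
    this needs [1 < n1]. *)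
Lemma chain_wrap r s : (r < s)%N -> (s <= n1)%N -> far a m (P s) (shf q (P r)).
Proof.
move=> rs sn; have rn : (r <= n1)%N by lia.
have step x : (x <= n1)%N -> [|| lg, s != x | (s < n1)%N] -> [|| sh, lg, x != r | (0 < x)%N] ->
    far a m (P s) (shf q (P r)).
  move=> xn h1 h2; apply: (@far_trans (rfl q (P x))); first exact: chain_rfl.
  by rewrite far_opp_rfl chain_opp.
have [lg1|lg0] := boolP lg; first by apply: (step s) => //; lia.
have [sh1|sh0] := boolP sh; first by apply: (step r) => //; lia.
have n12 := n1_gt1 sh0 lg0.
have [r0|r0] := posnP r; last by apply: (step r) => //; lia.
have [sn'|sn'] := ltnP s n1; first by apply: (step s) => //; lia.
by apply: (step 1%N) => //; lia.
Qed.

End Chains.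

Implicit Types Y : pt.

(** * Forbidden levels and distances between sites *)

Section AvoidedResidues.
Variables (a b q : int).
Hypotheses (a_ge0 : 0 <= a) (ab : a <= b).

Definition avoids (x : int) : Prop := forall k : int, 1 - a <= k <= b -> ~ (2 * q %| x - 2 * k)%Z.

(* Exchanging the sites negates the difference, while the levels [1 - a, ..., b] are not
   symmetric about 0: the labels tell which difference is the positive root. *)
Definition allowed (P Q : pt) : Prop := avoids (if P.2 < Q.2 then P.1 - Q.1 else Q.1 - P.1).

Lemma avoids_mod x y : (2 * q %| x - y)%Z -> avoids x -> avoids y.
Proof.
move=> xy hx k hk ky; apply: (hx k hk).
have -> : x - 2 * k = (x - y) + (y - 2 * k) by ring.
exact: rpredD.
Qed.

Lemma allowed_sym P Q : P.2 != Q.2 -> allowed P Q -> allowed Q P.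
Proof. by rewrite /allowed; case: ltgtP. Qed.

Lemma allowed_opp P Q : P.2 != Q.2 -> allowed P Q -> allowed (opp P) (opp Q).
Proof.
rewrite /allowed /= ltrN2; case: ltgtP => // _ _.
  by rewrite opprK addrC.
by rewrite opprK addrC.
Qed.

Lemma allowed_shf P Q j : allowed P Q -> allowed (P.1 + 2 * q * j, P.2) Q.
Proof.
rewrite /allowed /=; case: ifP => _; apply: avoids_mod.
  by apply/dvdzP; exists (- j); ring.
by apply/dvdzP; exists j; ring.
Qed.

(** The two gaps add up to one period, so at a forbidden level [k] the defining difference minus
    [2 * k] would lie strictly between consecutive multiples of [2 * q]. *)
Lemma far_allowed P Q : P.2 != Q.2 -> far a (b + 1 - a) P Q ->
  far a (b + 1 - a) Q (shf q P) -> allowed P Q.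
Proof.
have key x k j : 1 - a <= k <= b -> 2 * a <= x <= 2 * q - 2 * (b + 1) ->
    - x - 2 * k = j * (2 * q) -> False.
  move=> hk hx hj; have q0 : 0 < q by lia.
  have j1 : j * (2 * q) < 0 by lia.
  have j2 : - (2 * q) < j * (2 * q) by lia.
  have : j < 0 by nia.
  have : -1 < j by nia.
  by lia.
case: P Q => [x u] [y v]; rewrite /far /gapmin /allowed /=.
case: ltgtP => //= _ _ h1 h2 k hk /dvdzP[j hj].
  by apply: (key (2 * q - (y - x)) k (j - 1)); lia.
by apply: (key (y - x) k j); lia.
Qed.

(** A gap in the right order but too short is, halved and with the sign of the positive root, itself
    a forbidden level; evenness makes that level an integer. *)
Lemma allowed_far P Q : P.2 != Q.2 -> (2 %| Q.1 - P.1)%Z -> far 0 1 P Q -> allowed P Q ->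
  far a (b + 1 - a) P Q.
Proof.
have key (x : int) : (2 %| x)%Z -> (2 * q %| x - 2 * (x %/ 2)%Z)%Z.
  by move=> e; rewrite (_ : x - _ = 0) ?dvdz0 //; lia.
case: P Q => [x u] [y v]; rewrite /far /gapmin /allowed /=.
case: ltgtP => //= _ _ e h1 hP; rewrite leNgt; apply/negP => lt.
  by apply: (hP ((y - x) %/ 2)%Z); [lia | apply: key].
by apply: (hP ((x - y) %/ 2)%Z); [lia | apply: key; lia].
Qed.

Definition allowed2 P Q := allowed P Q /\ allowed (opp P) Q.

Definition indep (P Q : pt) := P.2 != Q.2 /\ - P.2 != Q.2.

Lemma allowed2_sym P Q : indep P Q -> allowed2 P Q -> allowed2 Q P.
Proof.
case=> h1 h2 [a1 a2]; split; first exact: allowed_sym.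
apply: allowed_sym; first by rewrite /= -(inj_eq oppr_inj) opprK.
by rewrite -[P]oppK; apply: allowed_opp.
Qed.

Definition same_site (Y P : pt) := [\/ P = Y, P = opp Y | P = shf q Y].

Lemma allowed2_site Y P Q : same_site Y P -> allowed2 Y Q <-> allowed2 P Q.
Proof.
case=> ->; first by [].
  by split=> -[h1 h2]; split; rewrite ?oppK // -[Y]oppK.
split=> -[h1 h2]; split.
- by have := @allowed_shf _ _ 1 h1; rewrite mulr1.
- have := @allowed_shf _ _ (-1) h2; rewrite /= mulrN1.
  by rewrite /opp /shf /= opprD.
- have := @allowed_shf _ _ (-1) h1; rewrite /= mulrN1 addrK.
  by case: (Y).
have := @allowed_shf _ _ 1 h2; rewrite /opp /shf /= opprD mulr1 subrK.
by [].
Qed.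

(** A change of sign exchanges the conditions for [e_i - e_j] and [e_i + e_j], so only the pair is
    invariant; it can then be tested on whichever representatives occur in a chain. *)
Lemma allowed2_sites Y P Y' P' : indep Y Y' -> same_site Y P -> same_site Y' P' ->
  allowed2 Y Y' <-> allowed2 P P'.
Proof.
move=> iY sP sP'.
have ind : indep P Y'.
  by case: iY => i1 i2; case: sP => ->; rewrite /indep /= ?opprK; split.
have indY : indep Y' P.
  by move: ind; rewrite /indep => -[h1 h2]; split; rewrite eq_sym // -(inj_eq oppr_inj) opprK.
have indP' : indep P P'.
  case: sP' => ->; rewrite /indep //=; case: ind => h1 h2; split=> //.
    by rewrite -(inj_eq oppr_inj) opprK.
  by rewrite (inj_eq oppr_inj).
have indP'' : indep P' P.
  by move: indP'; rewrite /indep => -[h1 h2]; split; rewrite eq_sym // -(inj_eq oppr_inj) opprK.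
rewrite (allowed2_site _ sP); split=> h.
  by apply: allowed2_sym => //; apply/(allowed2_site _ sP'); apply: allowed2_sym.
by apply: allowed2_sym => //; apply/(allowed2_site _ sP'); apply: allowed2_sym.
Qed.

End AvoidedResidues.

End SignedPoints.

Definition site_lt (P Q : pt) : bool := (P.1 < Q.1) || (P.1 == Q.1) && (P.2 < Q.2).

(** For equal parities a positive difference is at least 2, so the thresholds 0 and 1 only break
    ties by label. *)
Lemma far01P (P Q : pt) : P.2 != Q.2 -> (2 %| Q.1 - P.1)%Z -> far 0 1 P Q = site_lt P Q.
Proof.
by case: P Q => [x u] [z v]; rewrite /far /gapmin /site_lt /=; case: (ltgtP u v) => // _ _ e; lia.
Qed.

(** * Words of signed configurations *)

Section SignedWords.
Variables (sh lg : bool) (n1 : nat) (q : int).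
Notation n := n1.+1.

(* The coordinate [x_i] gets a negative label and [- x_i] the opposite one. *)
Definition lam (i : 'I_n) : int := i%:Z - n%:Z.
Definition pos (y : 'I_n -> int) i : pt := (y i, lam i).

Definition word : finType := ({perm 'I_n} * {ffun 'I_n -> bool})%type.
Implicit Types (w : word) (y : 'I_n -> int) (i j : 'I_n) (r s : nat).

(* At an end of the chain governed by a fork of the diagram, changing the sign of the
   extreme letter yields the same chain condition; [normal] selects one word. *)
Definition free_end r : bool :=
  [&& ~~ sh, ~~ lg & r == 0%N] || ~~ lg && (r == n1).

Definition normal w : Prop := forall r, (r <= n1)%N -> free_end r -> w.2 (w.1 (inord r)).

(** At an upper fork [normal] forces the sign of the last letter; a coordinate [x <= 0] is then
    represented one period higher, beyond the reflection point. *)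
Definition lift_site r (e : bool) (x : int) : int :=
  if e then (if [&& ~~ lg, r == n1 & x <= 0] then x + 2 * q else x) else - x.

Definition label w r : int :=
  if w.2 (w.1 (inord r)) then lam (w.1 (inord r)) else - lam (w.1 (inord r)).

Definition place w y r : pt :=
  (lift_site r (w.2 (w.1 (inord r))) (y (w.1 (inord r))), label w r).

Definition configuration y : Prop := (forall i, - q < y i <= q) /\
  if sh then forall i, (2 %| y i)%Z else forall i j, (2 %| y i - y j)%Z.

Definition admissible (a b : int) y : Prop :=
  [/\ forall i j, i != j -> allowed2 a b q (pos y i) (pos y j),
      lg -> forall i, allowed a b q (opp (pos y i)) (pos y i)
    & sh -> forall i, allowed a b q (0, 0) (pos y i)].

Lemma lam_lt0 i : lam i < 0.
Proof. by rewrite /lam; have := ltn_ord i; lia. Qed.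

Lemma opp_lam_neq i : - lam i != lam i.
Proof. by have := lam_lt0 i; lia. Qed.

Lemma lam_neq0 i : 0 != lam i.
Proof. by have := lam_lt0 i; lia. Qed.

Lemma lam_inj : injective lam.
Proof. by move=> i j e; apply: ord_inj; move: e; rewrite /lam; lia. Qed.

Lemma indep_pos y i j : i != j -> indep (pos y i) (pos y j).
Proof.
move=> ij; split; rewrite /=; last by have := lam_lt0 i; have := lam_lt0 j; lia.
by rewrite (inj_eq lam_inj).
Qed.

Lemma same_site_place w y r : same_site q (pos y (w.1 (inord r))) (place w y r).
Proof.
rewrite /place /label /lift_site; case: ifP => _; last by constructor 2.
by case: ifP => _; [constructor 3 | constructor 1].
Qed.

Lemma place_rank_neq w r s : (r <= n1)%N -> (s <= n1)%N -> r != s ->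
  w.1 (inord r) != w.1 (inord s).
Proof. by move=> rn sn; rewrite (inj_eq perm_inj) -val_eqE /= !inordK. Qed.

Lemma rank_of w i : exists2 r, (r <= n1)%N & i = w.1 (inord r).
Proof. by exists (w.1^-1%g i); rewrite ?inord_val ?permKV // -ltnS. Qed.

Lemma label_neq0 w r : label w r != 0.
Proof. by rewrite /label; have := lam_lt0 (w.1 (inord r)); case: ifP; lia. Qed.

Lemma opp_label_neq w r : - label w r != label w r.
Proof. by have := label_neq0 w r; lia. Qed.

Lemma indep_place w y r s : (r <= n1)%N -> (s <= n1)%N -> r != s ->
  indep (place w y r) (place w y s).
Proof.
move=> rn sn rs; have /indep_pos-/(_ y) := place_rank_neq w rn sn rs.
rewrite /indep /place /label /=; case: ifP => _; case: ifP => _; case=> h1 h2.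
- by split.
- by split; rewrite ?(inj_eq oppr_inj) // -(inj_eq oppr_inj) opprK.
- by split; rewrite ?opprK.
by split; rewrite ?opprK ?(inj_eq oppr_inj) // -(inj_eq oppr_inj) opprK.
Qed.

Lemma place_even w y : configuration y ->
  forall r s, (2 %| (place w y s).1 - (place w y r).1)%Z.
Proof.
move=> [_ hpar] r s; set i := w.1 (inord r); set j := w.1 (inord s).
have {hpar} : (2 %| y i - y j)%Z.
  by move: hpar; case: ifP => _ h; [rewrite rpredB | exact: h].
rewrite /place /= -/i -/j /lift_site.
by do 2 (case: ifP => _); do ?(case: ifP => _); lia.
Qed.

Lemma place_even_sh w y : sh -> configuration y -> forall r, (2 %| (place w y r).1)%Z.
Proof.
move=> sh1 [_]; rewrite sh1 => hpar r; have := hpar (w.1 (inord r)).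
by rewrite /place /lift_site /=; case: ifP => _; do ?(case: ifP => _); lia.
Qed.

Lemma allowed_O_site a b Y P : same_site q Y P -> Y.2 != 0 ->
  allowed a b q (0, 0) Y <-> allowed a b q (0, 0) P.
Proof.
have O : ((0, 0) : pt) = opp (0, 0) by rewrite /opp /= oppr0.
have shfO Q : allowed a b q (0, 0) (shf q Q) <-> allowed a b q (0, 0) Q.
  rewrite /allowed /=; case: ifP => _; split; apply: avoids_mod; apply/dvdzP;
    by [exists 1; ring | exists (-1); ring].
have oppO Q : Q.2 != 0 -> allowed a b q (0, 0) (opp Q) -> allowed a b q (0, 0) Q.
  move=> Q0 h; rewrite O -[Q]oppK; apply: allowed_opp => //.
  by rewrite /= eq_sym oppr_eq0.
move=> + Y0; case=> ->; [by [] | | by rewrite shfO].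
split=> [h|]; last exact: oppO.
by apply: oppO; rewrite ?oppK //= oppr_eq0.
Qed.

Lemma allowed_self_site a b w y r : lg ->
  allowed a b q (opp (pos y (w.1 (inord r)))) (pos y (w.1 (inord r))) <->
  allowed a b q (opp (place w y r)) (place w y r).
Proof.
move=> lg1; set Y := pos y _; have nY : (opp Y).2 != Y.2 by exact: opp_lam_neq.
rewrite /place /label /lift_site lg1 /= -/Y; case: ifP => _ //.
rewrite -[(- y _, - lam _)]/(opp Y) oppK; split=> h; apply: allowed_sym => //.
by rewrite eq_sym.
Qed.

Hypotheses (n1_gt0 : (0 < n1)%N) (n1_gt1 : ~~ sh -> ~~ lg -> (1 < n1)%N).

Section Thresholds.
Variables (a b : int).
Hypotheses (a_ge0 : 0 <= a) (ab : a <= b).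
Notation m := (b + 1 - a).
Notation chain01 := (chain 0 1 sh lg n1 q).
Notation chain_ab := (chain a m sh lg n1 q).

Let m_ge0 : 0 <= m. Proof. by lia. Qed.

(** Each root needs a separation on both sides of the period: [chain_lt] and [chain_wrap] give it
    for differences, [chain_opp] and [chain_rfl] for sums. *)
Lemma chain_admissible w y : configuration y -> chain_ab (place w y) -> admissible a b y.
Proof.
move=> Xy hP; have m0 := m_ge0; split.
- move=> i j ij.
  have [r rn ri] := rank_of w i; have [s sn sj] := rank_of w j.
  have rs : r != s by apply: contraNneq ij => rs; rewrite ri sj rs.
  have sr : same_site q (pos y i) (place w y r) by rewrite ri; exact: same_site_place.
  have ss : same_site q (pos y j) (place w y s) by rewrite sj; exact: same_site_place.
  apply/(allowed2_sites _ _ (indep_pos y ij) sr ss) => {sr ss}.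
  wlog lt_rs : r s i j ij rn sn ri sj rs / (r < s)%N.
    move=> W; case: (ltngtP r s) => [lt|lt|e]; [exact: (W r s i j)| |by rewrite e eqxx in rs].
    apply: allowed2_sym => //; first by apply: indep_place; rewrite // eq_sym.
    by apply: (W s r j i); rewrite // eq_sym.
  have [i1 i2] := indep_place w y rn sn rs.
  split; apply: far_allowed => //.
  + exact: (chain_lt a_ge0 m0 hP).
  + exact: (chain_wrap a_ge0 m0 n1_gt0 n1_gt1 hP).
  + by apply: (chain_opp a_ge0 m0 n1_gt1 hP) => //; rewrite rs !orbT.
  by rewrite -/(rfl q _); apply: (chain_rfl a_ge0 m0 n1_gt0 n1_gt1 hP) => //;
    rewrite eq_sym rs orbT.
- move=> lg1 i; have [r rn ->] := rank_of w i; set Y := pos y _.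
  have Yneq : (opp Y).2 != Y.2 by exact: opp_lam_neq.
  have : allowed a b q (opp (place w y r)) (place w y r).
    apply: far_allowed => //.
    + exact: opp_label_neq.
    + by apply: (chain_opp a_ge0 m0 n1_gt1 hP) => //; rewrite lg1 orbT.
    by rewrite -/(rfl q _); apply: (chain_rfl a_ge0 m0 n1_gt0 n1_gt1 hP) => //; rewrite lg1.
  exact: (allowed_self_site a b w y r lg1).2.
move=> sh1 i; have [r rn ->] := rank_of w i; set Y := pos y _.
have Yneq : ((0, 0) : pt).2 != Y.2 by exact: lam_neq0.
have O s : (s <= n1)%N -> far a m (0, 0) (place w y s).
  move=> sn; have [st _ _] := hP; move: st; rewrite /chain_start sh1.
  case: s sn => [//|s] sn st; apply: far_trans st _ => //.
  exact: (chain_lt a_ge0 m0 hP).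
have : allowed a b q (0, 0) (place w y r).
  apply: far_allowed => //.
  + by rewrite eq_sym; exact: label_neq0.
  + exact: O.
  (* The way from site [r] to the origin of the next period passes through the reflection of site
     [x]; without long roots the last site must use another site than itself. *)
  have [x xn hx] : exists2 x, (x <= n1)%N & [|| lg, r != x | (r < n1)%N].
    have [e|e] := eqVneq r n1; first by exists 0%N => //; rewrite e -lt0n n1_gt0 orbT.
    by exists r => //; rewrite ltn_neqAle e rn !orbT.
  apply: (@far_trans _ _ a_ge0 m0 (rfl q (place w y x))).
    exact: (chain_rfl a_ge0 m0 n1_gt0 n1_gt1 hP).
  by rewrite far_opp_rfl -far_opp oppK /opp /= oppr0 O.
have Y0 : Y.2 != 0 by rewrite eq_sym.
by move/(allowed_O_site _ _ (same_site_place w y r) Y0).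
Qed.

Lemma admissible_chain w y : configuration y -> chain01 (place w y) -> admissible a b y ->
  chain_ab (place w y).
Proof.
move=> Xy hP [pairs long short].
have par := place_even w Xy.
have P2 r s : (r <= n1)%N -> (s <= n1)%N -> r != s ->
    allowed2 a b q (place w y r) (place w y s).
  move=> rn sn rs; have ij := place_rank_neq w rn sn rs.
  apply/(allowed2_sites _ _ (indep_pos y ij) (same_site_place w y r) (same_site_place w y s)).
  exact: pairs.
have lab_neq r s : (r <= n1)%N -> (s <= n1)%N -> r != s ->
    (place w y r).2 != (place w y s).2 /\ - (place w y r).2 != (place w y s).2.
  by move=> rn sn rs; have := indep_place w y rn sn rs.
have [st en inner] := hP; split.
- move: st; rewrite /chain_start; case: (boolP sh) => [sh1 st|sh0].
    apply: allowed_far => //; first by rewrite eq_sym; exact: label_neq0.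
      by rewrite subr0; apply: place_even_sh.
    have Y0 : (pos y (w.1 (inord 0))).2 != 0 by rewrite eq_sym; exact: lam_neq0.
    by apply/(allowed_O_site _ _ (same_site_place w y 0) Y0); exact: short.
  case: (boolP lg) => [lg1 st|lg0 st].
    apply: allowed_far => //; first exact: opp_label_neq.
      by rewrite /= opprK; lia.
    exact: ((allowed_self_site a b w y 0 lg1).1 (long lg1 _)).
  have [h1 h2] := lab_neq 0%N 1%N isT n1_gt0 isT.
  apply: allowed_far => //.
    by have := par 0%N 1%N; rewrite /=; lia.
  exact: (P2 0%N 1%N isT n1_gt0 isT).2.
- move: en; rewrite /chain_end; case: (boolP lg) => [lg1 en|lg0 en].
    apply: allowed_far => //; first by rewrite eq_sym; exact: opp_label_neq.
      by rewrite /=; lia.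
    apply: allowed_sym; first exact: opp_label_neq.
    have /(@allowed_shf a b q _ _ 1) : allowed a b q (opp (place w y n1)) (place w y n1).
      exact: ((allowed_self_site a b w y n1 lg1).1 (long lg1 _)).
    by rewrite mulr1 => h; exact: h.
  have n1p : n1.-1 != n1 by lia.
  have [h1 h2] := lab_neq n1.-1 n1 (leq_pred _) (leqnn _) n1p.
  apply: allowed_far => //; first by rewrite eq_sym; exact: h2.
    by have := par n1.-1 n1; rewrite /=; lia.
  have [_ /(@allowed_shf a b q _ _ 1)] := P2 n1.-1 n1 (leq_pred _) (leqnn _) n1p.
  by rewrite mulr1 => h; apply: allowed_sym; [rewrite /= ; exact: h2 | exact: h].
move=> r rn; have rr : r != r.+1 by lia.
have [h1 _] := lab_neq r r.+1 (ltnW rn) rn rr.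
by apply: allowed_far => //; [exact: inner | exact: (P2 r r.+1 (ltnW rn) rn rr).1].
Qed.

End Thresholds.

(* The representative of [+- y i] in [0, q]. *)
Definition fold y i : pt := if 0 < y i then pos y i else opp (pos y i).

Definition word_lt y i j : bool := site_lt (fold y i) (fold y j).

Lemma indep_fold y i j : i != j -> indep (fold y i) (fold y j).
Proof.
move=> /indep_pos-/(_ y) [] /= h1 h2; rewrite /indep /fold.
by case: ifP => _; case: ifP => _; rewrite /= ?opprK ?(inj_eq oppr_inj);
  split=> //; rewrite -(inj_eq oppr_inj) opprK.
Qed.

Lemma fold_even y i j : configuration y -> (2 %| (fold y j).1 - (fold y i).1)%Z.
Proof.
move=> [_ hpar]; have {hpar} : (2 %| y i - y j)%Z.
  by move: hpar; case: ifP => _ h; [rewrite rpredB | exact: h].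
by rewrite /fold; case: ifP => _; case: ifP => _ /=; lia.
Qed.

Lemma word_lt_irr y : irreflexive (word_lt y).
Proof. by move=> i; rewrite /word_lt /site_lt !ltxx eqxx. Qed.

Lemma word_lt_trans y : transitive (word_lt y).
Proof. by move=> j i k; rewrite /word_lt /site_lt; lia. Qed.

Lemma word_lt_total y i j : i != j -> word_lt y i j || word_lt y j i.
Proof. by move=> /(indep_fold y) [h _]; rewrite /word_lt /site_lt; move: h; lia. Qed.

Lemma far_fold y i j : configuration y -> i != j -> word_lt y i j = far 0 1 (fold y i) (fold y j).
Proof. by move=> Xy ij; rewrite far01P ?fold_even //; have [] := indep_fold y ij. Qed.

Lemma far_opp_fold y i : far 0 1 (opp (fold y i)) (fold y i).
Proof.
by rewrite /far /gapmin /fold; have := lam_lt0 i; case: (ltP 0 (y i)) => /= ? ?; case: ifP; lia.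
Qed.

Lemma far_fold_rfl y i : configuration y -> far 0 1 (fold y i) (rfl q (fold y i)).
Proof.
move=> [/(_ i) yi _].
by rewrite /far /gapmin /fold; have := lam_lt0 i; case: (ltP 0 (y i)) => /= ? ?; case: ifP; lia.
Qed.

Lemma far_O_fold y i : sh -> configuration y -> far 0 1 (0, 0) (fold y i).
Proof.
move=> sh1 [_]; rewrite sh1 => /(_ i) yi.
by rewrite /far /gapmin /fold; have := lam_lt0 i; case: (ltP 0 (y i)) => /= ? ?; case: ifP; lia.
Qed.

Lemma rfl_shf P : rfl q (shf q P) = opp P.
Proof. by rewrite /rfl /shf /opp /=; congr (_, _); ring. Qed.

Lemma place_site y w r : w.2 (w.1 (inord r)) = (0 < y (w.1 (inord r))) ->
  (~~ lg -> r == n1 -> 0 < y (w.1 (inord r))) -> place w y r = fold y (w.1 (inord r)).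
Proof.
move=> e h; rewrite /place /label /lift_site /fold e; case: ifP => // y0.
by case: ifP => // /and3P[h1 h2 h3]; have := h h1 h2; lia.
Qed.

Lemma place_start y w : free_end 0 -> normal w ->
  place w y 0 = fold y (w.1 (inord 0)) \/ place w y 0 = opp (fold y (w.1 (inord 0))).
Proof.
move=> f0 /(_ 0%N isT f0) e; rewrite /place /label /lift_site /fold e.
have -> : [&& ~~ lg, 0%N == n1 & y (w.1 (inord 0)) <= 0] = false by rewrite (ltn_eqF n1_gt0) andbF.
by case: ifP => _; rewrite ?oppK; [left | right].
Qed.

Lemma place_end y w : ~~ lg -> normal w ->
  place w y n1 = fold y (w.1 (inord n1)) \/ place w y n1 = rfl q (fold y (w.1 (inord n1))).
Proof.
move=> lg0 /(_ n1 (leqnn _)) e; rewrite /place /label /lift_site /fold e; last first.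
  by rewrite /free_end lg0 eqxx orbT.
rewrite lg0 eqxx /=; case: ltP => _; first by left.
by right; rewrite /rfl oppK.
Qed.

Lemma place_middle y w r : (r <= n1)%N -> ~~ free_end r -> chain 0 1 sh lg n1 q (place w y) ->
  configuration y -> w.2 (w.1 (inord r)) = (0 < y (w.1 (inord r))) /\
  place w y r = fold y (w.1 (inord r)).
Proof.
move=> rn fr hP [Xy _].
have z0 : far 0 1 (opp (place w y r)) (place w y r).
  apply: (chain_opp _ _ n1_gt1 hP) => //; rewrite eqxx /=; move: fr; rewrite /free_end; lia.
have e : w.2 (w.1 (inord r)) = (0 < y (w.1 (inord r))).
  have := lam_lt0 (w.1 (inord r)); move: fr z0;
    rewrite /place /label /lift_site /free_end /far /gapmin /=.
  case: (w.2 _); first by case: ifP; case: ifP; lia.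
  by case: ifP; lia.
split=> //; apply: place_site => // lg0 rn1; move: fr.
by rewrite /free_end lg0 rn1 orbT.
Qed.

(** The word sorts the folded coordinates and records their signs, except at a fork, where the sign
    is prescribed. Changing it there reflects the extreme site and merely exchanges the two chain
    conditions at that fork. *)
Lemma word_exists y : configuration y ->
  exists2 w, normal w & chain 0 1 sh lg n1 q (place w y).
Proof.
move=> Xy.
have [t ht] := sorts_exists (@word_lt_irr y) (@word_lt_trans y) (@word_lt_total y).
pose w : word := (t, [ffun i => free_end (t^-1 i)%g || (0 < y i)]).
have wE r : (r <= n1)%N -> w.2 (w.1 (inord r)) = free_end r || (0 < y (t (inord r))).
  by move=> rn; rewrite ffunE permK inordK.
have nw : normal w by move=> r rn fr; rewrite wE // fr.
exists w => //.
pose f r := fold y (t (inord r)).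
have a0 : (0 : int) <= 0 by []. have m0 : (0 : int) <= 1 by [].
have flt r s : (r < s)%N -> (s <= n1)%N -> far 0 1 (f r) (f s).
  move=> rs sn; have rn : (r < n1.+1)%N by lia.
  have lt_rs : ((inord r : 'I_n) < (inord s : 'I_n))%N by rewrite !inordK.
  rewrite -far_fold //; first exact: ht.
  by rewrite (inj_eq perm_inj); apply: contraTneq lt_rs => ->; rewrite ltnn.
have mid r : (r <= n1)%N -> ~~ free_end r -> place w y r = f r.
  move=> rn /negbTE fr; apply: place_site; first by rewrite wE // fr.
  by move=> lg0 rn1; move: fr; rewrite /free_end lg0 rn1 orbT.
have P0 : place w y 0 = f 0%N \/ place w y 0 = opp (f 0%N).
  by case: (boolP (free_end 0)) => f0; [exact: place_start | left; apply: mid].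
have P0' : sh || lg -> place w y 0 = f 0%N.
  by move=> h; apply: mid => //; move: n1_gt0; rewrite /free_end; lia.
have Pn : place w y n1 = f n1 \/ place w y n1 = rfl q (f n1).
  by case: (boolP lg) => lg1; [left; apply: mid; rewrite // /free_end lg1 andbF | exact: place_end].
have Pn' : lg -> place w y n1 = f n1 by move=> lg1; apply: mid; rewrite // /free_end lg1 andbF.
have fo r : far 0 1 (opp (f r)) (f r) by exact: far_opp_fold.
have fr r : far 0 1 (f r) (rfl q (f r)) by exact: far_fold_rfl.
split.
- rewrite /chain_start; case: (boolP sh) => [sh1|sh0]; first by rewrite P0' ?sh1 ?far_O_fold.
  case: (boolP lg) => [lg1|lg0]; first by rewrite P0' ?lg1 ?orbT.
  have n12 := n1_gt1 sh0 lg0.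
  have -> : place w y 1 = f 1%N by apply: mid => //; rewrite /free_end; lia.
  case: P0 => ->; last by rewrite oppK flt.
  by apply: far_trans (fo 0%N) (flt _ _ _ _).
- rewrite /chain_end; case: (boolP lg) => [lg1|lg0]; first by rewrite Pn'.
  have -> : place w y n1.-1 = f n1.-1.
    by apply: mid; [lia | move: n1_gt0 n1_gt1; rewrite /free_end; lia].
  have ff : far 0 1 (f n1.-1) (f n1) by apply: flt; lia.
  have rr : far 0 1 (rfl q (f n1)) (rfl q (f n1.-1)) by rewrite far_rfl.
  by case: Pn => -> //; apply: far_trans (fr n1) rr.
move=> r rn.
have [r0|r0] := posnP r; have [rl|rl] := eqVneq r.+1 n1.
- rewrite r0 in rl *; rewrite rl.
  have ff : far 0 1 (f 0%N) (f n1) by apply: flt.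
  have -> : place w y 0 = f 0%N.
    by apply: P0'; case: (boolP sh) (boolP lg) n1_gt1 => //= sh0 [//|lg0] /(_ isT isT); lia.
  by case: Pn => -> //; apply: far_trans ff (fr n1).
- have -> : place w y r.+1 = f r.+1 by apply: mid => //; rewrite /free_end (negPf rl) !andbF.
  rewrite r0; have ff : far 0 1 (f 0%N) (f 1%N) by apply: flt; lia.
  by case: P0 => -> //; apply: far_trans (fo 0%N) ff.
- have -> : place w y r = f r by apply: mid; [lia | rewrite /free_end; lia].
  have ff : far 0 1 (f r) (f n1) by apply: flt; lia.
  by rewrite rl; case: Pn => -> //; apply: far_trans ff (fr n1).
have -> : place w y r = f r by apply: mid; [lia | rewrite /free_end; lia].
have -> : place w y r.+1 = f r.+1 by apply: mid; [lia | rewrite /free_end; lia].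
exact: flt.
Qed.

(** For [r < s] all four relations hold that arise by negating the left site or reflecting the right
    one, so folding the forked ends back does not disturb the order. Signs away from forks are read
    off by [place_middle]. *)
Lemma word_uniq y w w' : configuration y -> normal w -> normal w' ->
  chain 0 1 sh lg n1 q (place w y) -> chain 0 1 sh lg n1 q (place w' y) -> w = w'.
Proof.
move=> Xy.
have a0 : (0 : int) <= 0 by []. have m0 : (0 : int) <= 1 by [].
have sorted u : normal u -> chain 0 1 sh lg n1 q (place u y) -> sorts (word_lt y) u.1.
  move=> nu hP i j lt_ij; have jn : (j <= n1)%N by rewrite -ltnS.
  have iN : (i <= n1)%N by lia.
  rewrite far_fold // ?(inj_eq perm_inj); last by apply: contraTneq lt_ij => ->; rewrite ltnn.
  rewrite -(inord_val i) -(inord_val j);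
    move: (i : nat) (j : nat) lt_ij jn iN => {i j} r s rs sn rn.
  have PP := chain_lt a0 m0 hP rs sn.
  have oP : far 0 1 (opp (place u y r)) (place u y s).
    by apply: (chain_opp a0 m0 n1_gt1 hP) => //; lia.
  have Pr : far 0 1 (place u y r) (rfl q (place u y s)).
    by apply: (chain_rfl a0 m0 n1_gt0 n1_gt1 hP) => //; lia.
  have oPr : far 0 1 (opp (place u y r)) (rfl q (place u y s)).
    by rewrite -rfl_shf far_rfl (chain_wrap a0 m0 n1_gt0 n1_gt1 hP).
  have left_end : fold y (u.1 (inord r)) = place u y r \/
    fold y (u.1 (inord r)) = opp (place u y r).
    case: (boolP (free_end r)) => [fr|fr]; last by have [_ ->] := place_middle rn fr hP Xy; left.
    have r0 : r = 0%N by move: fr; rewrite /free_end; lia.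
    rewrite r0 in fr *; case: (place_start y fr nu) => ->; first by left.
    by right; rewrite oppK.
  have right_end : fold y (u.1 (inord s)) = place u y s \/
    fold y (u.1 (inord s)) = rfl q (place u y s).
    case: (boolP (free_end s)) => [fs|fs]; last by have [_ ->] := place_middle sn fs hP Xy; left.
    have [sn1 lg0] : s = n1 /\ ~~ lg by move: fs; rewrite /free_end; lia.
    rewrite sn1; case: (place_end y lg0 nu) => ->; first by left.
    by right; rewrite rflK.
  by case: left_end => ->; case: right_end => ->.
case: w w' => [t e] [t' e'] nw nw' hP hP'.
have tt : t = t'.
  exact: (sorts_uniq (@word_lt_irr y) (@word_lt_trans y) (sorted _ nw hP) (sorted _ nw' hP')).
rewrite -{}tt in nw' hP' *; congr (_, _); apply/ffunP => i.
have [r rn ->] := rank_of (t, e) i.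
case: (boolP (free_end r)) => fr; first by rewrite [LHS](nw r rn fr) [RHS](nw' r rn fr).
by have [-> _] := place_middle rn fr hP Xy; have [-> _] := place_middle rn fr hP' Xy.
Qed.

End SignedWords.

(** * Gap coordinates *)

Section GapCoordinates.
Variables (sh lg : bool) (n1 : nat).
Hypotheses (n1_gt0 : (0 < n1)%N) (n1_gt1 : ~~ sh -> ~~ lg -> (1 < n1)%N).

(* The marks of the affine diagram; [n1.+1] is the rank, and types B, C, D and BC
   have 2, 2, 4 and 1 marks equal to 1. *)
Definition weight (i : nat) : nat :=
  if i == 0%N then (if sh then 2 else 1)
  else if i == n1.+1 then 1
  else if [&& ~~ sh, ~~ lg & i == 1%N] || ~~ lg && (i == n1) then 1 else 2.

Lemma weight_gt0 i : (0 < weight i)%N.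
Proof. by rewrite /weight; do ?case: ifP. Qed.

Definition descent (w : word n1) (i : nat) : bool :=
  if i == 0%N then
    (if sh then label w 0 < 0 else if lg then label w 0 < - label w 0 else label w 1 < - label w 0)
  else if i == n1.+1 then
    (if lg then - label w n1 < label w n1 else - label w n1.-1 < label w n1)
  else label w i < label w i.-1.

Definition gap (q : int) (z : nat -> int) (i : nat) : int :=
  if i == 0%N then (if sh then z 0%N else if lg then z 0%N + z 0%N else z 0%N + z 1%N)
  else if i == n1.+1 then (if lg then 2 * q - z n1 - z n1 else 2 * q - z n1 - z n1.-1)
  else z i - z i.-1.

Definition partial_gaps (g : nat -> int) (r : nat) : int := \sum_(i < r.+1) (weight i)%:Z * g i.

(* Inverse to [gap], up to the doubling of positions. *)
Definition site (g : nat -> int) (r : nat) : int :=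
  partial_gaps g r - (if [&& ~~ sh, ~~ lg & r == 0%N] then g 1%N else 0)
  + (if ~~ lg && (r == n1) then g n1 else 0).

Lemma partial_gapsS g r : partial_gaps g r.+1 = partial_gaps g r + (weight r.+1)%:Z * g r.+1.
Proof. by rewrite /partial_gaps big_ord_recr. Qed.

Lemma partial_gaps0 g : partial_gaps g 0 = (weight 0)%:Z * g 0%N.
Proof. by rewrite /partial_gaps big_ord1. Qed.

(** A mark 2 gives the doubled step directly. The corrections in [site] supply the missing half
    where a mark next to a fork is 1; at the lower fork, [z 0 = g 0 - g 1] and [z 1 = g 0 + g 1]. *)
Lemma site_step g r : (r < n1)%N -> site g r.+1 - site g r = 2 * g r.+1.
Proof.
move=> rn; rewrite /site partial_gapsS /weight /=.
have [e|ne] := eqVneq r.+1 n1.+1; first by lia.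
have -> : (r == n1) = false by lia.
rewrite andbF.
have [r0|r0] := eqVneq r 0%N; last first.
  have -> : (r.+1 == 1%N) = false by lia.
  rewrite !andbF /=; case: (boolP lg) => [lg1|lg0] /=; first by lia.
  by have [<-|_] := eqVneq r.+1 n1; rewrite /=; lia.
rewrite r0 !andbT; case: (boolP lg) => [lg1|lg0] /=; first by rewrite ?andbF /=; lia.
rewrite andbT; case: (boolP sh) => [sh1|sh0] /=.
  by have [<-|_] := eqVneq 1%N n1; rewrite /=; lia.
by have := n1_gt1 sh0 lg0; have [<-|_] := eqVneq 1%N n1; rewrite /=; lia.
Qed.

Lemma gapE q g z : (forall r, (r <= n1)%N -> z r = site g r) -> partial_gaps g n1.+1 = q ->
  forall i, (i <= n1.+1)%N -> gap q z i = 2 * g i.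
Proof.
move=> zE gq i lei; rewrite /gap.
have [->|i0] := eqVneq i 0%N.
  rewrite !zE //; have := site_step g n1_gt0; rewrite /site partial_gaps0 /weight /=.
  rewrite (ltn_eqF n1_gt0) andbF.
  by case: (boolP sh); case: (boolP lg) => //=; lia.
have [->|iN] := eqVneq i n1.+1; last first.
  have rn : (i.-1 < n1)%N by lia.
  by have := site_step g rn; rewrite prednK ?lt0n // => <-; rewrite !zE //; lia.
move: gq; rewrite partial_gapsS /weight eqxx /= => gq.
rewrite !zE ?leq_pred //.
have rn : (n1.-1 < n1)%N by lia.
have := site_step g rn; rewrite prednK // => e.
have sE : site g n1 = partial_gaps g n1 + (if ~~ lg then g n1 else 0).
  by rewrite /site eqxx andbT (gtn_eqF n1_gt0) !andbF subr0.
by case: (boolP lg) sE => /= _ sE; lia.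
Qed.

Lemma gap_site q g z : (forall i, (i <= n1.+1)%N -> gap q z i = 2 * g i) ->
  (forall r, (r <= n1)%N -> z r = site g r) /\ partial_gaps g n1.+1 = q.
Proof.
move=> gE.
have step r : (r < n1)%N -> z r.+1 - z r = 2 * g r.+1.
  by move=> rn; have := gE r.+1; rewrite /gap /= eqSS (ltn_eqF rn) => -> //; lia.
have z0 : z 0%N = site g 0%N.
  have := gE 0%N isT; have := step 0%N n1_gt0; rewrite /site partial_gaps0 /gap /weight /=.
  rewrite (ltn_eqF n1_gt0) andbF.
  by case: (boolP sh); case: (boolP lg) => //=; lia.
have zE r : (r <= n1)%N -> z r = site g r.
  elim: r => // r IH rn; have := IH (ltnW rn); have := step r rn; have := site_step g rn.
  by lia.
split=> //; have := gE n1.+1 (leqnn _); rewrite /gap eqxx /= partial_gapsS /weight eqxx /=.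
rewrite !zE ?leq_pred //.
have rn : (n1.-1 < n1)%N by lia.
have := site_step g rn; rewrite prednK // => e.
have sE : site g n1 = partial_gaps g n1 + (if ~~ lg then g n1 else 0).
  by rewrite /site eqxx andbT (gtn_eqF n1_gt0) !andbF subr0.
by case: (boolP lg) sE => /= _ sE; lia.
Qed.

Lemma far_oppE a m (P Q : pt) :
  far a m (opp P) Q = (2 * (a + if Q.2 < - P.2 then m else 0) <= P.1 + Q.1).
Proof. by rewrite /far /gapmin /=; congr (_ <= _); ring. Qed.

Lemma far_rflE a m q (P Q : pt) :
  far a m P (rfl q Q) = (2 * (a + if - Q.2 < P.2 then m else 0) <= 2 * q - P.1 - Q.1).
Proof. by rewrite /far /gapmin /=; congr (_ <= _); ring. Qed.

Lemma chain_gaps a m q w (z : nat -> int) :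
  chain a m sh lg n1 q (fun r => (z r, label w r)) <->
  forall i, (i <= n1.+1)%N -> 2 * (a + if descent w i then m else 0) <= gap q z i.
Proof.
split.
  case=> st en inner i lei; rewrite /descent /gap.
  have [_|i0] := eqVneq i 0%N.
    move: st; rewrite /chain_start; case: (sh); first by rewrite /far /gapmin /= subr0.
    by rewrite !far_oppE; case: (lg).
  have [_|iN] := eqVneq i n1.+1.
    by move: en; rewrite /chain_end !far_rflE; case: (lg).
  by have := inner i.-1; rewrite prednK ?lt0n //; apply; lia.
move=> h; split.
- have := h 0%N isT; rewrite /descent /gap /chain_start !far_oppE /=.
  by case: (sh); [rewrite /far /gapmin /= subr0 | case: (lg)].
- have := h n1.+1 (leqnn _); rewrite /descent /gap /chain_end !far_rflE eqxx /=.
  by case: (lg).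
move=> r rn; have := h r.+1; rewrite /descent /gap /= eqSS (ltn_eqF rn).
by apply; lia.
Qed.

Variables (q a m : int).
Hypotheses (q_gt0 : 0 < q) (a_ge0 : 0 <= a) (m_gt0 : 0 < m).
Variable w : word n1.
Hypothesis w_normal : normal sh lg w.

Lemma label_sign r : if w.2 (w.1 (inord r)) then label w r < 0 else 0 < label w r.
Proof. by rewrite /label; case: (w.2 _); rewrite ?oppr_gt0 lam_lt0. Qed.

Section SiteBounds.
Variable z : nat -> int.
Hypothesis hz : chain a m sh lg n1 q (fun r => (z r, label w r)).

Let m_ge0 : 0 <= m. Proof. by lia. Qed.

(** Obtained by comparing the site with its own negative and its own reflection. The sign of the
    label decides which bound is strict, matching the half-open range of a configuration. *)
Lemma site_middle r : (r <= n1)%N -> ~~ free_end sh lg n1 r ->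
  if w.2 (w.1 (inord r)) then 1 <= z r <= q else 0 <= z r < q.
Proof.
move=> rn fr; have m0 := m_ge0; have hl := label_sign r.
have h1 : far a m (opp (z r, label w r)) (z r, label w r).
  by apply: (chain_opp a_ge0 m0 n1_gt1 hz) => //; rewrite eqxx /=; move: fr; rewrite /free_end; lia.
have h2 : far a m (z r, label w r) (rfl q (z r, label w r)).
  by apply: (chain_rfl a_ge0 m0 n1_gt0 n1_gt1 hz) => //; rewrite eqxx /=; move: fr;
    rewrite /free_end; lia.
move: h1 h2 hl; rewrite far_oppE far_rflE /=; case: (w.2 _) => h1 h2 hl; move: h1 h2;
  do 2 case: ifP; lia.
Qed.

Lemma site_start : ~~ sh -> ~~ lg -> - q < z 0%N <= q.
Proof.
move=> sh0 lg0; have m0 := m_ge0; have n12 := n1_gt1 sh0 lg0.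
have f0 : free_end sh lg n1 0 by rewrite /free_end sh0 lg0.
have := label_sign 0; rewrite (w_normal (leq0n _) f0) => hl.
have f1 : ~~ free_end sh lg n1 1 by rewrite /free_end; lia.
have hm := site_middle n1_gt0 f1.
have hl1 := label_sign 1.
have h1 : far a m (opp (z 0%N, label w 0)) (z 1%N, label w 1).
  by apply: (chain_opp a_ge0 m0 n1_gt1 hz (r := 0) (s := 1)); rewrite ?orbT.
have h2 : far a m (z 0%N, label w 0) (z 1%N, label w 1).
  exact: (chain_lt a_ge0 m0 hz (r := 0) (s := 1)).
move: h1 h2 hm hl1; rewrite far_oppE /far /gapmin /=.
by case: (w.2 _) => h1 h2 hm hl1; move: h1 h2; do 2 case: ifP; lia.
Qed.

Lemma site_end : ~~ lg -> 1 <= z n1 <= 2 * q.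
Proof.
move=> lg0; have m0 := m_ge0.
have fe : free_end sh lg n1 n1 by rewrite /free_end lg0 eqxx orbT.
have := label_sign n1; rewrite (w_normal (leqnn _) fe) => hl.
have f1 : ~~ free_end sh lg n1 n1.-1 by move: n1_gt1; rewrite /free_end; lia.
have hm := site_middle (leq_pred n1) f1.
have hl1 := label_sign n1.-1.
have ltp : (n1.-1 < n1)%N by lia.
have h1 : far a m (z n1.-1, label w n1.-1) (z n1, label w n1).
  exact: (chain_lt a_ge0 m0 hz ltp).
have h2 : far a m (z n1, label w n1) (rfl q (z n1.-1, label w n1.-1)).
  by apply: (chain_rfl a_ge0 m0 n1_gt0 n1_gt1 hz (leqnn _) (leq_pred _)); lia.
move: h1 h2 hm hl1; rewrite far_rflE /far /gapmin /=.
by case: (w.2 _) => h1 h2 hm hl1; move: h1 h2; do 2 case: ifP; lia.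
Qed.

End SiteBounds.

Definition unlift_site r (e : bool) (x : int) : int :=
  if e then (if [&& ~~ lg, r == n1 & q < x] then x - 2 * q else x) else - x.

Definition unplace (z : nat -> int) (i : 'I_n1.+1) : int :=
  unlift_site (w.1^-1%g i) (w.2 i) (z (w.1^-1%g i)).

Lemma unliftK r e x : - q < x <= q -> unlift_site r e (lift_site lg n1 q r e x) = x.
Proof.
move=> hx; rewrite /unlift_site /lift_site; case: e; last by rewrite opprK.
case: (boolP (~~ lg)) => //= _; case: (r == n1) => //=.
by case: (lerP x 0) => h; case: ifP; lia.
Qed.

Lemma place_unplace z r : (r <= n1)%N -> (~~ lg -> 1 <= z n1 <= 2 * q) ->
  (place lg q w (unplace z) r).1 = z r.
Proof.
move=> rn he; rewrite /place /unplace permK inordK //= /lift_site /unlift_site.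
case: (w.2 _); last by rewrite opprK.
case: (boolP (~~ lg)) => //= lg0; case: (eqVneq r n1) => //= ->.
by have := he lg0; case: (ltrP q (z n1)) => h1 h2; case: ifP; lia.
Qed.

(** For a fixed word, gaps and configurations determine each other; the required minimal gaps are
    subtracted by [card_gaps_ge]. *)
Lemma card_word_class :
  card_is (fun y => configuration sh q y /\ chain a m sh lg n1 q (place lg q w y))
    (rho (c := fun i : 'I_n1.+2 => weight i) (fun i => weight_gt0 i)
      (q - \sum_(i < n1.+2) (weight i)%:Z * (a + if descent w i then m else 0))).
Proof.
pose gn (g : 'I_n1.+2 -> int) (i : nat) := g (inord i).
pose zz y r := (place lg q w y r).1.
have sumE g : \sum_(i < n1.+2) (weight i)%:Z * g i = partial_gaps (gn g) n1.+1.
  by apply: eq_bigr => i _; rewrite /gn inord_val.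
apply: (card_is_bij (f := fun g => unplace (site (gn g)))
  (g := fun y i => (gap q (zz y) i %/ 2)%Z)) (card_gaps_ge (fun i : 'I_n1.+2 => weight_gt0 i) _ _).
- move=> g [gL]; rewrite sumE => gq.
  have gE := gapE (z := site (gn g)) (fun _ _ => erefl) gq.
  have hz : chain a m sh lg n1 q (fun r => (site (gn g) r, label w r)).
    apply/chain_gaps => i lei; rewrite gE // /gn.
    by have := gL (inord i); rewrite inordK //; lia.
  have pz r : (r <= n1)%N -> zz (unplace (site (gn g))) r = site (gn g) r.
    by move=> rn; apply: place_unplace => //; apply: site_end hz.
  have gE' := gapE pz gq.
  split; last first.
    apply/funext => i; have lei : (i <= n1.+1)%N := leq_ord i.
    by rewrite (gE' _ lei) mulKz // /gn inord_val.
  split; last by apply/chain_gaps => i lei; rewrite gE' // -gE //; move/chain_gaps: hz; apply.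
  (* Steps between sites are twice a gap, so all sites have one parity; with short roots the first
     site is itself twice a gap. *)
  have even r : (r <= n1)%N -> (2 %| site (gn g) r - site (gn g) 0)%Z.
    elim: r => [|r IH] rn; first by rewrite subrr.
    by have := site_step (gn g) rn; have := IH (ltnW rn); lia.
  have evenU i : (2 %| unplace (site (gn g)) i - site (gn g) (w.1^-1%g i))%Z.
    rewrite /unplace /unlift_site; move: (site (gn g) _) => x.
    case: (w.2 i); [case: ifP => _|]; lia.
  have lei i : (w.1^-1%g i <= n1)%N by rewrite -ltnS.
  split.
    move=> i; have := lei i; rewrite /unplace.
    have -> : w.2 i = w.2 (w.1 (w.1^-1%g i)) by rewrite permKV.
    move: (w.1^-1%g i) => j jn.
    rewrite /unlift_site; have := label_sign j; rewrite inord_val.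
    case: (boolP (free_end sh lg n1 j)) => fj; last first.
      have := site_middle hz jn fj; rewrite inord_val.
      case: (w.2 _) => h _; last by lia.
      case: ifP => [/and3P[lg0 jn1 _]|_]; last by lia.
      by move: fj; rewrite /free_end lg0 jn1 orbT.
    have := w_normal jn fj; rewrite inord_val => -> _.
    have [jn1|jn1] := eqVneq (j : nat) n1; last first.
      rewrite andbF /=; move: fj;
        rewrite /free_end (negPf jn1) andbF orbF => /and3P[sh0 lg0 /eqP ->].
      exact: (site_start hz sh0 lg0).
    have lg0 : ~~ lg by move: fj; rewrite /free_end; lia.
    have {hz} : 1 <= site (gn g) j <= 2 * q by rewrite jn1; exact: site_end hz lg0.
    by rewrite lg0 /=; case: ifP; lia.
  have even0 : sh -> (2 %| site (gn g) 0)%Z.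
    by move=> sh1; have := gE 0%N isT; rewrite /gap /= sh1; lia.
  case: ifP => sh1 i; first by have := even0 sh1; have := even _ (lei i); have := evenU i; lia.
  move=> j; have := even _ (lei i); have := evenU i; have := even _ (lei j); have := evenU j; lia.
move=> y [Xy hP]; have [Xb _] := Xy.
have par := place_even lg w Xy.
have ev i : (i <= n1.+1)%N -> (2 %| gap q (zz y) i)%Z.
  move=> lei; rewrite /gap; case: ifP => _.
    case: (boolP sh) => sh1; first exact: (place_even_sh lg w sh1 Xy).
    by case: ifP => _; [|have := par 0%N 1%N]; rewrite /zz; lia.
  case: ifP => _; last exact: par.
  by case: ifP => _; [|have := par n1 n1.-1]; rewrite /zz; lia.
set g := fun i : 'I_n1.+2 => _.
have gE i : (i <= n1.+1)%N -> gap q (zz y) i = 2 * gn g i.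
  by move=> lei; rewrite /gn /g inordK //; have := ev i lei; lia.
have [zE gq] := gap_site gE.
split.
  split; last by rewrite sumE.
  move=> i; have lei : (i <= n1.+1)%N by rewrite -ltnS.
  have := (chain_gaps a m q w (zz y)).1 hP i lei.
  by rewrite gE // /gn inord_val; lia.
apply/funext => i; rewrite /unplace.
have lei : (w.1^-1%g i <= n1)%N by rewrite -ltnS.
by rewrite -zE // /zz /place /= inord_val permKV unliftK.
Qed.

End GapCoordinates.

Lemma far_weaken (a m : int) P Q : 0 <= a -> 0 < m -> far a m P Q -> far 0 1 P Q.
Proof. by rewrite /far /gapmin; case: ifP; lia. Qed.

Lemma chain_weaken (a m : int) sh lg n1 q P : 0 <= a -> 0 < m ->
  chain a m sh lg n1 q P -> chain 0 1 sh lg n1 q P.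
Proof.
move=> a0 m0 [st en inner]; have W := far_weaken a0 m0; split.
- by move: st; rewrite /chain_start; case: (sh) => [/W//|]; case: (lg) => /W.
- by move: en; rewrite /chain_end; case: (lg) => /W.
by move=> r /inner/W.
Qed.

(** * Points over a prime field: types B, C, D and BC *)

Section SignedCount.
Variables (sh lg : bool) (n1 : nat).
Hypotheses (n1_gt0 : (0 < n1)%N) (n1_gt1 : ~~ sh -> ~~ lg -> (1 < n1)%N).

Definition normal_word : finType := {w : word n1 | `[< normal sh lg w >]}.

Definition descents (w : word n1) : nat := \sum_(i < n1.+2) weight sh lg n1 i * descent sh lg w i.

Notation wt := (fun i : 'I_n1.+2 => weight sh lg n1 i).
Notation rho := (rho (c := wt) (fun i => weight_gt0 sh lg n1 i)).

Theorem signed_count (q a b : nat) : (0 < q)%N -> (a <= b)%N ->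
  card_is (fun y : 'I_n1.+1 -> int => configuration sh q y /\ admissible sh lg q a b y)
    (\sum_(w : normal_word)
       rho (q%:Z - (a * cox wt)%:Z - (b + 1 - a)%N%:Z * (descents (val w))%:Z))%N.
Proof.
move=> q0 ab; set m := (b + 1 - a)%N.
have mE : m%:Z = b%:Z + 1 - a%:Z by rewrite /m; lia.
have a0 : 0 <= a%:Z by []. have m0 : 0 < m%:Z by lia.
have ab' : a%:Z <= b%:Z by lia.
pose P (w : normal_word) (y : 'I_n1.+1 -> int) :=
  configuration sh q y /\ chain a m sh lg n1 q (place lg q (val w) y).
apply: (@card_is_ext _ (fun y => exists w, P w y)) => [y|].
  split=> [[w [Xy hP]]|[Xy adm]].
    by split=> //; rewrite mE in hP; apply: (chain_admissible n1_gt0 n1_gt1 a0 ab' Xy hP).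
  have [w nw hP] := word_exists n1_gt0 n1_gt1 (y := y) Xy.
  have nw' : `[< normal sh lg w >] by apply/asboolP.
  exists (exist _ w nw'); split=> //=; rewrite mE.
  exact: (admissible_chain n1_gt0 n1_gt1 a0 ab' Xy hP adm).
apply: card_is_bigU => [w|w w' y [Xy hP] [_ hP']]; last first.
  apply: val_inj; have /asboolP nw := valP w; have /asboolP nw' := valP w'.
  by apply: (word_uniq n1_gt0 n1_gt1 Xy nw nw'); apply: chain_weaken a0 m0 _.
have /asboolP nw := valP w; have q0' : 0 < q%:Z by lia.
have := card_word_class n1_gt0 n1_gt1 q0' a0 m0 nw.
rewrite [X in rho (_ - X)](_ : _ = (a * cox wt)%:Z + m%:Z * (descents (val w))%:Z).
  by rewrite opprD addrA.
rewrite /cox /descents -!natz natrM !natr_sum !natz !mulr_sumr -big_split /=.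
apply: eq_bigr => i _; rewrite natrM !natz; case: descent => /=; ring.
Qed.

End SignedCount.

(** * Parities of the lifted coordinates *)

Section Configurations.
Variables (n1 q : nat).
Hypothesis q_gt0 : (0 < q)%N.
Notation n := n1.+1.

Definition parity_config (e : bool) (y : 'I_n -> int) : Prop :=
  forall i, - q%:Z < y i <= q%:Z /\ (2 %| y i - (e : nat)%:Z)%Z.

Lemma configuration_parity sh y : configuration sh q y <->
  exists e : bool, (sh ==> ~~ e) /\ parity_config e y.
Proof.
split=> [[Xb hpar]|[e [she Py]]]; last first.
  split=> [i|]; first by have [] := Py i.
  case: ifP she => sh1 /= he i; have [_ pi] := Py i; first by case: (e) he pi => //; lia.
  by move=> j; have [_ pj] := Py j; lia.
exists (~~ (2 %| y ord0)%Z); split.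
  by case: ifP hpar => // sh1 /(_ ord0) ->.
move=> i; split=> //; have : (2 %| y ord0 - y i)%Z.
  by move: hpar; case: ifP => _ h; [rewrite rpredB | exact: h].
by case: (boolP (2 %| y ord0)%Z) => /= ? ?; lia.
Qed.

Lemma parity_config_inj e e' y : parity_config e y -> parity_config e' y -> e = e'.
Proof. by move=> /(_ ord0)[_ h] /(_ ord0)[_ h']; case: (e) (e') h h' => [] [] //=; lia. Qed.

Lemma card_parity_config e : card_is (parity_config e) (q ^ n).
Proof.
(* [q - d] is the largest integer up to [q] with the parity of [e]; subtracting [2 * v] with [v < q]
   runs through that parity in the half-open interval. *)
pose d : int := ((q + e) %% 2)%N.
pose f (v : {ffun 'I_n -> 'I_q}) i : int := q%:Z - d - 2 * (v i)%:Z.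
have -> : (q ^ n = #|{: {ffun 'I_n -> 'I_q}}|)%N by rewrite card_ffun !card_ord.
apply: (card_is_image (e := f)) => [v v' fv|y].
  apply/ffunP => i; apply: ord_inj.
  have := congr1 (fun h => h i) fv; rewrite /f /=.
  by case: (v i) (v' i) => x hx [x' hx'] /=; lia.
split=> [hy|[v _ <-] i]; last first.
  by rewrite /f /d; case: (v i) => x hx /=; case: (e) => /=; lia.
have bnd i : (`|(q%:Z - d - y i) %/ 2|%Z < q)%N.
  have [h1 h2] := hy i; move: h1 h2; rewrite /d; case: (e) => /=; lia.
exists [ffun i => Ordinal (bnd i)] => //; apply/funext => i; rewrite /f ffunE /=.
by have [h1 h2] := hy i; move: h1 h2; rewrite /d; case: (e) => /=; lia.
Qed.

(** Source of the constant [C]: only even lifts occur with short roots, whereas without them each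
    point has an even and an odd lift. *)
Lemma card_configuration_of sh (Q : ('I_n -> int) -> Prop) N :
  (forall e : bool, sh ==> ~~ e -> card_is (fun y => parity_config e y /\ Q y) N) ->
  card_is (fun y => configuration sh q y /\ Q y) ((if sh then 1 else 2) * N)%N.
Proof.
move=> hN; pose E := {e : bool | sh ==> ~~ e}.
pose P (e : E) y := parity_config (val e) y /\ Q y.
have -> : ((if sh then 1 else 2) * N = \sum_(e : E) N)%N.
  rewrite sum_nat_const card_sig; congr (_ * _)%N.
  rewrite -sum1_card big_mkcond big_bool /=; by case: (sh).
apply: (@card_is_ext _ (fun y => exists e, P e y)) => [y|].
  split=> [[[e he] [Py Qy]]|[/configuration_parity[e [he Py]] Qy]].
    by split=> //; apply/configuration_parity; exists e.
  by exists (exist _ e he).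
apply: card_is_bigU => [[e he]|e e' y [h _] [h' _]]; first exact: hN.
by apply: val_inj; apply: parity_config_inj h h'.
Qed.

End Configurations.

Section PrimeField.
Variables (n1 p : nat).
Hypotheses (p_prime : prime p) (p_odd : odd p).
Notation n := n1.+1.
Notation F := 'F_p.

Lemma intr_Fp_eq (x y : int) : (x%:~R == y%:~R :> F) = (p%:Z %| x - y)%Z.
Proof. by rewrite -subr_eq0 -rmorphB /= -(dvdz_pcharf (pchar_Fp p_prime)). Qed.

Lemma two_Fp_neq0 : (2%:R : F) != 0.
Proof.
rewrite -(dvdn_pcharf (pchar_Fp p_prime)); apply: contraL p_odd => /dvdn_leq - /(_ isT).
by have := prime_gt1 p_prime; move: p_odd; lia.
Qed.

(** For odd [p], an even integer divisible by [p] is divisible by [2 * p]. *)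
Lemma avoids_Fp (a b d : int) : (2 %| d)%Z ->
  avoids a b p d <-> forall k, 1 - a <= k <= b -> d%:~R != (2 * k)%:~R :> F.
Proof.
move=> ed; split=> h k hk; [apply/negP | move/dvdzP => [j hj]; have := h k hk; case/negP].
  rewrite intr_Fp_eq => /dvdzP[j hj]; apply: (h k hk).
  have e2 : (2 %| j)%Z by move: p_odd hj; nia.
  by apply/dvdzP; exists (j %/ 2)%Z; rewrite hj; lia.
by rewrite intr_Fp_eq hj mulrA dvdz_mull.
Qed.

(* The representative of [u] modulo [p] in the interval (-p, p] that has parity [e]. *)
Definition Fp_rep (e : bool) (u : F) : int :=
  let v := (u : nat) in
  if odd v == e then v%:Z else if v == 0%N then p%:Z else v%:Z - p%:Z.

Lemma Fp_repK e u : (Fp_rep e u)%:~R = u.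
Proof.
have vE : (u : nat)%:R = u by rewrite natr_Zp.
have p0 : (p%:R : F) = 0 by apply/eqP; rewrite -(dvdn_pcharf (pchar_Fp p_prime)).
rewrite /Fp_rep; case: ifP => _; first by rewrite -[LHS]/((u : nat)%:R).
case: ifP => [/eqP u0|_]; first by rewrite -[LHS]/(p%:R) p0 -vE u0.
by rewrite rmorphB /= -[X in X - _]/((u : nat)%:R) -[X in _ - X]/(p%:R) p0 subr0.
Qed.

Lemma Fp_rep_bounds (e : bool) (u : F) : - p%:Z < Fp_rep e u <= p%:Z /\
  (2 %| Fp_rep e u - (e : nat)%:Z)%Z.
Proof.
have : (u < p)%N by rewrite -[ltnRHS](Fp_cast p_prime) ltn_ord.
rewrite /Fp_rep; move: (u : nat) => v ltv.
by move: p_odd; case: (e); case: (boolP (odd v)) => ov /=; (try case: eqP => v0); lia.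
Qed.

Lemma Fp_rep_uniq (e : bool) (x : int) : - p%:Z < x <= p%:Z -> (2 %| x - (e : nat)%:Z)%Z ->
  Fp_rep e x%:~R = x.
Proof.
move=> hx ex; have [] := Fp_rep_bounds e x%:~R.
have : (p%:Z %| Fp_rep e x%:~R - x)%Z by rewrite -intr_Fp_eq Fp_repK.
move: (Fp_rep _ _) => y /dvdzP[j hj] hy ey.
have e2 : (2 %| j)%Z by move: p_odd hj; nia.
have : j < 2 by nia.
have : -2 < j by nia.
move=> h1 h2; have j0 : j = 0 by lia.
by move: hj; rewrite j0; lia.
Qed.

Definition signed_good (sh lg : bool) (a b : int) (x : 'rV[F]_n) : Prop :=
  forall k : int, 1 - a <= k <= b ->
  [/\ forall i j : 'I_n, (i < j)%N -> x 0 i - x 0 j != k%:~R /\ x 0 i + x 0 j != k%:~R,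
      lg -> forall i, x 0 i + x 0 i != k%:~R
    & sh -> forall i, x 0 i != k%:~R].

Lemma card_admissible_Fp (sh lg : bool) (a b : int) (e : bool) : (sh -> e = false) ->
  card_is (fun y : 'I_n -> int => parity_config p e y /\ admissible sh lg p a b y)
    #|[pred x : 'rV[F]_n | `[< signed_good sh lg a b x >]]|.
Proof.
move=> she; have two0 := two_Fp_neq0.
(* Doubled positions are lifts of [2 x], so [g] divides by 2, which is invertible modulo an odd
   prime. *)
pose f (x : 'rV[F]_n) i := Fp_rep e (2%:R * x 0 i).
pose g (y : 'I_n -> int) : 'rV[F]_n := \row_i ((y i)%:~R / 2%:R).
have fgP (y : 'I_n -> int) (x : 'rV[F]_n) : parity_config p e y ->
  (forall i, (y i)%:~R = 2%:R * x 0 i) ->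
    admissible sh lg p a b y <-> signed_good sh lg a b x.
  move=> Py yx.
  have half (u : F) k : (2%:R * u == (2 * k)%:~R) = (u == k%:~R).
    by rewrite rmorphM /= (inj_eq (mulfI two0)).
  have evB i j : (2 %| y i - y j)%Z by have [_ h1] := Py i; have [_ h2] := Py j; lia.
  have evD i j : (2 %| y i + y j)%Z by have [_ h1] := Py i; have [_ h2] := Py j; lia.
  have hB i j k : (y i - y j)%:~R != (2 * k)%:~R :> F = (x 0 i - x 0 j != k%:~R).
    by rewrite rmorphB /= !yx -mulrBr half.
  have hD i j k : (y i + y j)%:~R != (2 * k)%:~R :> F = (x 0 i + x 0 j != k%:~R).
    by rewrite rmorphD /= !yx -mulrDr half.
  have aB (i j : 'I_n) : (i < j)%N -> allowed a b p (pos y i) (pos y j) <->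
    avoids a b p (y i - y j).
    by move=> ij; rewrite /allowed /= /lam; case: ifP => //; lia.
  have aB' (i j : 'I_n) : (i < j)%N -> allowed a b p (pos y j) (pos y i) <->
    avoids a b p (y i - y j).
    by move=> ij; rewrite /allowed /= /lam; case: ifP => //; lia.
  have aD i j : allowed a b p (opp (pos y i)) (pos y j) <-> avoids a b p (y i + y j).
    rewrite /allowed /=; have := lam_lt0 i; have := lam_lt0 j; case: ifP; first by lia.
    by rewrite opprK addrC.
  have aO i : allowed a b p (0, 0) (pos y i) <-> avoids a b p (y i).
    by rewrite /allowed /=; have := lam_lt0 i; case: ifP; [lia | rewrite subr0].
  have evS : sh -> forall i, (2 %| y i)%Z.
    by move=> /she e0 i; have [_] := Py i; rewrite e0 subr0.
  have hS i k : (y i)%:~R != (2 * k)%:~R :> F = (x 0 i != k%:~R) by rewrite yx half.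
  split=> [[pairs long short] k hk|hx].
    split=> [i j ij|lg1 i|sh1 i].
    - have ne : i != j by rewrite -val_eqE /= ltn_eqF.
      have [/(aB _ _ ij) h1 /aD h2] := pairs i j ne.
      by rewrite -hB -hD; split;
        [move/(avoids_Fp _ _ (evB i j)): h1 | move/(avoids_Fp _ _ (evD i j)): h2]; apply.
    - by rewrite -hD; move/aD/(avoids_Fp _ _ (evD i i)): (long lg1 i); apply.
    by rewrite -hS; move/aO/(avoids_Fp _ _ (evS sh1 i)): (short sh1 i); apply.
  split=> [i j ne|lg1 i|sh1 i].
  - have D : allowed a b p (opp (pos y i)) (pos y j).
      apply/aD/(avoids_Fp _ _ (evD i j)) => k /hx[hp _ _]; rewrite hD.
      case: (ltngtP i j) => [ij|ij|/val_inj e']; first exact: (hp _ _ ij).2.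
        by rewrite addrC (hp _ _ ij).2.
      by rewrite e' eqxx in ne.
    split=> //; case: (ltngtP i j) => [ij|ij|/val_inj e']; last by rewrite e' eqxx in ne.
      by apply/(aB _ _ ij)/(avoids_Fp _ _ (evB i j)) => k /hx[hp _ _]; rewrite hB (hp _ _ ij).1.
    by apply/(aB' _ _ ij)/(avoids_Fp _ _ (evB j i)) => k /hx[hp _ _]; rewrite hB (hp _ _ ij).1.
  - by apply/aD/(avoids_Fp _ _ (evD i i)) => k /hx[_ hl _]; rewrite hD hl.
  by apply/aO/(avoids_Fp _ _ (evS sh1 i)) => k /hx[_ _ hs]; rewrite hS hs.
have Pf x : parity_config p e (f x) by move=> i; apply: Fp_rep_bounds.
have fx x i : (f x i)%:~R = 2%:R * x 0 i by rewrite /f Fp_repK.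
have gy (y : 'I_n -> int) i : (y i)%:~R = 2%:R * g y 0 i by rewrite /g mxE mulrC divfK.
apply: (card_is_bij (f := f) (g := g)) (card_is_fin _) => [x|y [Py adm]].
  rewrite inE => /asboolP hx; split; first by split=> //; apply/(fgP (f x) x).
  by apply/rowP => i; rewrite mxE fx mulrC mulKf.
split; first by rewrite inE; apply/asboolP/(fgP y).
by apply/funext => i; rewrite /f -gy; have [h1 h2] := Py i; apply: Fp_rep_uniq.
Qed.

End PrimeField.

(** * Type A *)

Section CyclicWords.
Variable n0 : nat.
Notation n := n0.+1.
Implicit Types (w : {perm 'I_n}) (y : 'I_n -> int) (r s : nat).

(* The coordinates of type A are normalised by [x_0 = 0], the site [cO]; the others
   lie on a circle of length [q]. *)
Definition cpos y (i : 'I_n) : pt := (2 * y i, i%:Z + 1).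
Definition cplace w y r : pt := cpos y (w (inord r)).
Definition cO : pt := (0, 0).

Definition cchain (a m q : int) (P : nat -> pt) : Prop :=
  [/\ far a m cO (P 0%N), far a m (P n0) (shf q cO)
    & forall r, (r < n0)%N -> far a m (P r) (P r.+1)].

Definition cconfig (q : int) y : Prop := forall i, 0 <= y i < q.

Definition cadmissible (a b q : int) y : Prop :=
  (forall i j, i != j -> allowed a b q (cpos y i) (cpos y j)) /\
  (forall i, allowed a b q cO (cpos y i)).

Lemma cpos_neq y i j : i != j -> (cpos y i).2 != (cpos y j).2.
Proof. by rewrite -val_eqE /=; lia. Qed.

Lemma cpos_neq0 y i : cO.2 != (cpos y i).2.
Proof. by rewrite /=; lia. Qed.

Lemma crank_neq w r s : (r <= n0)%N -> (s <= n0)%N -> r != s -> w (inord r) != w (inord s).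
Proof. by move=> rn sn rs; rewrite (inj_eq perm_inj) -val_eqE /= !inordK. Qed.

Lemma crank_of w i : exists2 r, (r <= n0)%N & i = w (inord r).
Proof. by exists (w^-1%g i); rewrite ?inord_val ?permKV // -ltnS. Qed.

Section CyclicChain.
Variables (a m q : int) (P : nat -> pt).
Hypotheses (a_ge0 : 0 <= a) (m_ge0 : 0 <= m) (hP : cchain a m q P).

Lemma cchain_lt r s : (r < s)%N -> (s <= n0)%N -> far a m (P r) (P s).
Proof.
have [_ _ inner] := hP; elim: s => // s IHs; rewrite ltnS leq_eqVlt => /predU1P[->|rs] sn.
  exact: inner.
by apply: (far_trans a_ge0 m_ge0 (IHs rs (ltnW sn)) (inner _ sn)).
Qed.

Lemma cchain_start r : (r <= n0)%N -> far a m cO (P r).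
Proof.
have [st _ _] := hP; case: r => [//|r] rn.
exact: (far_trans a_ge0 m_ge0 st (cchain_lt _ rn)).
Qed.

Lemma cchain_end r : (r <= n0)%N -> far a m (P r) (shf q cO).
Proof.
have [_ en _] := hP; rewrite leq_eqVlt => /predU1P[->//|rn].
exact: (far_trans a_ge0 m_ge0 (cchain_lt rn (leqnn _)) en).
Qed.

Lemma cchain_wrap r s : (r <= n0)%N -> (s <= n0)%N -> far a m (P s) (shf q (P r)).
Proof.
move=> rn sn; apply: (far_trans a_ge0 m_ge0 (cchain_end sn)).
by rewrite far_shf cchain_start.
Qed.

End CyclicChain.

Lemma cchain_admissible (a b q : int) w y : 0 <= a -> a <= b ->
  cchain a (b + 1 - a) q (cplace w y) -> cadmissible a b q y.
Proof.
move=> a0 ab hP; have m0 : 0 <= b + 1 - a by lia.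
split=> [i j|i]; last first.
  have [r rn ->] := crank_of w i.
  by apply: far_allowed (cpos_neq0 _ _) (cchain_start a0 m0 hP rn) (cchain_end a0 m0 hP rn).
have [r rn ri] := crank_of w i; have [s sn sj] := crank_of w j.
rewrite {}ri {}sj => ne; have rs : r != s by apply: contraNneq ne => ->.
wlog lt_rs : r s rn sn ne rs / (r < s)%N.
  move=> W; case: (ltngtP r s) => [lt|lt|e]; [exact: W| |by rewrite e eqxx in rs].
  by apply: allowed_sym; [rewrite cpos_neq // eq_sym | apply: W; rewrite // eq_sym].
apply: far_allowed => //; first exact: cpos_neq.
  exact: (cchain_lt a0 m0 hP lt_rs).
exact: (cchain_wrap a0 m0 hP).
Qed.

Lemma cadmissible_chain (a b q : int) w y : 0 <= a -> a <= b ->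
  cchain 0 1 q (cplace w y) -> cadmissible a b q y -> cchain a (b + 1 - a) q (cplace w y).
Proof.
move=> a0 ab [st en inner] [pairs zero].
have ev (i j : 'I_n) : (2 %| (cpos y i).1 - (cpos y j).1)%Z by rewrite /=; lia.
have ev0 (i : 'I_n) : (2 %| (cpos y i).1)%Z by rewrite /=; lia.
split.
- by apply: allowed_far st (zero _) => //; rewrite ?cpos_neq0 // subr0 ev0.
- apply: allowed_far en _ => //; first by rewrite eq_sym cpos_neq0.
    by rewrite /cplace /shf /=; lia.
  apply: allowed_sym; first exact: cpos_neq0.
  have := @allowed_shf a b q _ _ 1 (zero (w (inord n0))).
  by rewrite mulr1 => h; exact: h.
move=> r rn; have ne : w (inord r) != w (inord r.+1) by apply: crank_neq; lia.
apply: allowed_far => //; [exact: cpos_neq | exact: ev | exact: inner | exact: pairs].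
Qed.

Definition cword_lt y (i j : 'I_n) : bool := site_lt (cpos y i) (cpos y j).

Lemma far_cpos y i j : i != j -> cword_lt y i j = far 0 1 (cpos y i) (cpos y j).
Proof. by move=> ij; rewrite far01P ?cpos_neq //=; lia. Qed.

Lemma cword_lt_irr y : irreflexive (cword_lt y).
Proof. by move=> i; rewrite /cword_lt /site_lt !ltxx eqxx. Qed.

Lemma cword_lt_trans y : transitive (cword_lt y).
Proof. by move=> j i k; rewrite /cword_lt /site_lt; lia. Qed.

Lemma cword_lt_total y i j : i != j -> cword_lt y i j || cword_lt y j i.
Proof. by move=> /(cpos_neq y) h; rewrite /cword_lt /site_lt; move: h; lia. Qed.

Lemma cword_exists q y : cconfig q y -> exists w, cchain 0 1 q (cplace w y).
Proof.
move=> Xy.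
have [t ht] := sorts_exists (@cword_lt_irr y) (@cword_lt_trans y) (@cword_lt_total y).
exists t; split.
- by have := Xy (t (inord 0)); rewrite /far /gapmin /cplace /=; do ?case: ifP; lia.
- by have := Xy (t (inord n0)); rewrite /far /gapmin /cplace /=; do ?case: ifP; lia.
move=> r rn; have ne : t (inord r) != t (inord r.+1) by apply: crank_neq; lia.
by rewrite -far_cpos //; apply: ht; rewrite !inordK //; lia.
Qed.

Lemma cword_uniq q y w w' : cchain 0 1 q (cplace w y) -> cchain 0 1 q (cplace w' y) -> w = w'.
Proof.
have sorted u : cchain 0 1 q (cplace u y) -> sorts (cword_lt y) u.
  move=> hP i j lt_ij; have jn : (j <= n0)%N by rewrite -ltnS.
  rewrite far_cpos ?(inj_eq perm_inj); last by apply: contraTneq lt_ij => ->; rewrite ltnn.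
  have := cchain_lt (lexx 0) ler01 hP lt_ij jn.
  by rewrite /cplace !inord_val.
by move=> h h'; apply: (sorts_uniq (@cword_lt_irr y) (@cword_lt_trans y) (sorted _ h)
  (sorted _ h')).
Qed.

(** The origin has label 0, below all others: the first step is never a descent and the closing one
    always is. *)
Definition cdescent w (i : nat) : bool :=
  (i == n) || (0 < i)%N && ((w (inord i) : nat) < w (inord i.-1))%N.

Definition cgap (q : int) (z : nat -> int) (i : nat) : int :=
  (if i == n then q else z i) - (if i == 0%N then 0 else z i.-1).

Definition csite (g : nat -> int) (r : nat) : int := \sum_(i < r.+1) g i.

Lemma cgapE q g z : (forall r, (r <= n0)%N -> z r = csite g r) -> csite g n = q ->
  forall i, (i <= n)%N -> cgap q z i = g i.
Proof.
move=> zE gq i lei; rewrite /cgap.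
have step r : csite g r.+1 = csite g r + g r.+1 by rewrite /csite big_ord_recr.
have [->|iN] := eqVneq i n; first by rewrite /= -gq step zE // addrC addKr.
case: i lei iN => [|i] lei iN /=; first by rewrite zE // subr0 /csite big_ord1.
by rewrite !zE ?step; [rewrite addrC addKr | lia | lia].
Qed.

Lemma cgap_site q g z : (forall i, (i <= n)%N -> cgap q z i = g i) ->
  (forall r, (r <= n0)%N -> z r = csite g r) /\ csite g n = q.
Proof.
move=> gE.
have step r : csite g r.+1 = csite g r + g r.+1 by rewrite /csite big_ord_recr.
have zE r : (r <= n0)%N -> z r = csite g r.
  elim: r => [|r IH] rn.
    by have := gE 0%N isT; rewrite /cgap /= subr0 /csite big_ord1.
  have := gE r.+1; rewrite /cgap eqSS (ltn_eqF rn) /= step -IH ?(ltnW rn) // => <-; last by lia.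
  by rewrite addrC subrK.
split=> //; have := gE n (leqnn _); rewrite /cgap eqxx /= step zE // => <-.
by rewrite addrC subrK.
Qed.

Lemma cchain_gaps a m q w (z : nat -> int) :
  cchain a m q (fun r => (2 * z r, (w (inord r))%:Z + 1)) <->
  forall i, (i <= n)%N -> a + (if cdescent w i then m else 0) <= cgap q z i.
Proof.
have E (x u v v' : int) : (2 * (x + u) <= 2 * v - 2 * v') = (x + u <= v - v') by lia.
split.
  case=> st en inner i lei; rewrite /cdescent /cgap.
  have [->|iN] := eqVneq i n.
    by move: en; rewrite /far /gapmin /=; do ?case: ifP; lia.
  case: i lei iN => [|i] lei iN /=; first by move: st; rewrite /far /gapmin /=; do ?case: ifP; lia.
  have /inner : (i < n0)%N by lia.
  rewrite /far /gapmin /= E; move: (w _) (w _) => [x hx] [x' hx'] /=.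
  by do ?case: ifP; lia.
move=> h; split.
- have := h 0%N isT; rewrite /cdescent /cgap /far /gapmin /=; do ?case: ifP; lia.
- by have := h n (leqnn _); rewrite /cdescent /cgap /far /gapmin eqxx /=; do ?case: ifP; lia.
move=> r rn; have := h r.+1; rewrite /cdescent /cgap /far /gapmin eqSS (ltn_eqF rn) /= E.
move=> /(_ (leqW rn)); move: (w _) (w _) => [x hx] [x' hx'] /=.
by do ?case: ifP; lia.
Qed.

Notation wt := (fun _ : 'I_n.+1 => 1%N).
Notation rho := (rho (c := wt) (fun _ => isT)).

Definition cdescents w : nat := \sum_(i < n.+1) cdescent w i.

Lemma card_cword_class (a m q : int) w : 0 <= a -> 0 < m ->
  card_is (fun y => cconfig q y /\ cchain a m q (cplace w y))
    (rho (q - \sum_(i < n.+1) 1%N%:Z * (a + if cdescent w i then m else 0))).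
Proof.
move=> a0 m0; have m0' : 0 <= m by lia.
pose gn (g : 'I_n.+1 -> int) (i : nat) := g (inord i).
pose zz (y : 'I_n -> int) r := y (w (inord r)).
have sumE g : \sum_(i < n.+1) 1%N%:Z * g i = csite (gn g) n.
  by apply: eq_bigr => i _; rewrite /gn inord_val mul1r.
pose f (z : nat -> int) (i : 'I_n) : int := z (w^-1%g i).
have fz z r : (r <= n0)%N -> zz (f z) r = z r by move=> rn; rewrite /zz /f permK inordK.
have := card_gaps_ge (c := wt) (fun _ => isT) (fun i => a + if cdescent w i then m else 0) q.
apply: (card_is_bij (f := fun g => f (csite (gn g))) (g := fun y (i : 'I_n.+1) => cgap q (zz y) i)).
- move=> g [gL]; rewrite sumE => gq.
  have gE := cgapE (fz (csite (gn g))) gq.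
  have hz : cchain a m q (cplace w (f (csite (gn g)))).
    apply/(cchain_gaps a m q w (zz (f (csite (gn g))))) => i lei; rewrite gE // /gn.
    by have := gL (inord i); rewrite inordK.
  split; last by apply/funext => i; rewrite (gE _ (leq_ord i)) /gn inord_val.
  split=> // i; have [r rn ->] := crank_of w i.
  have := cchain_start a0 m0' hz rn; have := cchain_end a0 m0' hz rn.
  by rewrite /far /gapmin /cplace /=; do ?case: ifP; lia.
move=> y [Xy hP]; set g := fun i : 'I_n.+1 => _.
have gE i : (i <= n)%N -> cgap q (zz y) i = gn g i by move=> lei; rewrite /gn /g inordK.
have [zE gq] := cgap_site gE.
split; last by apply/funext => i; rewrite /f -zE ?leq_ord // /zz inord_val permKV.
split; last by rewrite sumE.
by move=> i; exact: ((cchain_gaps a m q w (zz y)).1 hP i (leq_ord i)).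
Qed.

Theorem cyclic_count (q a b : nat) : (a <= b)%N ->
  card_is (fun y => cconfig q y /\ cadmissible a b q y)
    (\sum_(w : {perm 'I_n})
       rho (q%:Z - (a * cox wt)%:Z - (b + 1 - a)%N%:Z * (cdescents w)%:Z))%N.
Proof.
move=> ab; set m := (b + 1 - a)%N.
have mE : m%:Z = b%:Z + 1 - a%:Z by rewrite /m; lia.
have a0 : 0 <= a%:Z by []. have m0 : 0 < m%:Z by lia.
have ab' : a%:Z <= b%:Z by lia.
have weaken w y : cchain a m q (cplace w y) -> cchain 0 1 q (cplace w y).
  by have W := far_weaken a0 m0; case=> /W st /W en inner; split=> // r /inner/W.
pose P (w : {perm 'I_n}) y := cconfig q y /\ cchain a m q (cplace w y).
apply: (@card_is_ext _ (fun y => exists w, P w y)) => [y|].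
  split=> [[w [Xy hP]]|[Xy adm]].
    by split=> //; rewrite mE in hP; apply: cchain_admissible hP.
  have [w hP] := cword_exists Xy.
  by exists w; split=> //; rewrite mE; apply: cadmissible_chain adm.
apply: card_is_bigU => [w|w w' y [_ hP] [_ hP']]; last first.
  exact: cword_uniq (weaken _ _ hP) (weaken _ _ hP').
have := card_cword_class q w a0 m0.
rewrite [X in rho (_ - X)](_ : _ = (a * cox wt)%:Z + m%:Z * (cdescents w)%:Z).
  by rewrite opprD addrA.
rewrite /cox /cdescents -!natz natrM !natr_sum !natz !mulr_sumr -big_split /=.
apply: eq_bigr => i _; rewrite natz; case: cdescent => /=; ring.
Qed.

Lemma card_cconfig (q : nat) : card_is (cconfig q) (q ^ n).
Proof.
pose f (v : {ffun 'I_n -> 'I_q}) i : int := v i.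
have -> : (q ^ n = #|{: {ffun 'I_n -> 'I_q}}|)%N by rewrite card_ffun !card_ord.
apply: (card_is_image (e := f)) => [v v' fv|y].
  apply/ffunP => i; apply: ord_inj.
  by have := congr1 (fun h => h i) fv; rewrite /f /= => -[].
split=> [hy|[v _ <-] i]; last by rewrite /f; case: (v i) => x hx /=; lia.
have bnd i : (`|y i| < q)%N by have := hy i; lia.
by exists [ffun i => Ordinal (bnd i)] => //; apply/funext => i; rewrite /f ffunE /=;
  have := hy i; lia.
Qed.

End CyclicWords.

Section CyclicPrimeField.
Variables (n0 p : nat).
Hypotheses (p_prime : prime p) (p_n : (n0.+2 < p)%N).
Notation F := 'F_p.
Notation N := n0.+2.

Definition cyclic_good (a b : int) (x : 'rV[F]_N) : Prop :=
  \sum_i x 0 i = 0 /\ forall k : int, 1 - a <= k <= b ->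
  forall i j : 'I_N, (i < j)%N -> x 0 i - x 0 j != k%:~R.

Lemma avoids_double (a b d : int) : avoids a b p (2 * d) <->
  forall k, 1 - a <= k <= b -> d%:~R != k%:~R :> F.
Proof.
have p0 : 0 < p%:Z by have := prime_gt0 p_prime; lia.
have E k : (2 * p%:Z %| 2 * d - 2 * k)%Z = (d%:~R == k%:~R :> F).
  by rewrite intr_Fp_eq // -mulrBr dvdz_mul2l.
split=> h k hk; first by rewrite -E; apply/negP/h.
by rewrite E; apply/negP/h.
Qed.

(** Only differences of coordinates matter, so the normalisations of zero sum and of zero first
    coordinate are interchangeable. Subtracting the mean requires [N] to be invertible, which
    [N < p] ensures. *)
Lemma card_cadmissible_Fp (a b : int) :
  card_is (fun y : 'I_n0.+1 -> int => cconfig p y /\ cadmissible a b p y)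
    #|[pred x : 'rV[F]_N | `[< cyclic_good a b x >]]|.
Proof.
have N0 : (N%:R : F) != 0 by rewrite -(dvdn_pcharf (pchar_Fp p_prime)) gtnNdvd.
have ltF (v : F) : (v < p)%N by rewrite -[ltnRHS](Fp_cast p_prime) ltn_ord.
pose f (x : 'rV[F]_N) (j : 'I_n0.+1) : int := (((x 0 (lift ord0 j) - x 0 ord0)%R : F) : nat)%:Z.
pose u (y : 'I_n0.+1 -> int) (i : 'I_N) : F :=
  if unlift ord0 i is Some j then (y j)%:~R else 0.
pose g y : 'rV[F]_N := \row_i (u y i - (\sum_j u y j) / N%:R).
have u0 y : u y ord0 = 0 by rewrite /u unlift_none.
have uS y j : u y (lift ord0 j) = (y j)%:~R by rewrite /u liftK.
have fE x j : (f x j)%:~R = x 0 (lift ord0 j) - x 0 ord0 :> F.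
  by rewrite /f -[LHS]/((((x 0 (lift ord0 j) - x 0 ord0)%R : F) : nat)%:R) natr_Zp.
have good y (x : 'rV[F]_N) : (forall i j, u y i - u y j = x 0 i - x 0 j) -> \sum_i x 0 i = 0 ->
    cadmissible a b p y <-> cyclic_good a b x.
  move=> ux x0.
  have aS (i j : 'I_n0.+1) : (i < j)%N -> avoids a b p (2 * (y i - y j)) <->
      forall k, 1 - a <= k <= b -> x 0 (lift ord0 i) - x 0 (lift ord0 j) != k%:~R.
    by move=> ij; rewrite avoids_double rmorphB /= -!uS ux.
  have a0 j : avoids a b p (2 * - y j) <->
      forall k, 1 - a <= k <= b -> x 0 ord0 - x 0 (lift ord0 j) != k%:~R.
    by rewrite avoids_double rmorphN /= -uS -ux u0 sub0r.
  have al (i j : 'I_n0.+1) : (i < j)%N -> allowed a b p (cpos y i) (cpos y j) <->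
    avoids a b p (2 * (y i - y j)).
    by move=> ij; rewrite /allowed /= mulrBr; case: ifP => //; lia.
  have al' (i j : 'I_n0.+1) : (i < j)%N -> allowed a b p (cpos y j) (cpos y i) <->
    avoids a b p (2 * (y i - y j)).
    by move=> ij; rewrite /allowed /= mulrBr; case: ifP => //; lia.
  have alO i : allowed a b p cO (cpos y i) <-> avoids a b p (2 * - y i).
    by rewrite /allowed /= mulrN sub0r; case: ifP => //; lia.
  split=> [[pairs zero]|[_ hx]].
    split=> // k hk i j.
    case: (unliftP ord0 i) => [i' ->|->]; case: (unliftP ord0 j) => [j' ->|->] // ij.
      have ij' : (i' < j')%N by [].
      have ne : i' != j' by rewrite -val_eqE /= ltn_eqF.
      by move/(al _ _ ij')/(aS _ _ ij'): (pairs _ _ ne); apply.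
    by move/alO/a0: (zero j'); apply.
  split=> [i j ne|i]; last by apply/alO/a0 => k /hx; apply.
  case: (ltngtP i j) => [ij|ij|/val_inj e']; last by rewrite e' eqxx in ne.
    by apply/(al _ _ ij)/(aS _ _ ij) => k /hx; apply.
  by apply/(al' _ _ ij)/(aS _ _ ij) => k /hx; apply.
have uf x i : u (f x) i = x 0 i - x 0 ord0.
  by case: (unliftP ord0 i) => [j ->|->]; [rewrite uS fE | rewrite u0 subrr].
have sg y : \sum_i g y 0 i = 0.
  under eq_bigr do rewrite mxE.
  by rewrite sumrB sumr_const card_ord -[X in _ - X]mulr_natr divfK // subrr.
apply: (card_is_bij (f := f) (g := g)) (card_is_fin _) => [x|y [Py adm]].
  rewrite inE => /asboolP hx; have [sx _] := hx; split.
    split; last by apply/(good _ x) => // i j; rewrite !uf; ring.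
    by move=> j; apply/andP; split=> //; exact: ltF.
  apply/rowP => i; rewrite mxE uf.
  under eq_bigr do rewrite uf.
  rewrite sumrB sx sub0r sumr_const card_ord -[x 0 ord0 *+ N]mulr_natr mulNr mulfK //.
  by rewrite opprK subrK.
split; first by rewrite inE; apply/asboolP/(good y) => // i j; rewrite !mxE; ring.
apply/funext => j; have := fE (g y) j; rewrite !mxE u0 uS.
have -> : (y j)%:~R - (\sum_j u y j) / N%:R - (0 - (\sum_j u y j) / N%:R) = (y j)%:~R by ring.
move/eqP; rewrite intr_Fp_eq // => /dvdzP[q hq].
have : 0 <= f (g y) j < p%:Z.
  by apply/andP; split=> //; exact: ltF.
have := Py j; move: (f _ _) hq => z hq hy hz.
have h1 : q < 1 by nia.
have h2 : -1 < q by nia.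
have q0 : q = 0 by lia.
by move: hq; rewrite q0; lia.
Qed.

End CyclicPrimeField.

(** * The counting formula *)

(** The range of levels is empty, so every configuration is admissible and the word sum counts them
    all. *)
Lemma avoids00 (q x : int) : avoids 0 0 q x.
Proof. by move=> k hk; lia. Qed.

Section SignedSum.
Variables (sh lg : bool) (n1 : nat).
Hypotheses (n1_gt0 : (0 < n1)%N) (n1_gt1 : ~~ sh -> ~~ lg -> (1 < n1)%N).
Notation wt := (fun i : 'I_n1.+2 => weight sh lg n1 i).

Theorem signed_count_sum (a b p : nat) : (a <= b)%N -> prime p -> odd p ->
  (a * cox wt + (b + 1 - a) * cox wt + (b + 1 - a) <= p)%N ->
  ((b + 1 - a) ^ n1.+1 *
    #|[pred x : 'rV['F_p]_n1.+1 | `[< signed_good sh lg a b x >]]| =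
   count_sum wt (b + 1 - a) a p)%N.
Proof.
move=> ab p_prime p_odd lep.
apply: (@count_from_gaps _ _ (fun i => weight_gt0 sh lg n1 i) (normal_word sh lg n1)
  (fun w => descents sh lg (val w)) (if sh then 1 else 2)%N) => //.
- by lia.
- by case: (sh).
(* The modulus [j] is an arbitrary positive integer here; a prime is required only for the
   comparison with ['F_p]. *)
- move=> j j0.
  have h := signed_count n1_gt0 n1_gt1 j0 (leqnn 0).
  have h' : card_is (fun y : 'I_n1.+1 -> int => configuration sh j y /\ True)
      ((if sh then 1 else 2) * j ^ n1.+1)%N.
    apply: card_configuration_of => // e _.
    by apply: card_is_ext (card_parity_config n1 j0 e) => y; split=> [|[]].
  rewrite (card_is_uniq h' (card_is_ext _ h)); last first.
    move=> y; split=> -[Xy _]; split=> //.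
    by split=> *; first split; exact: avoids00.
  apply: eq_bigr => w _; congr rho; rewrite mul0n subr0.
  by rewrite mul1r.
have h := signed_count n1_gt0 n1_gt1 (prime_gt0 p_prime) ab.
apply: card_is_uniq h; apply: card_configuration_of => [|e he]; first exact: prime_gt0.
by apply: card_admissible_Fp => // sh1; move: he; rewrite sh1; case: (e).
Qed.

Lemma weight12 i : weight sh lg n1 i = 1%N \/ weight sh lg n1 i = 2%N.
Proof. by rewrite /weight; do ?case: ifP => _; auto. Qed.

Lemma nshort_weight : nshort wt = (if sh then (if lg then 1 else 2) else (if lg then 2 else 4))%N.
Proof.
(* A fork contributes its two nodes, an end governed by long roots one node, and a lower end
   governed by short roots none. *)
pose s : seq 'I_n1.+2 := [seq inord i | i <- if sh then (if lg then [:: n1.+1] else [:: n1; n1.+1])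
  else (if lg then [:: 0; n1.+1] else [:: 0; 1; n1; n1.+1])%N].
have inE' r (i : 'I_n1.+2) : (r < n1.+2)%N -> (i == inord r) = (i == r :> nat).
  by move=> rn; rewrite -val_eqE /= inordK.
have us : uniq s.
  rewrite /s map_inj_in_uniq; first by move: n1_gt1; case: (sh); case: (lg) => /=; rewrite ?inE;
    lia.
  move=> x y hx hy /(congr1 val) /=; rewrite !inordK //.
    by move: hy; case: (sh); case: (lg); rewrite ?inE; lia.
  by move: hx; case: (sh); case: (lg); rewrite ?inE; lia.
have -> : nshort wt = #|s|.
  apply: eq_card => i; rewrite !inE /s /weight; have lti := ltn_ord i.
  move: n1_gt1; case: (sh); case: (lg) => /= hn; rewrite ?inE ?inE' //; try lia.
  - by case: ifP => [|_]; [|case: ifP]; lia.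
  - by case: ifP => [|_]; [|case: ifP => [|_]; [|case: ifP]]; lia.
  - by case: ifP => [|_]; [|case: ifP]; lia.
  by case: ifP => [|_]; [|case: ifP => [|_]; [|case: ifP]]; lia.
rewrite (card_uniqP us) /s size_map; by case: (sh); case: (lg).
Qed.

End SignedSum.

(** Marks equal to 2 do not affect parity. This yields the evenness that [count_sum_operator]
    demands when two or four marks are 1. *)
Lemma odd_cox l (c : 'I_l.+1 -> nat) :
  (forall i, c i = 1%N \/ c i = 2%N) -> odd (cox c) = odd (nshort c).
Proof.
move=> c12; have -> : cox c = (nshort c + (\sum_(i | c i != 1%N) 1).*2)%N.
  rewrite /cox /nshort (bigID (fun i => c i == 1%N)) /= -sum1_card; congr (_ + _)%N.
    by apply: eq_bigr => i /eqP.
  rewrite -muln2 big_distrl /=; apply: eq_bigr => i; by case: (c12 i) => ->.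
by rewrite oddD odd_double addbF.
Qed.

Theorem cyclic_count_sum n0 (a b p : nat) : (a <= b)%N -> prime p -> (n0.+2 < p)%N ->
  (a * cox (fun _ : 'I_n0.+2 => 1) +
    (b + 1 - a) * cox (fun _ : 'I_n0.+2 => 1) + (b + 1 - a) <= p)%N ->
  ((b + 1 - a) ^ n0.+1 *
    #|[pred x : 'rV['F_p]_n0.+2 | `[< cyclic_good a b x >]]| =
   count_sum (fun _ : 'I_n0.+2 => 1) (b + 1 - a) a p)%N.
Proof.
move=> ab p_prime p_n lep.
apply: (@count_from_gaps n0.+1 (fun _ => 1%N) (fun _ => isT) _ (@cdescents n0) 1%N) => //.
- by lia.
- move=> j j0; rewrite mul1n.
  have h := cyclic_count n0 j (leqnn 0).
  rewrite (card_is_uniq (card_cconfig n0 j) (card_is_ext _ h)); last first.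
    move=> y; split=> [[]//|Xy]; split=> //.
    by split=> *; exact: avoids00.
  apply: eq_bigr => w _; congr rho; rewrite mul0n subr0.
  by rewrite mul1r.
rewrite mul1n; have h := cyclic_count n0 p ab.
by apply: card_is_uniq h; apply: card_cadmissible_Fp.
Qed.

(** * Characteristic polynomials of arrangements *)

From mathcomp Require Import all_classical all_reals.
Local Open Scope ring_scope.
Local Open Scope classical_set_scope.

Lemma sum_pred1_uniq (T : eqType) (V : zmodType) (s : seq T) (x : T) (F : T -> V) :
  uniq s -> x \in s -> \sum_(y <- s | y == x) F y = F x.
Proof. by move=> us xs; rewrite -big_filter filter_pred1_uniq ?big_seq1. Qed.

Section Whitney.
Variables (R : realType) (n N : nat) (V : set 'rV[R]_n) (A : seq (set 'rV[R]_n)).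
Variable (H : 'I_N -> set 'rV[R]_n).
Hypothesis H_A : forall X, X \in A <-> exists i, X = H i.
Hypothesis V_neq0 : V !=set0.
Hypothesis V_H : forall i, ~ V `<=` H i.
Hypothesis H_V : forall i, H i `<=` V.

(** The family [H] may name a hyperplane twice, as [x_i = 1] and [2 x_i = 2] do in type BC; the
    signed sums over subsets still give the Möbius function. *)
Definition flatI (J : {set 'I_N}) : set 'rV[R]_n :=
  V `&` [set x | forall i, i \in J -> H i x].

Notation L := (intersection_poset V A).

Lemma flatI_sub (J : {set 'I_N}) i : i \in J -> flatI J `<=` H i.
Proof. by move=> iJ x [_ /(_ i iJ)]. Qed.

Lemma mem_poset S : S \in L <-> S !=set0 /\ exists J, S = flatI J.
Proof.
rewrite mem_undup; split.
  case/mapP => J; rewrite mem_filter => /andP[J0 _] ->; split; first exact/set0P.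
  exists [set i : 'I_N | `[< exists2 j : 'I_(size A), j \in J & nth set0 A j = H i >]]%SET.
  rewrite /flat /flatI; congr (V `&` _); apply/seteqP; split=> x /= hx.
    by move=> i; rewrite inE => /asboolP[j jJ <-]; apply: hx.
  move=> j jJ; have /H_A[i hi] : nth set0 A j \in A by rewrite mem_nth.
  by rewrite hi; apply: hx; rewrite inE; apply/asboolP; exists j.
case=> S0 [J SJ]; apply/mapP.
pose J' : {set 'I_(size A)} :=
  [set j : 'I_(size A) | `[< exists2 i, i \in J & nth set0 A j = H i >]]%SET.
have SE : S = flat V J'.
  rewrite SJ /flat /flatI; congr (V `&` _); apply/seteqP; split=> x /= hx.
    by move=> j; rewrite inE => /asboolP[i iJ ->]; apply: hx.
  move=> i iJ; have HiA : H i \in A by apply/H_A; exists i.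
  have lt_i : (index (H i) A < size A)%N by rewrite index_mem.
  rewrite -(nth_index set0 HiA); apply: (hx (Ordinal lt_i)).
  by rewrite inE; apply/asboolP; exists i; rewrite ?nth_index.
exists J' => //; rewrite mem_filter -SE; apply/andP; split; last first.
  by rewrite mem_enum; exact: mem_set.
exact/set0P.
Qed.

Lemma poset_V : V \in L.
Proof.
apply/mem_poset; split=> //; exists (finset.set0); rewrite /flatI.
apply/seteqP; split=> [x Vx|x []//]; split=> // i.
by rewrite inE.
Qed.

Definition whitney (S : set 'rV[R]_n) : int := \sum_(J | flatI J == S) (-1) ^+ #|J|.

(** Toggling a fixed element of [K] pairs subsets of opposite sign. *)
Lemma sum_signed_subsets (T : finType) (K : {set T}) : K != finset.set0 ->
  \sum_(J : {set T} | J \subset K) (-1) ^+ #|J| = 0 :> int.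
Proof.
case/set0Pn => i iK.
rewrite (bigID (fun J : {set T} => i \in J)) /=.
rewrite (reindex_onto (fun J => i |: J) (fun J => J :\ i)) /=; last first.
  by move=> J /andP[_ iJ]; rewrite finset.setD1K.
rewrite (eq_bigl (fun J : {set T} => (J \subset K) && (i \notin J))); last first.
  move=> J; rewrite setU11 andbT finset.subUset finset.sub1set iK /=; congr (_ && _).
  apply/eqP/idP => [<-|iJ]; first by rewrite !inE eqxx.
  by rewrite finset.setU1K.
rewrite -big_split big1 // => J /andP[_ iJ].
by rewrite /= cardsU1 iJ exprS mulN1r addNr.
Qed.

(** The subsets whose flat contains [S] are the subsets of the set [K] of indices of hyperplanes
    containing [S], which is nonempty for [S != V]. This is the recursion that defines the Möbius
    function. *)
Lemma sum_whitney_above S : S \in L -> S != V -> \sum_(T <- L | `[< S `<=` T >]) whitney T = 0.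
Proof.
move=> SL SV; have [[x Sx] [J0 SJ0]] := (mem_poset S).1 SL.
rewrite /whitney (exchange_big_dep xpredT) //=.
pose K : {set 'I_N} := [set i : 'I_N | `[< S `<=` H i >]]%SET.
have KP J : (S `<=` flatI J) <-> J \subset K.
  split=> [SJ|JK y Sy].
    by apply/fintype.subsetP => i iJ; rewrite inE; apply/asboolP => y /SJ[_ /(_ i iJ)].
  split=> [|i iJ]; first by move: Sy; rewrite SJ0 => -[].
  by have := fintype.subsetP JK i iJ; rewrite inE => /asboolP; apply.
rewrite -[RHS](sum_signed_subsets (K := K)); last first.
  have [J00|/set0Pn[i iJ0]] := eqVneq J0 finset.set0.
    case/eqP: SV; rewrite SJ0 J00; apply/seteqP; split=> [y []//|y Vy]; split=> // i.
    by rewrite inE.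
  apply/set0Pn; exists i; rewrite inE; apply/asboolP; rewrite SJ0; exact: flatI_sub.
rewrite [RHS]big_mkcond; apply: eq_bigr => J _.
case: (boolP (J \subset K)) => [/KP SJ|nJ].
  have JL : flatI J \in L by apply/mem_poset; split; [exists x; apply: SJ | exists J].
  rewrite (eq_bigl (pred1 (flatI J))) => [|T]; last first.
    rewrite /= eq_sym; case: eqP => [->|//]; rewrite ?andbF // andbT.
    exact/asboolP.
  by rewrite sum_pred1_uniq ?undup_uniq.
rewrite big_pred0 // => T; apply/negP => /andP[/asboolP ST /eqP JT].
by case/negP: nJ; apply/KP; rewrite JT.
Qed.

Lemma whitney_V : whitney V = 1.
Proof.
rewrite /whitney (big_pred1 finset.set0) ?cards0 // => J /=.
apply/eqP/eqP => [JV|->]; last first.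
  apply/seteqP; split=> [x []//|x Vx]; split=> // i.
  by rewrite inE.
apply/eqP; apply: contraT => /set0Pn[i iJ].
by case: (V_H (i := i)); rewrite -{1}JV; apply: flatI_sub.
Qed.

Lemma poset_sub_V S : S \in L -> S `<=` V.
Proof. by move=> /mem_poset[_ [J ->]] x []. Qed.

(** The fuel is measured by the number of flats strictly above [S], which drops on passing to such a
    flat [T] because [T] itself is lost. *)
Lemma mobius_fuel_whitney k S : S \in L ->
  (size [seq T <- L | `[< S `<=` T >] && (T != S)] <= k)%N ->
  mobius_fuel L V k S = whitney S.
Proof.
elim: k S => [|k IHk] S SL.
  rewrite leqn0 size_eq0 => /eqP e /=; case: eqP => [->|/eqP SV]; first by rewrite whitney_V.
  have : V \in [seq T <- L | `[< S `<=` T >] && (T != S)].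
    by rewrite mem_filter poset_V eq_sym SV !andbT; apply/asboolP; exact: poset_sub_V.
  by rewrite e.
move=> le_k /=; case: eqP => [->|/eqP SV]; first by rewrite whitney_V.
rewrite big_seq_cond (eq_bigr whitney); last first.
  move=> T /andP[TL /andP[/asboolP ST TS]]; apply: IHk => //.
  rewrite -ltnS; apply: leq_trans le_k; rewrite !size_filter.
  pose a := fun U : set 'rV[R]_n => `[< S `<=` U >] && (U != S).
  pose b := fun U : set 'rV[R]_n => `[< T `<=` U >] && (U != T).
  have ab U : b U -> a U.
    move=> /andP[/asboolP TU UT]; apply/andP; split.
      by apply/asboolP; apply: subset_trans ST TU.
    by apply: contra TS => /eqP US; apply/eqP/seteqP; split=> //; rewrite -US.
  rewrite -/a -/b.
  have -> : count a L = (count b L + count (fun U => a U && ~~ b U) L)%N.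
    rewrite -(count_predUI b) [X in (_ + X)%N](eq_count (a2 := pred0)) ?count_pred0 ?addn0.
      by apply: eq_count => U /=; case: (boolP (b U)) => [/ab->|]; rewrite ?andbT.
    by move=> U /=; case: (b U); rewrite ?andbF.
  rewrite -addn1 leq_add2l -has_count; apply/hasP; exists T => //.
  by rewrite /a /b eqxx TS !andbF !andbT; apply/asboolP.
rewrite -big_seq_cond.
have := sum_whitney_above SL SV.
rewrite (bigID (fun T => T == S)) /= (eq_bigl (fun T => T == S)) => [|T]; last first.
  by rewrite /=; case: eqP => [->|]; rewrite ?andbF // andbT; apply/asboolP.
by rewrite sum_pred1_uniq ?undup_uniq // => /eqP; rewrite addr_eq0 => /eqP.
Qed.

Lemma mobiusE S : S \in L -> mobius L V S = whitney S.
Proof. by move=> SL; apply: mobius_fuel_whitney => //; rewrite size_filter count_size. Qed.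

Lemma arr_char_poly_mobius :
  arr_char_poly V A = \sum_(S <- L) whitney S *: 'X^(adim S).
Proof.
rewrite /arr_char_poly big_seq [RHS]big_seq; apply: eq_bigr => S SL.
by rewrite mobiusE.
Qed.

Lemma arr_char_poly_whitney :
  arr_char_poly V A = \sum_(J | flatI J != set0) (-1) ^+ #|J| *: 'X^(adim (flatI J)).
Proof.
rewrite arr_char_poly_mobius /whitney.
under eq_bigr do rewrite scaler_suml.
rewrite (exchange_big_dep xpredT) //= [RHS]big_mkcond; apply: eq_bigr => J _.
rewrite (eq_bigl (pred1 (flatI J))) => [|T]; last by rewrite /= eq_sym.
case: (boolP (flatI J != set0)) => [J0|/negPn/eqP J0].
  by rewrite sum_pred1_uniq ?undup_uniq //; apply/mem_poset; split; [apply/set0P | exists J].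
rewrite big_seq_cond big_pred0 // => T; apply/negP => /andP[/mem_poset[/set0P T0 _] /eqP TJ].
by move: T0; rewrite TJ J0 eqxx.
Qed.

End Whitney.

Local Close Scope classical_set_scope.

(** * Integer matrices over different fields *)

Definition intmx (F : fieldType) m n (M : 'M[int]_(m, n)) : 'M[F]_(m, n) :=
  map_mx (intr : int -> F) M.

Lemma intmx_unit (F : fieldType) n (M : 'M[int]_n) : M \in unitmx -> intmx F M \in unitmx.
Proof.
by rewrite !unitmxE /intmx det_map_mx => /(rmorph_unit (intr : int -> F)).
Qed.

Lemma mxrank_unitmx (F : fieldType) m n (L : 'M[F]_m) (D : 'M_(m, n)) (K : 'M_n) :
  L \in unitmx -> K \in unitmx -> \rank (L *m D *m K) = \rank D.
Proof.
move=> Lu Ku; rewrite mxrankMfree ?row_free_unit //.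
by rewrite (eqmxMfull _ _) // row_full_unit.
Qed.

(** In the Smith normal form the unimodular factors stay invertible over every field, so the rank
    counts the elementary divisors that are nonzero in [F]; [B] bounds their absolute values. *)
Lemma intmx_rank m n (M : 'M[int]_(m, n)) : exists B r : nat,
  forall F : fieldType, (forall d : nat, (0 < d <= B)%N -> d%:R != 0 :> F) ->
  \rank (intmx F M) = r.
Proof.
have [L Lu [K Ku [d sd ->]]] := int_Smith_normal_form M.
pose r := find (pred1 0) d.
pose r' := minn m (minn n r).
exists (\max_(x <- d) `|x|%N), r' => F hF.
have nz i : (d`_i != 0) = (i < r)%N.
  case: ltnP => [/(before_find 0) /= -> //|]; rewrite leq_eqVlt => /predU1P[<-|].
    have [hr|hr] := boolP (has (pred1 0) d); first by apply/negbTE; rewrite negbK;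
      exact: (nth_find 0 hr).
    by rewrite nth_default ?eqxx // /r hasNfind.
  move=> lt_ri; apply/negbTE; rewrite negbK.
  have [lt_i|?] := ltnP i (size d); last by rewrite nth_default.
  have hr : has (pred1 0) d by rewrite has_find (ltn_trans lt_ri).
  have /= /eqP d0 := nth_find 0 hr.
  have := sorted_ltn_nth (@dvdz_trans) 0 sd _ _ _ _ lt_ri.
  by rewrite !inE d0 (ltn_trans lt_ri lt_i) lt_i => /(_ isT isT); rewrite dvd0z.
rewrite /intmx !map_mxM -!/(intmx F _) mxrank_unitmx ?intmx_unit //.
(* Zero divisors are replaced by 1 to make the diagonal factor invertible; [pid_mx r'] alone carries
   the rank. *)
pose e : 'rV[F]_m := \row_i (if d`_i == 0 then 1 else (d`_i)%:~R).
have -> : intmx F (\matrix_(i, j) (d`_i *+ (i == j :> nat))) = diag_mx e *m pid_mx r' :> 'M_(m, n).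
  apply/matrixP => i j; rewrite mul_diag_mx !mxE.
  case: (boolP (i == j :> nat)) => [ij|_]; last by rewrite mulr0n mulr0.
  have lt_i : (i < n)%N by rewrite (eqP ij) ltn_ord.
  rewrite ?ij mulr1n /r' !leq_min ltn_ord lt_i /= -nz.
  by case: eqP => [->|_]; rewrite ?mulr0 ?mulr1.
have eu : diag_mx e \in unitmx.
  rewrite unitmxE det_diag unitfE; apply/prodf_neq0 => i _.
  rewrite mxE; case: (d`_i =P 0) => [_|/eqP d0]; first by rewrite oner_eq0.
  rewrite {1}(intEsign d`_i) rmorphM rmorph_sign mulf_neq0 ?signr_eq0 //=.
  apply: hF; rewrite lt0n absz_eq0 d0 /=.
  have lt_i : (i < size d)%N by case: ltnP d0 => // h; rewrite nth_default ?eqxx.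
  exact: (@leq_bigmax_seq _ d xpredT (fun x : int => `|x|%N) _ (mem_nth 0 lt_i)).
by rewrite (eqmxMfull _ _) ?row_full_unit // rank_pid_mx // /r'; lia.
Qed.

Lemma card_affine_sols (F : finFieldType) m n (M : 'M[F]_(m, n)) (v : 'rV[F]_n) :
  #|[set x : 'rV[F]_m | x *m M == v]| = if (v <= M)%MS then (#|F| ^ (m - \rank M))%N else 0%N.
Proof.
case: ifP => [/submxP[x0 ->]|/negP nv]; last first.
  apply: eq_card0 => x; rewrite !inE; apply/eqP => xv.
  by apply: nv; apply/submxP; exists x.
rewrite -mxrank_ker -card_rowg -(card_imset (rowg (kermx M)) (addrI x0)).
apply: eq_card => x; rewrite inE; apply/eqP/imsetP => [xM|[y]].
  exists (x - x0); last by rewrite addrC subrK.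
  by rewrite inE; apply/sub_kermxP; rewrite mulmxBl xM subrr.
by rewrite inE => /sub_kermxP yM ->; rewrite mulmxDl yM addr0.
Qed.

Lemma submx_rank_col (F : fieldType) m n (M : 'M[F]_(m, n)) (v : 'rV[F]_n) :
  (v <= M)%MS = (\rank (col_mx v M) == \rank M).
Proof.
rewrite -addsmxE; apply/idP/eqP => [vM|e]; first by rewrite (addsmx_idPr vM).
by have := (mxrank_leqif_sup (addsmxSr v M)).2; rewrite e eqxx addsmx_sub => /esym/andP[].
Qed.

(** Solvability is itself an equality of ranks, of [M] and of [M] extended by [v], so it is
    preserved modulo large primes together with the dimension. *)
Lemma count_sols_mod_p (R : numFieldType) m n (M : 'M[int]_(m, n)) (v : 'rV[int]_n) :
  exists B : nat, forall p : nat, prime p -> (B < p)%N ->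
  #|[set x : 'rV['F_p]_m | x *m intmx _ M == intmx _ v]| =
    if (intmx R v <= intmx R M)%MS then (p ^ (m - \rank (intmx R M)))%N else 0%N.
Proof.
have [B1 [r1 h1]] := intmx_rank M; have [B2 [r2 h2]] := intmx_rank (col_mx v M).
have hR B d : (0 < d <= B)%N -> d%:R != 0 :> R.
  by move=> /andP[d0 _]; rewrite pnatr_eq0 -lt0n.
exists (maxn B1 B2) => p pp; rewrite gtn_max => /andP[lt1 lt2].
have hp B d : (B < p)%N -> (0 < d <= B)%N -> d%:R != 0 :> 'F_p.
  move=> ltB /andP[d0 dB]; rewrite -(dvdn_pcharf (pchar_Fp pp)) gtnNdvd //.
  exact: leq_ltn_trans ltB.
rewrite card_affine_sols card_Fp //.
have rk (F : fieldType) : \rank (col_mx (intmx F v) (intmx F M)) = \rank (intmx F (col_mx v M)).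
  by rewrite /intmx map_col_mx.
rewrite !submx_rank_col !rk (h1 R) ?(h2 R) ?(h1 'F_p) ?(h2 'F_p) //; by [apply: hR | move=> d;
  apply: hp].
Qed.

Local Open Scope classical_set_scope.

(** * Dimensions of affine solution sets *)

Section AffineDimension.
Variable R : realType.

Definition affset n m (M : 'M[R]_(n, m)) (v : 'rV[R]_m) : set 'rV[R]_n :=
  [set x | x *m M = v].

Lemma free_row_free n (vs : seq 'rV[R]_n) :
  free vs = row_free (\matrix_(i < size vs) vs`_i).
Proof.
set A := \matrix_i _; rewrite -kermx_eq0.
have sumE (u : 'rV_(size vs)) : u *m A = \sum_i u 0 i *: vs`_i.
  by rewrite mulmx_sum_row; apply: eq_bigr => i _; rewrite rowK.
apply/(@freeP _ _ _ (in_tuple vs))/eqP => [h|h].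
  apply/row_matrixP => j; rewrite row0; apply/rowP => i; rewrite [RHS]mxE.
  apply: (h (fun i => row j (kermx A) 0 i)); rewrite -sumE.
  by rewrite -row_mul mulmx_ker row0.
move=> k hk i.
have : (\row_i k i <= kermx A)%MS.
  by apply/sub_kermxP; rewrite sumE -[RHS]hk; apply: eq_bigr => j _; rewrite mxE.
by rewrite h submx0 => /eqP/rowP/(_ i); rewrite !mxE.
Qed.

(** The directions that stay in the set form the kernel of [M], whatever the base point, and a basis
    of this kernel attains the maximum in [adim]. *)
Lemma adim_affset n m (M : 'M[R]_(n, m)) v : affset M v !=set0 ->
  adim (affset M v) = (n - \rank M)%N.
Proof.
move=> [x0 x0v]; rewrite -mxrank_ker.
have shiftE x u : affset M v x -> affset M v (x + u) <-> (u <= kermx M)%MS.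
  rewrite /affset /= mulmxDl => ->; split=> [/eqP|/sub_kermxP->]; last by rewrite addr0.
  by rewrite -subr_eq0 addrC addKr => /eqP/sub_kermxP.
have lt_r : (\rank (kermx M) < n.+1)%N by rewrite ltnS rank_leq_col.
apply/eqP; rewrite eqn_leq /adim; apply/andP; split.
  apply/bigmax_leqP => d /asboolP[x [xv [vs [<- fvs vsv]]]].
  move: fvs; rewrite free_row_free => /eqP <-; apply: mxrankS.
  apply/row_subP => i; rewrite rowK; apply/(shiftE x) => //.
  by apply: vsv; apply: mem_nth.
apply: (@leq_bigmax_cond _ _ (fun d : 'I_n.+1 => d : nat) (Ordinal lt_r)).
apply/asboolP; exists x0; split=> //.
pose B := row_base (kermx M).
exists [seq row i B | i <- enum 'I_(\rank (kermx M))].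
have sz : size [seq row i B | i <- enum 'I_(\rank (kermx M))] = \rank (kermx M).
  by rewrite size_map size_enum_ord.
split=> //.
- apply/(@freeP _ _ _ (Tuple (introT eqP sz))) => k hk i.
  have : (\row_i k i) *m B = 0.
    rewrite mulmx_sum_row -[RHS]hk; apply: eq_bigr => j _; rewrite mxE /=.
    by rewrite (nth_map j) ?size_enum_ord // nth_ord_enum.
  have /row_free_inj := row_base_free (kermx M); rewrite -/B => inj /eqP.
  by rewrite -[X in _ == X](mul0mx _ B) => /eqP/inj/rowP/(_ i); rewrite !mxE.
- move=> u /mapP[i _ ->]; apply/shiftE => //.
  by apply: submx_trans (row_sub _ _) _; rewrite eq_row_base.
Qed.

Lemma adim_affset_lt n m m' (M : 'M[R]_(n, m)) v (M' : 'M[R]_(n, m')) v' :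
  affset M v !=set0 -> affset M v `<=` affset M' v' -> affset M v <> affset M' v' ->
  (adim (affset M v) < adim (affset M' v'))%N.
Proof.
move=> X0 sXY XY; have [x0 x0v] := X0; have x0v' := sXY _ x0v.
rewrite !adim_affset //; last by exists x0.
rewrite -!mxrank_ker.
have sK : (kermx M <= kermx M')%MS.
  apply/row_subP => i; apply/sub_kermxP.
  have /sXY : affset M v (x0 + row i (kermx M)).
    by rewrite /affset /= mulmxDl -row_mul mulmx_ker row0 addr0.
  rewrite /affset /= mulmxDl x0v' => /eqP; rewrite -subr_eq0 addrC addKr.
  by move/eqP.
have := mxrank_leqif_sup sK => -[le_r eq_r]; rewrite ltn_neqAle le_r andbT eq_r.
apply/negP => sK'; apply: XY; apply/seteqP; split=> // y yv'.
have : (y - x0 <= kermx M')%MS.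
  by apply/sub_kermxP; rewrite mulmxBl x0v' yv' subrr.
move/submx_trans/(_ sK')/sub_kermxP; rewrite mulmxBl x0v => /eqP.
by rewrite subr_eq0 => /eqP.
Qed.

Lemma adim_hyperplane n m (M : 'M[R]_(n, m)) v (c : 'cV[R]_n) k :
  affset (row_mx M c) (row_mx v k) !=set0 ->
  (adim (affset M v) <= (adim (affset (row_mx M c) (row_mx v k))).+1)%N.
Proof.
move=> Z0; rewrite !adim_affset //; last first.
  by case: Z0 => x; rewrite /affset /= mul_mx_row => /eq_row_mx[]; exists x.
have : (\rank (row_mx M c) <= \rank M + 1)%N.
  rewrite -mxrank_tr tr_row_mx -addsmxE -[\rank M]mxrank_tr.
  apply: leq_trans (mxrank_adds_leqif _ _) _.
  by rewrite leq_add2l mxrank_tr rank_leq_col.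
by have := rank_leq_row (row_mx M c); lia.
Qed.

End AffineDimension.

Definition intdot (F : pzRingType) n (u : 'I_n -> int) (x : 'rV[F]_n) : F :=
  \sum_j x 0 j * (u j)%:~R.

(** * Arrangements given by integral equations *)

Section IntegralArrangement.
Variables (R : realType) (n N : nat) (om : 'I_n -> int) (al : 'I_N -> 'I_n -> int)
  (k : 'I_N -> int) (A : seq (set 'rV[R]_n)).

Definition ambI : set 'rV[R]_n := [set x | intdot om x = 0].
Definition hypI i : set 'rV[R]_n := ambI `&` [set x | intdot (al i) x = (k i)%:~R].

Hypothesis A_uniq : uniq A.
Hypothesis H_A : forall X, X \in A <-> exists i, X = hypI i.
Hypothesis hyp_neq0 : forall i, hypI i !=set0.
Hypothesis amb_hyp : forall i, ~ ambI `<=` hypI i.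

(** Equations outside [J] become zero columns instead of being deleted, so the shape is the same for
    all [J]; the first column is the equation of the ambient space. *)
Definition sysmx (J : {set 'I_N}) : 'M[int]_(n, 1 + N) :=
  row_mx (\col_j om j) (\matrix_(j, i) if i \in J then al i j else 0).
Definition sysrhs (J : {set 'I_N}) : 'rV[int]_(1 + N) :=
  row_mx 0 (\row_i if i \in J then k i else 0).

Lemma sysP (F : fieldType) (J : {set 'I_N}) (x : 'rV[F]_n) :
  x *m intmx F (sysmx J) = intmx F (sysrhs J) <->
  intdot om x = 0 /\ forall i, i \in J -> intdot (al i) x = (k i)%:~R.
Proof.
rewrite /intmx /sysmx /sysrhs !map_row_mx mul_mx_row; split.
  case/eq_row_mx => e1 e2; split.
    have := congr1 (fun B : 'M_(1, 1) => B 0 0) e1; rewrite !mxE mulr0z => <-.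
    by apply: eq_bigr => j _; rewrite !mxE.
  move=> i iJ; have := congr1 (fun B : 'M_(1, N) => B 0 i) e2; rewrite !mxE iJ => <-.
  by apply: eq_bigr => j _; rewrite !mxE iJ.
case=> e1 e2; congr row_mx; apply/rowP => i; rewrite !mxE.
  by rewrite mulr0z -[RHS]e1; apply: eq_bigr => j _; rewrite !mxE.
case: ifP => iJ; last by rewrite mulr0z big1 // => j _; rewrite !mxE iJ mulr0.
by rewrite -e2 //; apply: eq_bigr => j _; rewrite !mxE iJ.
Qed.

Notation flat := (flatI ambI hypI).

Lemma flat_affset J : flat J = affset (intmx R (sysmx J)) (intmx R (sysrhs J)).
Proof.
apply/seteqP; split=> x.
  by case=> x0 hx; apply/sysP; split=> // i /hx[].
by move=> /sysP[x0 hx]; split=> // i /hx.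
Qed.

Lemma hypI_sub i : hypI i `<=` ambI. Proof. by move=> x []. Qed.

Lemma ambI_neq0 : ambI !=set0.
Proof. by exists 0; rewrite /ambI /= /intdot big1 // => j _; rewrite mxE mul0r. Qed.

Notation L := (intersection_poset ambI A).
Notation chi := (arr_char_poly ambI A).

Definition good_points (F : finFieldType) : {set 'rV[F]_n} :=
  finset.finset (fun x : 'rV[F]_n => (intdot om x == 0) &&
    [forall i, intdot (al i) x != (k i)%:~R]).

(** After exchanging the sums, a point of the ambient space contributes the signed count of the
    subsets of hyperplanes through it, which is 0 unless there are none. *)
Lemma card_good_points (F : finFieldType) : (#|good_points F|%:R =
  \sum_(J : {set 'I_N}) (-1) ^+ #|J| *
    #|finset.finset (fun x : 'rV[F]_n =>
      x *m intmx F (sysmx J) == intmx F (sysrhs J))|%:R :> int)%R.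
Proof.
under eq_bigr => J _ do rewrite -[#|finset.finset _|]sum1_card natr_sum mulr_sumr.
rewrite (exchange_big_dep (fun x : 'rV[F]_n => intdot om x == 0)) /=; last first.
  by move=> J x _; rewrite inE => /eqP/sysP[-> _].
rewrite -sum1_card natr_sum big_mkcond [RHS]big_mkcond; apply: eq_bigr => x _.
rewrite inE; case: ifP => [/andP[x0 /forallP hx]|].
  rewrite x0 (big_pred1 finset.set0) ?cards0 ?mulr1 // => J /=.
  rewrite inE; apply/eqP/eqP => [/sysP[_ hJ]|->].
    apply/eqP; apply: contraT => /set0Pn[i iJ].
    by move: (hx i); rewrite hJ ?eqxx.
  by apply/sysP; split; [exact/eqP | move=> i; rewrite inE].
case: ifP => //= x0 /negbT/forallPn[i0]; rewrite negbK => /eqP i0x.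
pose K : {set 'I_N} := finset.finset (fun i : 'I_N => intdot (al i) x == (k i)%:~R).
rewrite -[LHS](sum_signed_subsets (K := K)); last by apply/set0Pn; exists i0; rewrite inE i0x.
apply: eq_big => [J|J _]; last by rewrite mulr1.
rewrite inE; apply/fintype.subsetP/eqP => [JK|/sysP[_ hJ] i iJ].
  by apply/sysP; split; [apply/eqP | move=> i /JK; rewrite inE => /eqP].
by rewrite inE hJ.
Qed.

Theorem finite_field_method : exists B : nat, forall p : nat, prime p -> (B < p)%N ->
  chi.[p%:R] = #|good_points 'F_p|%:R.
Proof.
pose Q (J : {set 'I_N}) (B : nat) := forall p : nat, prime p -> (B < p)%N ->
  #|finset.finset (fun x : 'rV['F_p]_n => x *m intmx _ (sysmx J) == intmx _ (sysrhs J))| =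
    if (intmx R (sysrhs J) <= intmx R (sysmx J))%MS then (p ^ (n - \rank (intmx R (sysmx J))))%N
      else 0%N.
have hQ J : exists B, Q J B := count_sols_mod_p R (sysmx J) (sysrhs J).
have /choice[Bf hB] := hQ.
exists (\max_J Bf J) => p pp ltp.
rewrite card_good_points (arr_char_poly_whitney H_A ambI_neq0 amb_hyp) horner_sum.
rewrite big_mkcond; apply: eq_bigr => J _.
rewrite (hB J) ?(leq_ltn_trans _ ltp) ?leq_bigmax //.
have -> : (intmx R (sysrhs J) <= intmx R (sysmx J))%MS = (flat J != set0).
  rewrite flat_affset; apply/submxP/idP => [[x hx]|/set0P[x hx]].
    by apply/set0P; exists x; rewrite /affset /= hx.
  by exists x; rewrite hx.
case: ifP => J0; last by rewrite mulr0.
rewrite hornerZ hornerXn flat_affset adim_affset -?flat_affset; last exact/set0P.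
by rewrite natrX.
Qed.

Notation l := (adim ambI).

Lemma poset_affset S : S \in L -> exists J, S = affset (intmx R (sysmx J)) (intmx R (sysrhs J)).
Proof. by move=> /(mem_poset _ H_A)[_ [J ->]]; exists J; rewrite flat_affset. Qed.

Lemma poset_nonempty S : S \in L -> S !=set0.
Proof. by move=> /(mem_poset _ H_A)[]. Qed.

Lemma adim_lt S T : S \in L -> T \in L -> S `<=` T -> S != T -> (adim S < adim T)%N.
Proof.
move=> SL TL sST /eqP nST; have := poset_nonempty SL; move: sST nST.
have [J ->] := poset_affset SL; have [J' ->] := poset_affset TL => sST nST S0.
exact: adim_affset_lt.
Qed.

Lemma hypI_flat i : hypI i = flat (finset.set1 i).
Proof.
apply/seteqP; split=> x.
  by case=> x0 hx; split=> // j; rewrite inE => /eqP->.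
by case=> x0 /(_ i); rewrite inE eqxx => /(_ isT).
Qed.

Lemma hypI_poset i : hypI i \in L.
Proof. by apply/(mem_poset _ H_A); split=> //; exists (finset.set1 i); rewrite hypI_flat. Qed.

Lemma ambI_poset : ambI \in L.
Proof. exact: (poset_V H_A ambI_neq0). Qed.

Lemma adim_ltV S : S \in L -> S != ambI -> (adim S < l)%N.
Proof. by move=> SL; apply: adim_lt => //; [exact: ambI_poset | exact: (poset_sub_V H_A)]. Qed.

Lemma hypI_neqV i : hypI i != ambI.
Proof. by apply/eqP => e; apply: (amb_hyp (i := i)); rewrite e. Qed.

Lemma adim_hypI i : (adim (hypI i)).+1 = l.
Proof.
apply/eqP; rewrite eqn_leq adim_ltV ?hypI_poset ?hypI_neqV //=.
pose M : 'M[R]_(n, 1) := \col_j (om j)%:~R.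
pose c : 'cV[R]_n := \col_j (al i j)%:~R.
have colE (u : 'I_n -> int) (x : 'rV[R]_n) : x *m (\col_j (u j)%:~R) = (intdot u x)%:M.
  by rewrite [LHS]mx11_scalar; congr _%:M; rewrite !mxE; apply: eq_bigr => j _; rewrite mxE.
have VE : ambI = affset M 0.
  apply/seteqP; split=> x; rewrite /affset /= /M colE; first by move->; rewrite raddf0.
  by move/(congr1 (fun B : 'M_1 => B 0 0)); rewrite !mxE.
have HE : hypI i = affset (row_mx M c) (row_mx 0 ((k i)%:~R)%:M).
  apply/seteqP; split=> x; rewrite /affset /= mul_mx_row.
    by case=> x0 /= hx; congr row_mx; rewrite colE ?x0 ?hx ?raddf0.
  case/eq_row_mx => x0 hx; split; first by rewrite VE.
  by move: hx; rewrite colE => /(congr1 (fun B : 'M_1 => B 0 0)); rewrite !mxE.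
by rewrite VE HE; apply: adim_hyperplane; rewrite -HE.
Qed.

(** A flat other than the ambient space lies in some hyperplane of the family, and equal dimensions
    force equality. *)
Lemma poset_coatom S : S \in L -> (adim S == l.-1) && (S != ambI) = (S \in A).
Proof.
move=> SL; apply/andP/idP => [[/eqP Sl SV]|/H_A[i ->]]; last first.
  by rewrite -(adim_hypI i) eqxx hypI_neqV.
have [S0 [J SJ]] := (mem_poset _ H_A _).1 SL.
have /set0Pn[i iJ] : J != finset.set0.
  apply: contraNneq SV => J0; rewrite SJ J0; apply/eqP/seteqP; split=> [x []//|x Vx].
  by split=> // i; rewrite inE.
have sSi : S `<=` hypI i by rewrite SJ; apply: flatI_sub.
apply/H_A; exists i; apply/eqP; apply: contraT => nSi.
by have := adim_lt SL (hypI_poset i) sSi nSi; rewrite Sl -(adim_hypI i) ltnn.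
Qed.

Lemma coef_chi d : chi`_d = \sum_(S <- L | adim S == d) whitney ambI hypI S.
Proof.
rewrite (arr_char_poly_mobius H_A ambI_neq0 amb_hyp) coef_sum [RHS]big_mkcond.
apply: eq_bigr => S _; rewrite coefZ coefXn eq_sym.
by case: eqP; rewrite ?mulr1 ?mulr0.
Qed.

(** The only flats containing [hypI i] are itself and the ambient space, and their values sum to
    0. *)
Lemma whitney_coatom i : whitney ambI hypI (hypI i) = -1.
Proof.
have := sum_whitney_above H_A (hypI_poset i) (hypI_neqV i).
rewrite -big_filter (perm_big [:: hypI i; ambI]) /=; last first.
  apply: uniq_perm; rewrite ?filter_uniq ?undup_uniq //= ?inE ?hypI_neqV // => T.
  rewrite mem_filter !inE; apply/andP/orP => [[/asboolP iT TL]|[/eqP->|/eqP->]].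
  - have [->|TV] := eqVneq T ambI; first by right.
    left; rewrite eq_sym; apply: contraT => niT.
    have := adim_lt (hypI_poset i) TL iT niT.
    by rewrite -ltnS adim_hypI ltnNge -ltnS -ltnS; have := adim_ltV TL TV; lia.
  - by split; [apply/asboolP | exact: hypI_poset].
  by split; [apply/asboolP; exact: hypI_sub | exact: ambI_poset].
rewrite !big_cons big_nil (whitney_V amb_hyp) addr0 => /eqP.
by rewrite addr_eq0 => /eqP.
Qed.

Lemma chi_coef_top : chi`_l = 1.
Proof.
rewrite coef_chi -(whitney_V amb_hyp) -big_filter.
rewrite (perm_big [:: ambI]) ?big_seq1 //; apply: uniq_perm;
  rewrite ?filter_uniq ?undup_uniq // => S.
rewrite mem_filter inE; apply/andP/eqP => [[/eqP Sl SL]|->]; last by rewrite ambI_poset.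
by apply/eqP; apply: contraT => /(adim_ltV SL); rewrite Sl ltnn.
Qed.

Lemma size_chi : size chi = l.+1.
Proof.
apply/eqP; rewrite eqn_leq; apply/andP; split; last first.
  by rewrite ltnNge; apply/negP => h; have := chi_coef_top; rewrite nth_default.
apply/leq_sizeP => d ltd; rewrite coef_chi -big_filter.
rewrite (_ : [seq _ <- _ | _] = [::]) ?big_nil //.
apply/eqP; rewrite -size_eq0 size_filter -leqn0 leqNgt -has_count;
  apply/negP => /hasP[S SL /eqP Sd].
have [SV|SV] := eqVneq S ambI; first by move: ltd; rewrite -Sd SV ltnn.
by have := adim_ltV SL SV; rewrite Sd => /(ltn_trans ltd); rewrite ltnn.
Qed.

Lemma chi_monic : chi \is monic.
Proof. by rewrite monicE lead_coefE size_chi chi_coef_top. Qed.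

Lemma chi_coef_subtop : (0 < l)%N -> chi`_l.-1 = - (size A)%:R.
Proof.
move=> l0; rewrite coef_chi -big_filter (perm_big A) /=; last first.
  apply: uniq_perm; rewrite ?filter_uniq ?undup_uniq // => S; rewrite mem_filter.
  apply/andP/idP => [[/eqP Sl SL]|SA].
    rewrite -poset_coatom // Sl eqxx /=; apply/eqP => SV.
    by move: Sl; rewrite SV; lia.
  have SL : S \in L by move: SA => /H_A[i ->]; exact: hypI_poset.
  by move: SA; rewrite -poset_coatom // => /andP[->].
rewrite (eq_big_seq (fun=> -1)) => [|S /H_A[i ->]]; last exact: whitney_coatom.
by rewrite big_const_seq count_predT iter_addr addr0 mulNrn.
Qed.

End IntegralArrangement.

Local Close Scope classical_set_scope.

(** * Arrangements of root systems *)

Section PolynomialIdentity.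
Variable R : rcfType.
Notation C := R[i].

Lemma primes_above (B k : nat) : exists s : seq nat,
  [/\ uniq s, size s = k & forall p, p \in s -> prime p /\ (B < p)%N].
Proof.
elim: k => [|k [s [us ss hs]]]; first by exists [::].
have [p ltp pp] := prime_above (maxn B (\max_(x <- s) x)).
rewrite gtn_max in ltp; case/andP: ltp => ltB lts.
exists (p :: s); split; rewrite /= ?ss ?us ?andbT //; last first.
  by move=> q; rewrite inE => /predU1P[->|/hs].
by apply/negP => ps; move: lts; rewrite ltnNge (@leq_bigmax_seq _ s xpredT id).
Qed.

Lemma poly_eq_on_primes (P Q : {poly C}) (B : nat) :
  (forall p, prime p -> (B < p)%N -> P.[p%:R] = Q.[p%:R]) -> P = Q.
Proof.
move=> h; apply/eqP; rewrite -subr_eq0; apply: contraT => nz.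
have [s [us ss hs]] := primes_above B (size (P - Q)%R).
have := max_poly_roots (rs := [seq p%:R | p <- s]) nz.
rewrite size_map ss ltnn => -> //.
  by apply/allP => _ /mapP[p /hs[pp lp] ->]; rewrite /root !hornerE h ?subrr.
by rewrite map_inj_uniq // => x y /eqP; rewrite eqr_nat => /eqP.
Qed.

Lemma horner_map_intr (chi : {poly int}) (p : nat) :
  (map_poly (intr : int -> C) chi).[p%:R] = (chi.[p%:R])%:~R.
Proof. by rewrite -[p%:R](rmorph_nat (intr : int -> C)) horner_map. Qed.

Lemma aligned_of_counts (chi : {poly int}) l (c : 'I_l.+1 -> nat) (a m B : nat) (N : nat -> nat) :
  (0 < m)%N -> chi != 0 -> (forall i, c i = 1%N \/ c i = 2%N) ->
  (forall i, c i = 1%N) \/ nshort c = 1%N \/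
    (nshort c = 2%N \/ nshort c = 4%N) /\ ~~ odd (a * cox c) ->
  (forall p, prime p -> (B < p)%N -> chi.[p%:R] = (N p)%:R) ->
  (forall p, prime p -> (B < p)%N -> (m ^ l * N p = count_sum c m a p)%N) ->
  aligned (map_poly (intr : int -> C) chi).
Proof.
move=> m0 chi0 c12 hc hchi hN.
have [G [Groots GE]] := @count_sum_operator R l c m m0 a c12 hc.
set X := map_poly _ chi.
have X0 : X != 0 by rewrite /X map_poly_eq0_id0 // intr_eq0 lead_coef_eq0.
(* Of the factor [m ^ l.+1], [m ^ l] comes from dividing the gaps by [m] and one [m] from the
   filter. *)
have E : (m ^ l.+1)%:R *: X = act G 'X^l.
  apply: (@poly_eq_on_primes _ _ (maxn B (maxn 2 (a * cox c + m * cox c)))) => p pp.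
  rewrite !gtn_max => /and3P[ltB lt2 ltc].
  rewrite -GE; [|by case: (even_prime pp) lt2 => // ->|exact: ltnW].
  rewrite hornerZ /X horner_map_intr hchi // -[((N p)%:R)%:~R]/(((N p)%:R : int)%:~R).
  by rewrite rmorph_nat -natrM -hN // mulnA -expnS.
have [e|] := aligned_act Groots (or_intror (alignedXn R l)).
  move: E; rewrite e => /eqP; rewrite scaler_eq0 (negPf X0) orbF pnatr_eq0.
  by rewrite expn_eq0 eqn0Ngt m0.
rewrite -E => -[r hr]; exists r => z rz; apply: hr.
by rewrite rootZ // pnatr_eq0 expn_eq0 eqn0Ngt m0.
Qed.

End PolynomialIdentity.

Definition unit_row (T : pzRingType) n (i : 'I_n) : 'rV[T]_n := \row_j (i == j)%:R.

(** An integral copy of [pos_roots], so that the same vectors can be read over the reals and modulo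
    [p]. *)
Definition int_roots (t : root_type) (n : nat) : seq 'rV[int]_n :=
  let minus := [seq unit_row int i - unit_row int j | i : 'I_n <- enum 'I_n,
                   j : 'I_n <- [seq j : 'I_n <- enum 'I_n | (i < j)%N]] in
  let plus := [seq unit_row int i + unit_row int j | i : 'I_n <- enum 'I_n,
                   j : 'I_n <- [seq j : 'I_n <- enum 'I_n | (i < j)%N]] in
  let short := [seq unit_row int i | i : 'I_n <- enum 'I_n] in
  let long := [seq 2%:R *: unit_row int i | i : 'I_n <- enum 'I_n] in
  match t with
  | TA => minus
  | TB => short ++ minus ++ plus
  | TC => long ++ minus ++ plus
  | TD => minus ++ plus
  | TBC => short ++ long ++ minus ++ plus
  end.

Definition has_plus t := if t is TA then false else true.
Definition has_short t := match t with TB | TBC => true | _ => false end.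
Definition has_long t := match t with TC | TBC => true | _ => false end.

Lemma int_rootsP t n (u : 'rV[int]_n) : u \in int_roots t n <->
  [\/ exists i j : 'I_n, (i < j)%N /\ u = unit_row int i - unit_row int j,
      has_plus t /\ exists i j : 'I_n, (i < j)%N /\ u = unit_row int i + unit_row int j,
      has_short t /\ exists i, u = unit_row int i
    | has_long t /\ exists i, u = 2%:R *: unit_row int i].
Proof.
have P (f : 'I_n -> 'I_n -> 'rV[int]_n) :
    u \in [seq f i j | i <- enum 'I_n, j <- [seq j : 'I_n <- enum 'I_n | (i < j)%N]] <->
    exists i j : 'I_n, (i < j)%N /\ u = f i j.
  split=> [/allpairsPdep[i [j [_]]]|[i [j [ij ->]]]].
    by rewrite mem_filter => /andP[ij _] ->; exists i, j.
  apply/allpairsPdep; exists i, j; split=> //; first by rewrite mem_enum.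
  by rewrite mem_filter ij mem_enum.
have Q (f : 'I_n -> 'rV[int]_n) : u \in [seq f i | i <- enum 'I_n] <-> exists i, u = f i.
  split=> [/mapP[i _ ->]|[i ->]]; first by exists i.
  by apply: map_f; rewrite mem_enum.
rewrite /int_roots; case: t; rewrite ?mem_cat /=; split.
- by move/P; constructor 1.
- by case=> [/P//|[]|[]|[]].
- by case/or3P => [/Q|/P|/P] h; [constructor 3|constructor 1|constructor 2].
- by case=> [/P ->|[_ /P ->]|[_ /Q ->]|[]//]; rewrite ?orbT.
- by case/or3P => [/Q|/P|/P] h; [constructor 4|constructor 1|constructor 2].
- by case=> [/P ->|[_ /P ->]|[]//|[_ /Q ->]]; rewrite ?orbT.
- by case/orP => /P h; [constructor 1|constructor 2].
- by case=> [/P ->|[_ /P ->]|[]//|[]//]; rewrite ?orbT.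
- by case/or4P => [/Q|/Q|/P|/P] h; [constructor 3|constructor 4|constructor 1|constructor 2].
by case=> [/P ->|[_ /P ->]|[_ /Q ->]|[_ /Q ->]]; rewrite ?orbT.
Qed.

Section IntDot.
Variables (F : pzRingType) (n : nat) (x : 'rV[F]_n).
Implicit Types u v : 'rV[int]_n.

Lemma intdot_unit i : intdot (unit_row int i 0) x = x 0 i.
Proof.
rewrite /intdot (bigD1 i) //= mxE eqxx mulr1 big1 ?addr0 // => j ji.
by rewrite mxE eq_sym (negPf ji) mulr0.
Qed.

Lemma intdotD u v : intdot ((u + v) 0) x = intdot (u 0) x + intdot (v 0) x.
Proof. by rewrite /intdot -big_split; apply: eq_bigr => j _; rewrite mxE rmorphD /= mulrDr. Qed.

Lemma intdotB u v : intdot ((u - v) 0) x = intdot (u 0) x - intdot (v 0) x.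
Proof. by rewrite /intdot -sumrB; apply: eq_bigr => j _; rewrite !mxE rmorphB /= mulrBr. Qed.

Lemma intdot2 u : intdot ((2%:R *: u) 0) x = intdot (u 0) x + intdot (u 0) x.
Proof. by rewrite -intdotD scaler_nat mulr2n. Qed.

End IntDot.

Lemma pos_rootsE (R : realType) t n :
  pos_roots R t n = [seq map_mx (intr : int -> R) u | u <- int_roots t n].
Proof.
have E i : map_mx (intr : int -> R) (unit_row int i) = evec R i :> 'rV_n.
  by apply/rowP => j; rewrite !mxE rmorph_nat.
have P (f : 'I_n -> 'I_n -> 'rV[R]_n) (g : 'I_n -> 'I_n -> 'rV[int]_n) :
    (forall i j, map_mx (intr : int -> R) (g i j) = f i j) ->
    [seq f i j | i <- enum 'I_n, j <- [seq j : 'I_n <- enum 'I_n | (i < j)%N]] =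
    [seq map_mx (intr : int -> R) u | u <-
      [seq g i j | i <- enum 'I_n, j <- [seq j : 'I_n <- enum 'I_n | (i < j)%N]]].
  move=> fg; rewrite map_flatten -map_comp; congr flatten; apply: eq_map => i /=.
  by rewrite -map_comp; apply: eq_map => j /=; rewrite fg.
have EB i j : map_mx (intr : int -> R) (unit_row int i - unit_row int j) =
  evec R i - evec R j :> 'rV_n.
  by rewrite map_mxB !E.
have ED i j : map_mx (intr : int -> R) (unit_row int i + unit_row int j) =
  evec R i + evec R j :> 'rV_n.
  by rewrite map_mxD !E.
rewrite /pos_roots /int_roots (P _ _ EB) (P _ _ ED).
have ES : [seq evec R i | i : 'I_n <- enum 'I_n] =
    [seq map_mx (intr : int -> R) u | u <- [seq unit_row int i | i : 'I_n <- enum 'I_n]].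
  by rewrite -[RHS]map_comp; apply: eq_map => i /=; rewrite E.
have EL : [seq 2%:R *: evec R i | i : 'I_n <- enum 'I_n] =
    [seq map_mx (intr : int -> R) u | u <- [seq 2%:R *: unit_row int i | i : 'I_n <- enum 'I_n]].
  rewrite -[RHS]map_comp; apply: eq_map => i /=; rewrite -E.
  by rewrite !scaler_nat !mulr2n map_mxD.
by case: t; rewrite ?ES ?EL ?map_cat.
Qed.

Lemma mem_int_range (c d k : int) : (k \in int_range c d) = (c <= k <= d).
Proof.
apply/mapP/idP => [[j]|ck]; first by rewrite mem_iota => /andP[_ li] ->; move: li; lia.
by exists `|k - c|%N; [rewrite mem_iota |]; lia.
Qed.

Section RootArrangement.
Variables (t : root_type) (n a b : nat).
Hypotheses (n_ge2 : (2 <= n)%N) (ab_gt0 : (0 < a + b)%N) (ab : (a <= b)%N).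

Definition amb_form (i : 'I_n) : int := if t is TA then 1 else 0.

(** Equations are listed before coinciding hyperplanes are merged: whether two of them define the
    same set is never decided, as repetitions are harmless for the Whitney sum. *)
Definition hyp_data : seq ('rV[int]_n * int) :=
  [seq (u, k) | u <- int_roots t n, k <- int_range (1 - a%:Z) b%:Z].

Definition normal_of (i : 'I_(size hyp_data)) (j : 'I_n) : int := (nth (0, 0) hyp_data i).1 0 j.
Definition level_of (i : 'I_(size hyp_data)) : int := (nth (0, 0) hyp_data i).2.

Lemma hyp_dataP (u : 'rV[int]_n) (k : int) : u \in int_roots t n -> 1 - a%:Z <= k <= b%:Z ->
  exists i, normal_of i = u 0 /\ level_of i = k.
Proof.
move=> ur kr; have d : (u, k) \in hyp_data by apply: allpairs_f; rewrite ?mem_int_range.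
have lti : (index (u, k) hyp_data < size hyp_data)%N by rewrite index_mem.
by exists (Ordinal lti); rewrite /normal_of /level_of /= nth_index.
Qed.

Lemma hyp_dataE i : exists u, [/\ u \in int_roots t n,
  normal_of i = u 0 & 1 - a%:Z <= level_of i <= b%:Z].
Proof.
have /allpairsP[[u k] /= [ur kr e]] := mem_nth (0, 0) (ltn_ord i).
by exists u; rewrite /normal_of /level_of e -mem_int_range.
Qed.

Lemma good_pointsE (F : finFieldType) (x : 'rV[F]_n) :
  x \in good_points amb_form normal_of level_of F <->
  intdot amb_form x = 0 /\ forall (u : 'rV[int]_n) k,
    u \in int_roots t n -> 1 - a%:Z <= k <= b%:Z ->
    intdot (u 0) x != k%:~R.
Proof.
rewrite inE; split=> [/andP[/eqP x0 /forallP hx]|[x0 hx]].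
  by split=> // u k ur kr; have [i [<- <-]] := hyp_dataP ur kr.
apply/andP; split; first exact/eqP.
by apply/forallP => i; have [u [ur -> kr]] := hyp_dataE i; apply: hx.
Qed.

Lemma int_roots_amb (T : pzRingType) (u : 'rV[int]_n) : u \in int_roots t n ->
  \sum_j amb_form j * u 0 j = 0.
Proof.
rewrite /amb_form => /int_rootsP; case: (t); try by move=> _; rewrite big1 // => j _; rewrite mul0r.
case=> [[i [j [_ ->]]]|[]//|[]//|[]//].
under eq_bigr do rewrite mul1r !mxE.
rewrite sumrB (bigD1 i) //= eqxx big1 ?addr0 => [|k ki]; last by rewrite eq_sym (negPf ki).
rewrite (bigD1 j) //= eqxx big1 ?addr0 ?subrr // => k kj.
by rewrite eq_sym (negPf kj).
Qed.

Lemma int_roots_neq0 (u : 'rV[int]_n) : u \in int_roots t n -> exists i, u 0 i != 0.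
Proof.
move=> /int_rootsP[[i [j [ij ->]]]|[_ [i [j [ij ->]]]]|[_ [i ->]]|[_ [i ->]]]; exists i;
  rewrite !mxE eqxx ?mulr1 // -val_eqE /= gtn_eqF //.
Qed.

Variable R : realType.
Notation A := (arrangement R t n (1 - a%:Z) b%:Z).
Notation V := (ambient R t n).
Notation hyp := (hypI (R := R) amb_form normal_of level_of).

Notation ambV := (ambI (R := R) amb_form).

Lemma ambientE : V = ambV.
Proof.
apply/seteqP; rewrite /ambI /amb_form /intdot; split=> x /=.
  case: t => /= hx; try by rewrite big1 // => j _; rewrite mulr0z mulr0.
  by rewrite -[RHS]hx; apply: eq_bigr => j _; rewrite mulr1z mulr1.
by case: t => //= hx; rewrite -[RHS]hx; apply: eq_bigr => j _; rewrite mulr1z mulr1.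
Qed.

Lemma dotv_int (u : 'rV[int]_n) (x : 'rV[R]_n) : dotv (map_mx (intr : int -> R) u) x =
  intdot (u 0) x.
Proof. by apply: eq_bigr => j _; rewrite mxE mulrC. Qed.

Lemma arrangementP X : X \in A <-> exists i, X = hyp i.
Proof.
have E (u : 'rV[int]_n) (k : int) i : normal_of i = u 0 -> level_of i = k ->
    [set x | V x /\ dotv (map_mx (intr : int -> R) u) x = k%:~R]%classic = hyp i.
  move=> e1 e2; rewrite /hypI -ambientE e1 e2.
  by apply/seteqP; split=> x [x0 hx]; split=> //; move: hx; rewrite /= dotv_int.
rewrite mem_undup; split=> [/allpairsP[[v k] /= [+ kr ->]]|[i ->]].
  rewrite pos_rootsE => /mapP[u ur ->]; rewrite mem_int_range in kr.
  by have [i [e1 e2]] := hyp_dataP ur kr; exists i; apply: E.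
have [u [ur e1 kr]] := hyp_dataE i; rewrite -(E u (level_of i) i) //.
apply/allpairsP; exists (map_mx (intr : int -> R) u, level_of i); split=> //=.
  by rewrite pos_rootsE map_f.
by rewrite mem_int_range.
Qed.

(** The root itself serves: it lies in the ambient space and has positive square norm, so its
    multiples reach every level. *)
Lemma multiple_in_hyp i : exists2 u : 'rV[R]_n, ambV u & intdot (normal_of i) u != 0.
Proof.
have [u [ur e _]] := hyp_dataE i; exists (map_mx intr u).
  rewrite /ambI /= /intdot -[RHS](mulr0z 1) -(int_roots_amb R ur).
  rewrite (raddf_sum (intr : {additive int -> R})); apply: eq_bigr => j _.
  by rewrite mxE /= mulrC rmorphM.
rewrite e /intdot; have [j uj] := int_roots_neq0 ur.
rewrite (bigD1 j) //= mxE gt_eqF // ltr_pwDl //.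
  by rewrite -expr2 exprn_even_gt0 //= intr_eq0.
by apply: sumr_ge0 => i' _; rewrite mxE -expr2 sqr_ge0.
Qed.

Lemma intdotZ (f : 'I_n -> int) z (u : 'rV[R]_n) : intdot f (z *: u) = z * intdot f u.
Proof. by rewrite /intdot mulr_sumr; apply: eq_bigr => j _; rewrite mxE mulrA. Qed.

Lemma hyp_neq0 i : (hyp i !=set0)%classic.
Proof.
have [u u0 hu] := multiple_in_hyp i.
exists (((level_of i)%:~R / intdot (normal_of i) u) *: u); split.
  by move: u0; rewrite /ambI /= intdotZ => ->; rewrite mulr0.
by rewrite /= intdotZ divfK.
Qed.

Lemma amb_not_hyp i : ~ (ambV `<=` hyp i)%classic.
Proof.
have [u u0 hu] := multiple_in_hyp i =>
  /(_ ((((level_of i)%:~R + 1) / intdot (normal_of i) u) *: u)).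
case; first by move: u0; rewrite /ambI /= intdotZ => ->; rewrite mulr0.
move=> _; rewrite /= intdotZ divfK // => /eqP.
by rewrite -subr_eq0 addrC addKr oner_eq0.
Qed.

Lemma adim_ambient : adim (ambV) = ambient_dim t n.
Proof.
pose M : 'M[R]_(n, 1) := \col_j (amb_form j)%:~R.
have VE : ambV = affset M 0.
  apply/seteqP; split=> x; rewrite /affset /ambI /= /intdot => hx.
    by apply/rowP => i; rewrite !mxE -[RHS]hx; apply: eq_bigr => j _; rewrite mxE.
  have := congr1 (fun B : 'M_1 => B 0 0) hx; rewrite !mxE => e; rewrite -[RHS]e.
  by apply: eq_bigr => j _; rewrite mxE.
rewrite VE adim_affset; last by exists 0; rewrite /affset /= mul0mx.
have [eA|eA] : t = TA \/ M = 0.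
  by rewrite /M /amb_form; case: t; [left | right | right | right | right] => //;
    apply/matrixP => i j; rewrite !mxE.
- have -> : \rank M = 1%N.
    apply/eqP; rewrite eqn_leq rank_leq_col lt0n mxrank_eq0.
    have i0 : 'I_n by apply: (@Ordinal n 0); lia.
    apply/eqP => /matrixP/(_ i0 0); rewrite !mxE /amb_form eA => /eqP.
    by rewrite oner_eq0.
  by rewrite eA subn1.
rewrite eA mxrank0 subn0; move: eA; rewrite /ambient_dim; case E: t => // eA.
have i0 : 'I_n by apply: (@Ordinal n 0); lia.
have := congr1 (fun B : 'M[R]_(n, 1) => B i0 0) eA; rewrite !mxE /amb_form E => /eqP.
by rewrite oner_eq0.
Qed.

End RootArrangement.

Section GoodPoints.
Variables (a b p : nat).

Notation good t n := (good_points (amb_form t (n := n)) (normal_of (t := t) (n := n)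
    (a := a) (b := b))
  (level_of (t := t) (n := n) (a := a) (b := b)) 'F_p).

Lemma good_signed t n1 : t <> TA ->
  #|good t n1.+1| = #|[pred x : 'rV['F_p]_n1.+1 | `[< signed_good (has_short t)
    (has_long t) a b x >]]|.
Proof.
move=> tA; apply: eq_card => x; rewrite [RHS]inE.
have pl : has_plus t by case: t tA.
apply/idP/asboolP => [/good_pointsE[_ hx] k kr|hx].
  split=> [i j ij|lg i|sh i].
  - rewrite -!intdot_unit -intdotB -intdotD; split; apply: hx => //; apply/int_rootsP.
      by constructor 1; exists i, j.
    by constructor 2; split=> //; exists i, j.
  - rewrite -!intdot_unit -intdot2; apply: hx => //; apply/int_rootsP.
    by constructor 4; split=> //; exists i.
  rewrite -!intdot_unit; apply: hx => //; apply/int_rootsP.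
  by constructor 3; split=> //; exists i.
apply/good_pointsE; split.
  by rewrite /intdot big1 // => j _; rewrite /amb_form; case: t tA {hx pl} => // _;
    rewrite mulr0z mulr0.
move=> u k /int_rootsP hu /hx[hp hl hs].
case: hu => [[i [j [ij ->]]]|[_ [i [j [ij ->]]]]|[sh [i ->]]|[lg [i ->]]].
- by rewrite intdotB !intdot_unit (hp _ _ ij).1.
- by rewrite intdotD !intdot_unit (hp _ _ ij).2.
- by rewrite intdot_unit hs.
by rewrite intdot2 intdot_unit hl.
Qed.

Lemma good_cyclic n0 :
  #|good TA n0.+2| = #|[pred x : 'rV['F_p]_n0.+2 | `[< cyclic_good a b x >]]|.
Proof.
apply: eq_card => x; rewrite [RHS]inE.
have E : intdot (amb_form TA (n := n0.+2)) x = \sum_i x 0 i.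
  by apply: eq_bigr => j _; rewrite /amb_form mulr1z mulr1.
apply/idP/asboolP => [/good_pointsE[x0 hx]|[x0 hx]].
  split; first by rewrite -E.
  move=> k kr i j ij; rewrite -!intdot_unit -intdotB; apply: hx => //; apply/int_rootsP.
  by constructor 1; exists i, j.
apply/good_pointsE; split; first by rewrite E.
move=> u k /int_rootsP[[i [j [ij ->]]]|[]//|[]//|[]//] kr.
by rewrite intdotB !intdot_unit; apply: hx.
Qed.

(* D_2 = A_1 x A_1 is reducible, so its alcoves are not simplices; it is
   handled by the coordinates [x_0 - x_1] and [x_0 + x_1]. *)
Lemma good_D2 : prime p -> odd p -> (a + b < p)%N -> #|good TD 2| = ((p - (a + b)) ^ 2)%N.
Proof.
move=> pp op ltp; rewrite (@good_signed TD 1) //.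
(* The [a + b] forbidden levels are distinct residues because [a + b < p], so each of the two
   coordinates has [p - (a + b)] free values. *)
pose kk (i : 'I_(a + b)) : 'F_p := (1 - a%:Z + i%:Z)%:~R.
have kk_inj : injective kk.
  move=> i j /eqP; rewrite intr_Fp_eq // => /dvdzP[q hq]; apply: ord_inj.
  have := ltn_ord i; have := ltn_ord j; move: (i : nat) (j : nat) hq => {i j} i j hq hi hj.
  have h1 : q < 1 by nia.
  have h2 : -1 < q by nia.
  have q0 : q = 0 by lia.
  by move: hq; rewrite q0; lia.
pose S : {set 'F_p} := (~: [set kk i | i : 'I_(a + b)])%SET.
have cS : #|S| = (p - (a + b))%N.
  by rewrite cardsCs finset.setCK card_Fp // card_imset // card_ord.
have SP (v : 'F_p) : v \in S <-> forall k : int, 1 - a%:Z <= k <= b%:Z -> v != k%:~R.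
  rewrite inE; split=> [nv k kr|hv]; last first.
    apply/imsetP => -[i _ e]; have := hv (1 - a%:Z + i%:Z); rewrite e /kk eqxx.
    by have := ltn_ord i; move: (i : nat) => {i e} i li /(_ _)/negP; apply => //; lia.
  apply: contraNneq nv => ->; apply/imsetP.
  have li : (absz (k - (1 - a%:Z))%R < a + b)%N by lia.
  by exists (Ordinal li) => //; rewrite /kk /=; congr (_ %:~R); lia.
have two0 := two_Fp_neq0 pp op.
pose i0 : 'I_2 := ord0; pose i1 : 'I_2 := lift ord0 ord0.
rewrite -mulnn -cS -cardsX.
pose f (x : 'rV['F_p]_2) := (x 0 i0 - x 0 i1, x 0 i0 + x 0 i1).
pose g (v : 'F_p * 'F_p) : 'rV['F_p]_2 :=
  \row_i (if i == i0 then (v.1 + v.2) / 2%:R else (v.2 - v.1) / 2%:R).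
apply: card_is_uniq (card_is_fin _).
apply: (card_is_bij (f := f) (g := g)) (card_is_fin _) => [x|[u v]].
  move=> hx0; have {hx0} hx : signed_good false false a b x by apply/asboolP.
  split.
    rewrite inE /=; apply/andP; split; apply/SP => k kr; have [hp _ _] := hx k kr.
      exact: (hp i0 i1 isT).1.
    exact: (hp i0 i1 isT).2.
  apply/rowP => i; rewrite mxE /=.
  have [->|ii] := eqVneq i i0; first by field.
  have -> : i = i1 by apply: ord_inj; case: i ii => [[|[|//]]].
  by field.
rewrite inE => /andP[/= /SP hu /SP hv]; split.
  suff : signed_good false false a b (g (u, v)) by move=> h; apply/asboolP.
  move=> k kr; split=> // i j.
  case: i => [[|[|//]] hi]; case: j => [[|[|//]] hj] // _; rewrite !mxE /=.
  have -> : (u + v) / 2%:R - (v - u) / 2%:R = u by field.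
  have -> : (u + v) / 2%:R + (v - u) / 2%:R = v by field.
  by split; [apply: hu | apply: hv].
by rewrite /f !mxE /=; congr (_, _); field.
Qed.

End GoodPoints.

Lemma aligned_chi (R : rcfType) t n a b B (chi : {poly int}) :
  (2 <= n)%N -> (a <= b)%N -> chi != 0 ->
  (forall p, prime p -> (B < p)%N -> chi.[p%:R] =
    #|good_points (amb_form t (n := n)) (normal_of (t := t) (n := n) (a := a) (b := b))
        (level_of (t := t) (n := n) (a := a) (b := b)) 'F_p|%:R) ->
  aligned (map_poly (intr : int -> R[i]) chi).
Proof.
move=> n2 ab chi0 hB.
have odd_p p : prime p -> (2 < p)%N -> odd p by move=> /even_prime[->|].
have m0 : (0 < b + 1 - a)%N by lia.
have [tA|/eqP tA] := eqVneq (if t is TA then true else false) true.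
  have tE : t = TA by case: t tA {hB}.
  case: n n2 hB => [|[|n0]] // _; rewrite tE => hB.
  pose c (_ : 'I_n0.+2) := 1%N.
  apply: (@aligned_of_counts R chi n0.+1 c a (b + 1 - a)
    (maxn B (n0.+2 + (a * cox c + (b + 1 - a) * cox c + (b + 1 - a)))) _ m0 chi0) => //.
  - by move=> i; left.
  - by left.
  - by move=> p pp; rewrite gtn_max => /andP[ltB _]; apply: hB.
  move=> p pp; rewrite gtn_max => /andP[_ ltp].
  rewrite good_cyclic cyclic_count_sum //; first by apply: leq_ltn_trans ltp; exact: leq_addr.
  by apply: leq_trans (ltnW ltp); exact: leq_addl.
have {}tA : t <> TA by move=> tE; rewrite tE in tA.
case: n n2 hB => [|n1] // n2 hB.
have n1_gt0 : (0 < n1)%N by [].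
case: (boolP [&& ~~ has_short t, ~~ has_long t & n1 == 1%N]) => [/and3P[sh lg /eqP n11]|nD].
  have tE : t = TD by case: t tA sh lg {hB}.
  subst n1 t.
  have E : map_poly (intr : int -> R[i]) chi = ('X - ((a + b)%:R)%:P) ^+ 2.
    apply: (@poly_eq_on_primes _ _ _ (maxn B (maxn 2 (a + b)))) => p pp.
    rewrite !gtn_max => /and3P[ltB lt2 ltp].
    rewrite horner_map_intr hB // good_D2 //; last exact: odd_p.
    by rewrite !hornerE rmorph_nat natrX natrB // ltnW.
  rewrite E; exists (a + b)%:R => z;
    rewrite /root horner_exp expf_eq0 /= !hornerE subr_eq0 => /eqP ->.
  by rewrite -(rmorph_nat (real_complex R)).
have n1_gt1 : ~~ has_short t -> ~~ has_long t -> (1 < n1)%N.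
  by move=> sh lg; move: nD; rewrite sh lg /= ltn_neqAle eq_sym n1_gt0 => ->.
pose c (i : 'I_n1.+2) := weight (has_short t) (has_long t) n1 i.
have c12 i : c i = 1%N \/ c i = 2%N := weight12 _ _ _ _.
have ns := nshort_weight n1_gt0 n1_gt1; rewrite -/c in ns.
apply: (@aligned_of_counts R chi n1.+1 c a (b + 1 - a)
  (maxn B (2 + (a * cox c + (b + 1 - a) * cox c + (b + 1 - a)))) _ m0 chi0 c12).
(* Type BC has a single mark 1; types B, C and D have two or four, and then [cox] is even. *)
- right; rewrite oddM (odd_cox c12) ns.
  by case: (has_short t); case: (has_long t); [left | right | right | right]; rewrite ?andbF;
    split; auto.
- by move=> p pp; rewrite gtn_max => /andP[ltB _]; apply: hB.
move=> p pp; rewrite gtn_max => /andP[_ ltp].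
rewrite good_signed // signed_count_sum //.
  by apply: odd_p => //; apply: leq_ltn_trans ltp; exact: leq_addr.
by apply: leq_trans (ltnW ltp); exact: leq_addl.
Qed.

Theorem theorem1p2 (R : realType) (t : root_type) (n a b : nat) :
  (2 <= n)%N -> (0 < a + b)%N -> (a <= b)%N ->
  let A := arrangement R t n (1 - a%:Z) b%:Z in
  let h := size A in
  let l := ambient_dim t n in
  forall z : R[i],
    root (map_poly (fun k : int => k%:~R) (arr_char_poly (ambient R t n) A)) z ->
    complex.Re z = h%:R / l%:R.
Proof.
move=> n2 ab0 ab A h l.
set chi := arr_char_poly _ _.
have chiE : chi = arr_char_poly (ambI (R := R) (amb_form t (n := n))) A by rewrite /chi ambientE.
have hA := @arrangementP t n a b R.
have hne := @hyp_neq0 t n a b R; have hnv := @amb_not_hyp t n a b R.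
have dimV := @adim_ambient t n a b n2 ab0 ab R.
have size_chi' : size chi = l.+1 by rewrite chiE (size_chi hA hnv) dimV.
have monic_chi : chi \is monic by rewrite chiE (chi_monic hA hnv).
have l0 : (0 < l)%N by rewrite /l /ambient_dim; case: (t); lia.
have sub_chi : chi`_l.-1 = - (h%:R).
  by rewrite chiE /l -dimV (chi_coef_subtop (undup_uniq _) hA hne hnv) ?dimV.
have chi0 : chi != 0 by rewrite -size_poly_eq0 size_chi'.
have [B hB] := finite_field_method hA hnv; rewrite -chiE in hB.
have al : aligned (map_poly (intr : int -> R[i]) chi).
  exact: aligned_chi n2 ab chi0 hB.
move=> z; apply: aligned_sum_roots => //.
- exact: monic_map.
- by rewrite size_map_poly_id0 // (monicP monic_chi) oner_eq0.
by rewrite coef_map /= sub_chi mulrNz (rmorph_nat (real_complex R))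
  -(rmorph_nat (intr : int -> R[i])).
Qed.
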